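(* Suppose that Assumptions A1 through A4 (listed in the context) hold, and that $h=o(1)$ and $nh^2\to\infty$ as $n\to\infty$. Then $$\bigl\|\widehat f_{n,\lambda}-f_0-S_{n,\lambda}(f_0)\bigr\|=O_P(a_n\log n),$$ where $S_{n,\lambda}(f_0)=\frac1n\sum_{i=1}^n\epsilon_iR_{U_i}-P_\lambda f_0$ with $\epsilon_i=\dot\ell_a(Y_i;X_i^T\theta_0+g_0(Z_i))$, and $$a_n=n^{-1/2}\bigl((nh)^{-1/2}+h^m\bigr)h^{-(6m-1)/(4m)}(\log\log n)^{1/2}+C_\ell h^{-1/2}\bigl((nh)^{-1}+h^{2m}\bigr)/\log n,$$ $$C_\ell=\sup_{u\in\mathcal U}E\Bigl\{\sup_{a\in\mathcal I}|\ell'''_a(Y;a)|\,\Big|\,U=u\Bigr\}.$$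
   Context: Setting. $\mathbb I=[0,1]$, $\mathcal U=\mathbb I^p\times\mathbb I$. $T_i=(Y_i,X_i,Z_i)$, $1\le i\le n$, are i.i.d. copies of $T=(Y,X,Z)$ with $Y\in\mathcal Y\subseteq\mathbb R$, $U=(X,Z)\in\mathcal U$, $U_i=(X_i,Z_i)$; the density $\pi$ of $Z$ is bounded above and bounded away from $0$ on $[0,1]$. The model is $E(Y|U)=F(X^T\theta_0+g_0(Z))$ with known link $F$. The criterion function $\ell(y;a):\mathcal Y\times\mathbb R\to\mathbb R$ is either the log-likelihood $\log p(y;F(a))$ (where $p(\cdot;F(X^T\theta_0+g_0(Z)))$ is the conditional density of $Y$ given $U$) or the quasi-likelihood $Q(y;F(a))$, $Q(y;\mu)=\int_y^\mu (y-s)/\mathcal V(s)\,ds$, where $\mathrm{Var}(Y|U)=\mathcal V(E(Y|U))$ with $\mathcal V>0$ known. $\dot\ell_a,\ddot\ell_a,\ell'''_a$ are the first three derivatives of $\ell$ in $a$. Function spaces. $m>1/2$ is a known (integer) order; $H^m(\mathbb I)$ is the set of $g:\mathbb I\to\mathbb R$ with $g^{(j)}$ absolutely continuous for $0\le j\le m-1$ and $g^{(m)}\in L_2(\mathbb I)$. $\mathcal H=\mathbb R^p\times H^m(\mathbb I)$; $\mathcal H$ may alternatively denote $\mathbb R^p\times H_0^m(\mathbb I)$, where $H_0^m(\mathbb I)=\{g\in H^m(\mathbb I): g^{(j)}(0)=g^{(j)}(1),\,0\le j\le m-1\}$, in which case $H_0^m(\mathbb I)$ replaces $H^m(\mathbb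 I)$ everywhere. $f_0=(\theta_0,g_0)\in\mathcal H$; $f=(\theta,g)$ is identified with the function $f(x,z)=x^T\theta+g(z)$ on $\mathcal U$. $J(g,\tilde g)=\int_{\mathbb I}g^{(m)}\tilde g^{(m)}dz$. The smoothing parameter $\lambda=\lambda_n>0$ tends to $0$, and $h=\lambda^{1/(2m)}$. Estimator. $\widehat f_{n,\lambda}=(\widehat\theta_{n,\lambda},\widehat g_{n,\lambda})$ maximizes $\ell_{n,\lambda}(f)=\frac1n\sum_{i=1}^n\ell(Y_i;X_i^T\theta+g(Z_i))-\frac\lambda2J(g,g)$ over $f\in\mathcal H$. RKHS notation. $I(U)=-E(\ddot\ell_a(Y;X^T\theta_0+g_0(Z))|U)$, $B(Z)=E\{I(U)|Z\}$, $V(g,\tilde g)=E\{B(Z)g(Z)\tilde g(Z)\}$, $\langle g,\tilde g\rangle_1=V(g,\tilde g)+\lambda J(g,\tilde g)$ with norm $\|\cdot\|_1$. On $\mathcal H$: $\langle(\theta,g),(\tilde\theta,\tilde g)\rangle=E\{I(U)(X^T\theta+g(Z))(X^T\tilde\theta+\tilde g(Z))\}+\lambda J(g,\tilde g)$, with norm $\|\cdot\|$. For $u=(x,z)\in\mathcal U$, $R_u\in\mathcal H$ is the element with $\langle R_u,f\rangle=x^T\theta+g(z)$ for all $f=(\theta,g)\in\mathcal H$; $P_\lambda:\mathcal H\to\mathcal H$ is the linear operator with $\langle P_\lambda f,\tilde f\rangle=\lambda J(g,\tilde g)$ for all $f=(\theta,g),\tilde f=(\tilde\theta,\tilde g)\in\mathcal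 H$. $G(Z)=(G_1,\dots,G_p)^T(Z)=E\{I(U)X|Z\}/B(Z)$ and $\Omega=E\{I(U)(X-G(Z))(X-G(Z))^T\}$. Assumption A1. Let $\mathcal I_0$ be the (compact interval) range of $f_0$ on $\mathcal U$. (a) $\ell(y;a)$ is three times continuously differentiable and concave in $a$; there are a bounded open interval $\mathcal I\supset\mathcal I_0$ and constants $C_0,C_1>0$ with $E\{\exp(\sup_{a\in\mathcal I}|\ddot\ell_a(Y;a)|/C_0)|U\}\le C_1$ and $E\{\exp(\sup_{a\in\mathcal I}|\ell'''_a(Y;a)|/C_0)|U\}\le C_1$ a.s. (b) There is $C_2>0$ with $C_2^{-1}\le I(U)\le C_2$ a.s. (c) $\epsilon=\dot\ell_a(Y;X^T\theta_0+g_0(Z))$ satisfies $E(\epsilon|U)=0$, $E(\epsilon^2|U)=I(U)$ a.s. and $E(\epsilon^4)<\infty$. Assumption A2. There are real functions $h_\nu\in H^m(\mathbb I)$, $\nu\in\mathbb N=\{0,1,\dots\}$, with $\sup_\nu\sup_z|h_\nu(z)|<\infty$, and a nondecreasing real sequence $\gamma_\nu\asymp\nu^{2m}$ with $V(h_\mu,h_\nu)=\delta_{\mu\nu}$, $J(h_\mu,h_\nu)=\gamma_\mu\delta_{\mu\nu}$; every $g\in H^m(\mathbb I)$ satisfies $g=\sum_\nu V(g,h_\nu)h_\nu$ in $\|\cdot\|_1$. ($a_\mu\asymp b_\mu$ means the ratio tends to a strictly positive constant.) Assumption A3. $G_1,\dots,G_p$ have finite second moments under the law of $Z$, and $\Omega$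 is positive definite. Assumption A4. $\|\widehat f_{n,\lambda}-f_0\|=O_P((nh)^{-1/2}+h^m)$. *)

(* Defs.v *)
From HB Require Import structures.
From mathcomp Require Import all_boot all_order all_algebra.
From mathcomp Require Import all_classical all_reals all_analysis measurable_realfun.

Set Implicit Arguments.
Unset Strict Implicit.
Unset Printing Implicit Defensive.

Import Order.TTheory GRing.Theory Num.Theory.
Import numFieldNormedType.Exports.
Local Open Scope classical_set_scope.
Local Open Scope ring_scope.

Section sobolev.
Context {R : realType}.
Implicit Types g : R -> R.

(* Functions on [0,1] are total functions on R whose values outside [0,1] are
   never used.  In particular [dI g] is the derivative of the restriction of g
   to [0,1], one-sided at the end points. *)
Definition quotI g (x y : R) : R := (g y - g x) / (y - x).

Definition derivableI g (x : R) : Prop :=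
  cvg (quotI g x y @[y --> within `[0, 1] x^']).

Definition dI g (x : R) : R := lim (quotI g x y @[y --> within `[0, 1] x^']).

Definition dIn (j : nat) g : R -> R := iter j dI g.

Definition abs_contI g : Prop :=
  forall e : R, 0 < e -> exists2 d : R, 0 < d &
    forall (k : nat) (a b : 'I_k -> R),
      (forall i, 0 <= a i /\ a i <= b i /\ b i <= 1) ->
      (forall i j, i != j -> `]a i, b i[ `&` `]a j, b j[ = set0) ->
      \sum_(i < k) (b i - a i) < d -> \sum_(i < k) `|g (b i) - g (a i)| < e.

(* For j < m - 1 the derivative of g^(j) exists everywhere on [0,1]; g^(m) is
   only the almost everywhere derivative of the absolutely continuous function
   g^(m-1) (the junk value of [lim] is taken on a null set). *)
Definition sobolev (m : nat) g : Prop :=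
  [/\ forall j, (j < m)%N -> abs_contI (dIn j g),
      forall j x, (j.+1 < m)%N -> 0 <= x <= 1 -> derivableI (dIn j g) x,
      measurable_fun (`[0, 1] : set R) (dIn m g) &
      (\int[lebesgue_measure]_(z in `[0%R, 1%R]) ((dIn m g z) ^+ 2)%:E < +oo)%E].

Definition sobolev_periodic (m : nat) g : Prop :=
  sobolev m g /\ forall j, (j < m)%N -> dIn j g 0 = dIn j g 1.

(* H^m if [per] is false, and H^m_0 if [per] is true *)
Definition Hm (per : bool) (m : nat) g : Prop :=
  if per then sobolev_periodic m g else sobolev m g.

Definition J (m : nat) g1 g2 : R :=
  \int[lebesgue_measure]_(z in `[0, 1]) (dIn m g1 z * dIn m g2 z).

End sobolev.

Section probability_notions.
Context d {Om : measurableType d} {R : realType} (P : probability Om R).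

(* w is a version of u |-> E(V | W = u); V is nonnegative or integrable *)
Definition is_cexp d' (S : measurableType d') (W : Om -> S)
    (V : Om -> \bar R) (w : S -> \bar R) : Prop :=
  [/\ measurable_fun setT V,
      (forall o, 0 <= V o)%E \/ P.-integrable setT V,
      measurable_fun setT w &
      forall B, measurable B ->
        (\int[P]_(o in W @^-1` B) w (W o) = \int[P]_(o in W @^-1` B) V o)%E].

Definition cexp_ae_eq d' (S : measurableType d') (W : Om -> S)
    (V E : Om -> \bar R) : Prop :=
  exists2 w, is_cexp W V w & {ae P, forall o, w (W o) = E o}.

Definition cexp_ae_le d' (S : measurableType d') (W : Om -> S)
    (V : Om -> \bar R) (c : R) : Prop :=
  exists2 w, is_cexp W V w & {ae P, forall o, (w (W o) <= c%:E)%E}.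

Definition iid_copies d' (S : measurableType d') (T : Om -> S)
    (Ts : nat -> Om -> S) : Prop :=
  (forall i A, measurable A -> P (Ts i @^-1` A) = P (T @^-1` A)) /\
  (forall n (A : 'I_n -> set S), (forall i, measurable (A i)) ->
     P (\bigcap_(i in [set: 'I_n]) Ts i @^-1` A i) =
     (\prod_(i < n) P (Ts i @^-1` A i))%E).

(* W_n = O_P(r_n).  The outer measure makes sense of it without measurability
   of W_n (which involves suprema over function classes and argmaxima). *)
Definition OP (W : nat -> Om -> R) (r : nat -> \bar R) : Prop :=
  forall e : R, (0 < e)%R -> exists2 M : R, 0 < M &
    \forall n \near \oo,
      (mu_ext P [set o | M%:E * r n < (W n o)%:E] <= e%:E)%E.

End probability_notions.

(* covariates u = (x, z), observations t = (y, u), parameters f = (theta, g);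
   R^o is R with its structure of vector space over itself *)
Notation cov R p := (p.-tuple R * R)%type.
Notation obs R p := (R * cov R p)%type.
Notation par R p := ('rV[R]_p * (R -> R^o))%type.

Section model.
Context {R : realType} {p : nat}.
Implicit Types (f : par R p) (u : cov R p).

Definition Ucal : set (cov R p) :=
  [set u | (forall k, 0 <= tnth u.1 k <= 1) /\ 0 <= u.2 <= 1].

(* f = (theta, g) as a function of u = (x, z) *)
Definition ev f u : R := \sum_(k < p) tnth u.1 k * f.1 0 k + f.2 u.2.

Definition Hpar (per : bool) (m : nat) : set (par R p) :=
  [set f | Hm per m f.2].

(* integral from a to b, with the usual sign when b < a *)
Definition orient_int (F : R -> R) (a b : R) : R :=
  if a <= b then \int[lebesgue_measure]_(s in `[a, b]) F s
  else - \int[lebesgue_measure]_(s in `[b, a]) F s.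

Definition supabs_deriv (ell : R -> R -> R) (lo hi : R) (k : nat) (y : R) :
    \bar R :=
  ereal_sup [set `|derive1n k (ell y) a|%:E | a in `]lo, hi[].

(* penalised criterion based on the first n observations *)
Definition pen_crit (ell : R -> R -> R) (lam : R) (m n : nat)
    (ts : nat -> obs R p) f : R :=
  n%:R^-1 * \sum_(i < n) ell (ts i).1 (ev f (ts i).2)
  - lam / 2 * J m f.2 f.2.

Definition is_maximizer (D : set (par R p))
    (L : par R p -> R) f : Prop :=
  D f /\ forall f', D f' -> L f' <= L f.

Section law.
Context {d} {Om : measurableType d} (P : probability Om R).
Context (T : Om -> obs R p).

Let Y (o : Om) : R := (T o).1.
Let U (o : Om) : cov R p := (T o).2.
Let X (k : 'I_p) (o : Om) : R := tnth (T o).2.1 k.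
Let Z (o : Om) : R := (T o).2.2.

Definition Z_has_density : Prop :=
  exists (dens : R -> R) (c C : R),
    [/\ measurable_fun setT dens, 0 < c,
        forall z, 0 <= z <= 1 -> c <= dens z <= C &
        forall A : set R, measurable A ->
          P (Z @^-1` A) =
          (\int[lebesgue_measure]_(z in A `&` `[0%R, 1%R]) (dens z)%:E)%E].

Definition mean_model (F : R -> R) f0 : Prop :=
  cexp_ae_eq P U (fun o => (Y o)%:E) (fun o => (F (ev f0 (U o)))%:E).

(* ell(y; a) = log p(y; F(a)), where p(.; F(f0(U))) is the conditional density
   of Y given U with respect to some sigma-finite measure nu *)
Definition loglik_criterion (Ycal : set R) (F : R -> R) (ell : R -> R -> R) f0
    : Prop :=
  exists (nu : {sigma_finite_measure set R -> \bar R}) (dens : R -> R -> R),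
    [/\ forall y a, Ycal y -> 0 < dens y (F a),
        forall y a, Ycal y -> ell y a = ln (dens y (F a)) &
        forall A : set R, measurable A ->
          cexp_ae_eq P U (fun o => (\1_A (Y o))%:E)
            (fun o => \int[nu]_(y in A `&` Ycal)
                        (dens y (F (ev f0 (U o))))%:E)%E].

(* ell(y; a) = Q(y; F(a)).  The domain of the variance function Vf is the range
   of the mean; the integrability clause says that Q(y; F(a)) is well defined *)
Definition quasilik_criterion (Ycal : set R) (F : R -> R) (ell : R -> R -> R)
    : Prop :=
  exists Vf : R -> R,
    [/\ forall a, 0 < Vf (F a),
        forall y a, Ycal y ->
          lebesgue_measure.-integrable
            (`[Num.min y (F a), Num.max y (F a)] : set R)
            (fun s => ((y - s) / Vf s)%:E),
        forall y a, Ycal y ->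
          ell y a = orient_int (fun s => (y - s) / Vf s) y (F a) &
        exists mean : cov R p -> R,
          is_cexp P U (fun o => (Y o)%:E) (fun u => (mean u)%:E) /\
          cexp_ae_eq P U (fun o => ((Y o - mean (U o)) ^+ 2)%:E)
            (fun o => (Vf (mean (U o)))%:E)].

Definition is_I (ell : R -> R -> R) f0 (I : cov R p -> R) : Prop :=
  is_cexp P U (fun o => (derive1n 2 (ell (Y o)) (ev f0 (U o)))%:E)
    (fun u => (- I u)%:E).

Definition is_B (I : cov R p -> R) (B : R -> R) : Prop :=
  is_cexp P Z (fun o => (I (U o))%:E) (fun z => (B z)%:E).

(* G_k(z) = E{I(U) X_k | Z = z} / B(z), for a version of the numerator *)
Definition is_G (I : cov R p -> R) (B : R -> R) (G : 'I_p -> R -> R)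
    : Prop :=
  forall k, exists2 IX : R -> R,
    is_cexp P Z (fun o => (I (U o) * X k o)%:E) (fun z => (IX z)%:E) &
    forall z, G k z = IX z / B z.

Section with_I.
Context (I : cov R p -> R) (B : R -> R).

Definition Vform (g1 g2 : R -> R) : R :=
  fine ('E_P[fun o => (B (Z o) * g1 (Z o) * g2 (Z o))%R])%E.

Definition norm1 (lam : R) (m : nat) (g : R -> R) : R :=
  Num.sqrt (Vform g g + lam * J m g g).

Definition inner (lam : R) (m : nat) f1 f2 : R :=
  fine ('E_P[fun o => (I (U o) * ev f1 (U o) * ev f2 (U o))%R])%E
  + lam * J m f1.2 f2.2.

Definition Hnorm (lam : R) (m : nat) f : R := Num.sqrt (inner lam m f f).

(* equality in H means equality of theta and of g on [0,1]; up to this, R_u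
   and P_lambda f are unique *)
Definition is_representer (per : bool) (lam : R) (m : nat) u r : Prop :=
  Hpar per m r /\ forall f, Hpar per m f -> inner lam m r f = ev f u.

Definition is_Plambda (per : bool) (lam : R) (m : nat)
    (Pl : par R p -> par R p) : Prop :=
  forall f, Hpar per m f ->
    Hpar per m (Pl f) /\
    forall f', Hpar per m f' -> inner lam m (Pl f) f' = lam * J m f.2 f'.2.

Definition Omega (G : 'I_p -> R -> R) : 'M[R]_p :=
  \matrix_(j, k) fine ('E_P[fun o =>
    (I (U o) * (X j o - G j (Z o)) * (X k o - G k (Z o)))%R])%E.

Definition score (ell : R -> R -> R) f0 (t : obs R p) : R :=
  derive1 (ell t.1) (ev f0 t.2).

Definition S_nl (ell : R -> R -> R) f0 (ts : nat -> obs R p)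
    (Rep : cov R p -> par R p) (Pl : par R p -> par R p) (n : nat) : par R p :=
  n%:R^-1 *: (\sum_(i < n) score ell f0 (ts i) *: Rep (ts i).2) - Pl f0.

Record assumption_A1 (Ycal : set R) (ell : R -> R -> R) f0 (lo hi : R)
    : Prop := AssumptionA1 {
  A1_derivable : forall y a k, Ycal y -> (k < 3)%N ->
    derivable (derive1n k (ell y)) a 1 ;
  A1_continuous : forall y, Ycal y -> continuous (derive1n 3 (ell y)) ;
  A1_concave : forall y, Ycal y ->
    @convex_function R R^o setT (fun a => - ell y a) ;
  A1_interval : forall u, Ucal u -> lo < ev f0 u < hi ;
  A1_moments : exists C0 C1 : R, [/\ 0 < C0, 0 < C1,
    cexp_ae_le P U
      (fun o => expeR ((C0^-1)%:E * supabs_deriv ell lo hi 2 (Y o))%E) C1 &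
    cexp_ae_le P U
      (fun o => expeR ((C0^-1)%:E * supabs_deriv ell lo hi 3 (Y o))%E) C1] ;
  A1_I : exists2 C2 : R, 0 < C2 &
    {ae P, forall o, C2^-1 <= I (U o) <= C2} ;
  A1_eps_mean :
    cexp_ae_eq P U (fun o => (score ell f0 (T o))%:E) (fun=> 0%E) ;
  A1_eps_var :
    cexp_ae_eq P U (fun o => (score ell f0 (T o) ^+ 2)%:E)
      (fun o => (I (U o))%:E) ;
  A1_eps_fourth : ('E_P[fun o => (score ell f0 (T o) ^+ 4)%R] < +oo)%E
}.

(* ||.||_1 depends on lambda; lam is the whole sequence lambda_n, for the norms ||.||_1 *)
Definition assumption_A2 (per : bool) (m : nat) (lam : nat -> R) : Prop :=
  exists (hb : nat -> R -> R) (gam : nat -> R),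
    (forall nu, Hm per m (hb nu)) /\
    (exists C : R, forall nu z, 0 <= z <= 1 -> `|hb nu z| <= C) /\
    nondecreasing_seq gam /\
    (exists2 c : R, 0 < c & (gam nu / nu%:R ^+ (2 * m))%R @[nu --> \oo] --> c) /\
    (forall mu nu, Vform (hb mu) (hb nu) = (mu == nu)%:R) /\
    (forall mu nu, J m (hb mu) (hb nu) = gam mu * (mu == nu)%:R) /\
    (forall n g, Hm per m g ->
       norm1 (lam n) m
         (fun z => g z - \sum_(nu < N) Vform g (hb nu) * hb nu z)
         @[N --> \oo] --> (0 : R)).

Definition assumption_A3 (G : 'I_p -> R -> R) : Prop :=
  (forall k, ('E_P[fun o => (G k (Z o) ^+ 2)%R] < +oo)%E) /\
  (forall v : 'rV[R]_p, v != 0 -> 0 < (v *m Omega G *m v^T) 0 0).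

End with_I.
End law.
End model.

Section rates.
Context {R : realType}.

Definition bandwidth (m : nat) (lam : R) : R := lam `^ (2 * m)%:R^-1.

(* (n h)^(-1/2) + h^m *)
Definition rate (m n : nat) (h : R) : R :=
  (n%:R * h) `^ (- 2^-1) + h ^+ m.

(* C_ell is a supremum of conditional expectations, a priori in [0, +oo] *)
Definition a_rate (Cell : \bar R) (m n : nat) (h : R) : \bar R :=
  ((n%:R `^ (- 2^-1) * rate m n h * h `^ (- ((6 * m)%:R - 1) / (4 * m)%:R)
      * ln (ln n%:R) `^ 2^-1)%:E
   + Cell * (h `^ (- 2^-1) * ((n%:R * h)^-1 + h ^+ (2 * m)) / ln n%:R)%:E)%E.

End rates.

(* Main.v *)
Require Import Defs.
From HB Require Import structures.
From mathcomp Require Import all_boot all_order all_algebra.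
From mathcomp Require Import all_classical all_reals all_analysis measurable_realfun.
From mathcomp Require Import ring lra zify.
Import Order.TTheory GRing.Theory Num.Theory.
Import numFieldNormedType.Exports.
Local Open Scope classical_set_scope.
Local Open Scope ring_scope.
Set Implicit Arguments.
Unset Strict Implicit.
Unset Printing Implicit Defensive.

(** Write delta for the estimation error fhat - f_0 and r = delta - S_n(f_0)
for the Bahadur remainder.  The first order condition at the maximizer fhat,
tested against g in H, together with a Taylor expansion of the score around
f_0, reads
  <r, g> = B_1(delta, g) + n^-1 sum_i rho_i g(U_i).
Here B_1(f, g) is the empirical mean of ell''(Y; f_0(U)) f(U) g(U) minus its
expectation, which is - E(I(U) f(U) g(U)), and |rho_i| <= L(Y_i) delta(U_i)^2,
where L(y) is the supremum of |ell'''(y; a)| for a between lo and hi.  The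
expansion holds as soon as sup |delta| is smaller than the distance from the
range of f_0 to the end points lo and hi.  With g = r this gives
([remainder_le])
  ||r|| <= |B_1| ||delta|| + s (|B_2| + K) ||delta||^2,
where s is a constant such that sup |f| <= s ||f|| on H, B_2 is the same
empirical form with weight L, |B| is the norm of the bilinear form B on H, and
E(L(Y) f(U)^2) <= K ||f||^2; one may take K = C_ell C_2 ([EE_om_third]).

No chaining is needed to bound |B_1| and |B_2| in probability.  Elements of H
expand in the coordinates x_k of x and the functions h_nu of z, with squared
coefficients summable against the weights 1 and 1 + lambda gamma_nu, with sum
at most a constant times ||f||^2 ([cbas_sum]).  By Cauchy-Schwarz, |B| is then
at most a constant times the Hilbert-Schmidt norm of B in the weighted basis,
whose expected square is at most a constant times n^-1 (sum_a 1/w_a)^2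
([bform_HS_event], [bform_H_event]), and the sum of the inverse weights is
O(1/h) ([weight_sum]).  Hence |B| = O_P(n^(-1/2) h^-1), and
h^-1 <= h^(-(6m-1)/(4m)).  The same expansion gives
sup |f| <= C h^(-1/2) ||f|| ([ev_le]); with the rate of ||delta|| it makes
sup |delta| tend to 0, because h tends to 0 and n h^2 to infinity.

Two facts support this.  The Sobolev space is a vector space on which J is
bilinear: this needs that an absolutely continuous function has a derivative
almost everywhere, which is obtained from the finiteness of its total
variation, Lebesgue-Stieltjes measures, the Radon-Nikodym theorem and the
first fundamental theorem of calculus ([nondecreasing_ae_derivable],
[abs_contI_ae_derivable]).  And theta is controlled by the norm of
f = (theta, g), because X - G(Z) is orthogonal to the functions of Z, so that
theta Omega theta^T <= E(I(U) f(U)^2) ([theta_le]).  When C_ell is infinite the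
bound holds trivially. *)

(** * Absolutely continuous functions on the unit interval *)

Section absolute_continuity.
Context {R : realType}.
Implicit Types (f g : R -> R) (s : seq (R * R)).

(** The intervals with end points p and q do not overlap: one lies to the left of
the other, or one is degenerate or reversed. *)
Definition nonoverlap (p q : R * R) : bool :=
  [|| p.2 <= q.1, q.2 <= p.1, p.2 <= p.1 | q.2 <= q.1].

(** All pairs of s are the end points of a subinterval of [0,1]. *)
Definition subitv01 s := all (fun p => [&& 0 <= p.1, p.1 <= p.2 & p.2 <= 1]) s.

Lemma nonoverlap_sym p q : nonoverlap p q = nonoverlap q p.
Proof. by rewrite /nonoverlap; do 4 case: (_ <= _). Qed.

(** Absolute continuity, for finite families given by sequences. *)
Lemma abs_contI_seq f : abs_contI f -> forall e, 0 < e ->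
  exists2 d, 0 < d & forall s, subitv01 s -> pairwise nonoverlap s ->
    \sum_(p <- s) (p.2 - p.1) < d -> \sum_(p <- s) `|f p.2 - f p.1| < e.
Proof.
move=> fac e /fac[d d0 fd]; exists d => // s /allP s01 sno sd.
have := fd (size s) (fun i => (nth (0, 0) s i).1) (fun i => (nth (0, 0) s i).2).
rewrite (big_nth (0, 0)) big_mkord in sd.
rewrite (big_nth (0, 0)) big_mkord; apply => //.
  by move=> i; have /s01/and3P[? ? ?] := mem_nth (0, 0) (ltn_ord i).
move=> i j ij; rewrite -subset0 => x /=; rewrite !in_itv/=.
have no : nonoverlap (nth (0, 0) s i) (nth (0, 0) s j).
  have /(pairwiseP (0, 0)) pw := sno.
  case: (ltngtP i j) => [lij|lji|/val_inj eij].
  - by apply: pw => //; rewrite inE ltn_ord.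
  - by rewrite nonoverlap_sym; apply: pw => //; rewrite inE ltn_ord.
  - by rewrite eij eqxx in ij.
move=> [/andP[a1 a2] /andP[b1 b2]].
by move: no; rewrite /nonoverlap => /or4P[] h; lra.
Qed.

(** The consecutive intervals of the partition a :: l. *)
Fixpoint segments (a : R) (l : seq R) : seq (R * R) :=
  if l is b :: l' then (a, b) :: segments b l' else [::].

Lemma segments_sum a l (F : R -> R -> R) :
  \sum_(p <- segments a l) F p.1 p.2 =
  \sum_(0 <= i < size l) F (nth 0 (a :: l) i) (nth 0 (a :: l) i.+1).
Proof.
elim: l a => [|b l ih] a; first by rewrite big_nil big_nat big_pred0// => i; rewrite ltn0 andbF.
by rewrite /= big_cons big_nat_recl//= ih.
Qed.

Lemma segments_length a l : \sum_(p <- segments a l) (p.2 - p.1) = last a l - a.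
Proof.
elim: l a => [|b l ih] a; first by rewrite big_nil subrr.
by rewrite /= big_cons ih/=; ring.
Qed.

Lemma segments_variation f a b l : last a l = b ->
  variation a b f l = \sum_(p <- segments a l) `|f p.2 - f p.1|.
Proof.
move=> lb; rewrite (segments_sum a l (fun x y => `|f y - f x|)) /variation.
apply: eq_big_nat => i /andP[_ il].
by rewrite /= !(set_nth_default 0 b) //= ltnS// ltnW.
Qed.

Lemma segments_in a l p : path <%O a l -> p \in segments a l ->
  [/\ a <= p.1, p.1 <= p.2 & p.2 <= last a l].
Proof.
elim: l a => [|b l ih] a //= /andP[ab bl]; rewrite inE => /predU1P[->|/(ih _ bl)[h1 h2 h3]] /=.
  split => //; first exact: ltW.
  elim: l b bl {ab ih} => //= c l ih b /andP[bc cl].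
  exact: le_trans (ltW bc) (ih _ cl).
by split => //; rewrite (le_trans (ltW ab)).
Qed.

Lemma segments_pairwise a l : path <%O a l -> pairwise nonoverlap (segments a l).
Proof.
elim: l a => [|b l ih] a //= /andP[ab bl].
rewrite ih// andbT; apply/allP => q /(segments_in bl)[h1 _ _].
by rewrite /nonoverlap/= h1.
Qed.

(** Total variations may replace increments in absolute continuity. *)
Lemma abs_contI_TV f : abs_contI f -> forall e, 0 < e ->
  exists2 d, 0 < d & forall s, subitv01 s -> pairwise nonoverlap s ->
    \sum_(p <- s) (p.2 - p.1) < d ->
    (\sum_(p <- s) total_variation p.1 p.2 f <= e%:E)%E.
Proof.
move=> fac e e0; have [d d0 fd] := abs_contI_seq fac e0; exists d => // s.
(* induction on s: the intervals of s carry total variations, those of t increments *)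
have key (t : seq (R * R)) : subitv01 (s ++ t) -> pairwise nonoverlap (s ++ t) ->
    \sum_(p <- s ++ t) (p.2 - p.1) < d ->
    (\sum_(p <- s) total_variation p.1 p.2 f +
     (\sum_(p <- t) `|f p.2 - f p.1|)%:E <= e%:E)%E.
  elim: s t => [|p s ih] t st no sd.
    by rewrite big_nil add0e lee_fin ltW// fd.
  have /and3P[p0 p12 p1] : [&& 0 <= p.1, p.1 <= p.2 & p.2 <= 1].
    by move: st => /= /andP[].
  rewrite big_cons.
  set V := (\sum_(q <- s) _)%E; set W := (\sum_(q <- t) _).
  have VW l : itv_partition p.1 p.2 l ->
      ((variation p.1 p.2 f l)%:E + (V + W%:E) <= e%:E)%E.
    move=> [pl /eqP ll].
    have := ih (segments p.1 l ++ t).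
    rewrite !big_cat/= -(segments_variation _ ll) EFinD addeCA; apply.
    - move: st; rewrite /subitv01/= !all_cat => /and3P[_ -> ->].
      rewrite andbT/=; apply/allP => q /(segments_in pl)[h1 h2 h3].
      rewrite (le_trans p0 h1) h2 (le_trans h3)// ll//.
    - move: no => /=; rewrite !pairwise_cat all_cat allrel_catr => /andP[/andP[ps pt] /and3P[st' -> ->]].
      rewrite st' (segments_pairwise pl)/= !andbT; apply/andP; split.
        apply/allrelP => a q sa /(segments_in pl)[h1 h2 h3].
        move/allP: ps => /(_ a sa); rewrite /nonoverlap ll in h3 *.
        by move=> /or4P[] h; apply/or4P; [apply: Or42|apply: Or41|apply: Or44|apply: Or43]; lra.
      apply/allrelP => q a /(segments_in pl)[h1 h2 h3] ta.
      move/allP: pt => /(_ a ta); rewrite /nonoverlap ll in h3 *.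
      by move=> /or4P[] h; apply/or4P; [apply: Or41|apply: Or42|apply: Or43|apply: Or44]; lra.
    - move: sd; rewrite /= big_cons !big_cat/= segments_length ll.
      by move=> sd; lra.
  have V0 : (0 <= V)%E.
    rewrite /V big_seq; apply: sume_ge0 => q qs.
    move: st => /= /andP[_]; rewrite /subitv01 all_cat => /andP[/allP/(_ _ qs)/and3P[_ ? _] _].
    exact: total_variation_ge0.
  have W0 : 0 <= W by apply: sumr_ge0.
  have Vfin : V \is a fin_num.
    have H := ih t; rewrite -/V -/W in H.
    rewrite ge0_fin_numE//; apply: le_lt_trans (ltry e); apply: le_trans (H _ _ _).
    - by rewrite leeDl// lee_fin.
    - by move: st => /= /andP[].
    - by move: no => /= /andP[].
    - by move: sd; rewrite /= big_cons; lra.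
  rewrite -addeA -leeBrDr ?fin_numD ?Vfin//.
  apply: ge_ereal_sup => _ /= [_ [l pl <-] <-].
  by rewrite leeBrDr ?fin_numD ?Vfin// VW.
move=> s01 no sd; have := key [::]; rewrite cats0 big_nil adde0; exact.
Qed.

End absolute_continuity.

(** * Almost everywhere differentiability *)

Section nondecreasing_ae_derivable.
Context {R : realType}.
Local Notation mu := (@lebesgue_measure R).

Let le_mu (m : {measure set (measurableTypeR R) -> \bar R}) (A B : set R) :
  measurable A -> measurable B -> A `<=` B -> (m A <= m B)%E.
Proof. by move=> mA mB AB; apply: le_measure; rewrite ?inE. Qed.

(** An open interval of finite Lebesgue measure has real end points.  The empty set
is included: its infimum and supremum are both 0. *)
Lemma open_interval_finite_measure (J : set R) : open J -> is_interval J ->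
  (mu J < +oo)%E -> inf J <= sup J /\ J = `]inf J, sup J[%classic.
Proof.
move=> oJ iJ Jfin.
have [->|/set0P[x Jx]] := eqVneq J set0.
  by rewrite inf0 sup0; split => //; rewrite set_itvoo0.
have mJ : measurable J by exact: open_measurable.
have bnd y z : J y -> J z -> y <= z -> z - y <= fine (mu J).
  move=> Jy Jz yz; rewrite -lee_fin fineK ?ge0_fin_numE//.
  have -> : (z - y)%:E = mu `]y, z[%classic.
    rewrite lebesgue_measure_itv/= lte_fin; case: ltP => [//|zy].
    by congr (_%:E); lra.
  apply: le_measure; rewrite ?inE// => t; rewrite /= in_itv/= => /andP[yt tz].
  by apply: (iJ y z) => //; rewrite (ltW yt) (ltW tz).
have hu : has_ubound J.
  exists (x + fine (mu J)) => z Jz; have [xz|zx] := leP x z.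
    by have := bnd _ _ Jx Jz xz; lra.
  by rewrite (le_trans (ltW zx))// lerDl fine_ge0.
have hl : has_lbound J.
  exists (x - fine (mu J)) => z Jz; have [zx|xz] := leP z x.
    by have := bnd _ _ Jz Jx zx; lra.
  by rewrite (le_trans _ (ltW xz))// gerBl fine_ge0.
split.
  apply: (@le_trans _ _ x).
    by apply: ge_inf => //.
  by apply: sup_upper_bound => //; split => //; exists x.
by rewrite -[LHS](interior_id J).1 ?interval_bounded_interior.
Qed.

Variable G : R -> R.
Hypothesis ndG : {homo G : x y / x <= y}.
Hypothesis acG : forall e, 0 < e -> exists2 d, 0 < d &
  forall s : seq (R * R), all (fun p => p.1 <= p.2) s -> pairwise nonoverlap s ->
    \sum_(p <- s) (p.2 - p.1) < d -> \sum_(p <- s) (G p.2 - G p.1) <= e.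

Let cG : right_continuous G.
Proof.
move=> x; apply: cvg_within_filter.
apply/cvgrPdist_le => e e0; have [d d0 H] := acG e0.
near=> y.
have xyd : `|x - y| < d by near: y; exact: cvgr_dist_lt.
have [xy|yx] := leP x y.
  have := H [:: (x, y)]; rewrite /= !big_seq1/= xy => /(_ erefl erefl).
  rewrite distrC ger0_norm ?subr_ge0// in xyd.
  by rewrite distrC ger0_norm ?subr_ge0 ?ndG//; exact.
have := H [:: (y, x)]; rewrite /= !big_seq1/= (ltW yx) => /(_ erefl erefl).
rewrite ger0_norm ?subr_ge0 ?(ltW yx)// in xyd.
by rewrite ger0_norm ?subr_ge0 ?ndG ?(ltW yx)//; exact.
Unshelve. all: by end_near. Qed.

HB.instance Definition _ := isCumulative.Build R _ R G ndG cG.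

Let nu : {measure set (measurableTypeR R) -> \bar R} :=
  lebesgue_stieltjes_measure (G : cumulative R R).

Let nu_oc a b : a <= b -> nu `]a, b]%classic = (G b - G a)%:E.
Proof.
move=> ab; change (lebesgue_stieltjes_measure (G : cumulative R R) `]a, b]%classic = (G b - G a)%:E).
rewrite /lebesgue_stieltjes_measure /measure_extension.
by rewrite measurable_mu_extE/= ?wlength_itv_bnd//; exact: is_ocitv.
Qed.

Let nu_dom : nu `<< mu.
Proof.
apply/null_content_dominatesP => A mA A0.
apply/eqP; rewrite eq_le measure_ge0 andbT.
apply/lee_addgt0Pr => e e0; rewrite add0e.
have [d d0 H] := acG e0.
have [|U [oU AU Ud]] := @lebesgue_regularity_outer R A d mA _ d0.
  by rewrite A0.
have mU : measurable U by exact: open_measurable.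
have {}Ud : (mu U < d%:E)%E.
  rewrite -(setDUK AU); apply: le_lt_trans Ud.
  apply: (le_trans (measureU2 _ mA (measurableD mU mA))).
  by rewrite A0 add0e.
apply: (@le_trans _ _ (nu U)); first by apply: le_measure; rewrite ?inE.
pose Ik := open_disjoint_itv oU.
have mI k : measurable (Ik k) by apply: open_measurable; exact: open_disjoint_itv_open.
have tI := @open_disjoint_itv_trivIset _ _ oU.
have EI := @open_disjoint_itv_bigcup _ _ oU.
have IU k : (mu (Ik k) <= mu U)%E.
  apply: le_mu => // t It.
  by rewrite EI; exists k.
have Ifin k : inf (Ik k) <= sup (Ik k) /\ Ik k = `]inf (Ik k), sup (Ik k)[%classic.
  apply: open_interval_finite_measure.
  - exact: open_disjoint_itv_open.
  - exact: open_disjoint_itv_is_interval.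
  - by rewrite (le_lt_trans (IU k))// (lt_trans Ud)// ltry.
have -> : nu U = (\sum_(0 <= i <oo) nu (Ik i))%E.
  by rewrite [in LHS]EI measure_semi_bigcup// -EI.
apply: lime_le; first exact: is_cvg_nneseries.
near=> n.
have nuI k : (nu (Ik k) <= (G (sup (Ik k)) - G (inf (Ik k)))%:E)%E.
  have [Ile IE] := Ifin k; rewrite -nu_oc//.
  apply: le_mu => // t; rewrite {1}IE.
  by rewrite /= !in_itv/= => /andP[-> /ltW ->].
apply: (@le_trans _ _ (\sum_(0 <= k < n) (G (sup (Ik k)) - G (inf (Ik k)))%:E)%E).
  exact: lee_sum.
rewrite sumEFin lee_fin.
have := H [seq (inf (Ik k), sup (Ik k)) | k <- index_iota 0 n].
rewrite !big_map/=; apply.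
- by rewrite all_map; apply/allP => k _ /=; have [] := Ifin k.
- rewrite pairwise_map; have := iota_uniq 0 (n - 0); rewrite uniq_pairwise.
  apply: sub_pairwise => k l /= kl.
  have [ak Ek] := Ifin k; have [al El] := Ifin l.
  apply: contraT; rewrite /nonoverlap/= !negb_or -!ltNge => /and4P[h1 h2 h3 h4].
  move: tI => /trivIsetP/(_ k l I I kl); rewrite -/Ik Ek El.
  move=> /seteqP[+ _].
  set M := Num.max (inf (Ik k)) (inf (Ik l)); set m := Num.min (sup (Ik k)) (sup (Ik l)).
  move=> /(_ ((M + m) / 2)) []/=.
  have Mm : M < m by rewrite /M /m gt_max !lt_min h1 h2 h3 h4.
  have [? ?] : inf (Ik k) <= M /\ inf (Ik l) <= M by rewrite /M !le_max !lexx orbT.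
  have [? ?] : m <= sup (Ik k) /\ m <= sup (Ik l) by rewrite /m !ge_min !lexx orbT.
  by rewrite !in_itv/=; split; lra.
- rewrite -lte_fin -sumEFin; apply: le_lt_trans Ud.
  apply: (@le_trans _ _ (\sum_(0 <= k < n) mu (Ik k))%E).
    apply: lee_sum => k _; have [Ile IE] := Ifin k.
    rewrite IE lebesgue_measure_itv/= -IE lte_fin; case: ltP => // h.
    by rewrite lee_fin subr_le0.
  rewrite [in leRHS]EI measure_semi_bigcup// -?EI//.
  exact: nneseries_lim_ge.
Unshelve. all: by end_near. Qed.

(** The Stieltjes measure of G is dominated by the Lebesgue measure, so that on a
bounded interval G is, up to a constant, the indefinite integral of a density. *)
Lemma nondecreasing_ae_derivable : 
  {ae mu, forall x, 0 < x < 1 -> derivable G x 1}.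
Proof.
(* only the restriction of the Stieltjes measure to a bounded interval is finite,
   as Radon-Nikodym requires; the derivative is taken on ]0, 1[ *)
pose D : set (measurableTypeR R) := `]-1, 2]%classic.
have mD : measurable D by exact: measurable_itv.
have nuD : (nu D < +oo)%E by rewrite nu_oc ?ltry//; lra.
pose nuf : {finite_measure set (measurableTypeR R) -> \bar R} := mfrestr mD nuD.
have nuf_dom : nuf `<< mu.
  apply/null_content_dominatesP => A mA A0.
  move/null_content_dominatesP : nu_dom => /(_ A mA A0) nuA0.
  apply/eqP; rewrite eq_le measure_ge0 andbT -nuA0.
  by apply: le_measure; rewrite ?inE//; exact: measurableI.
have [f [f0 ffin intf fE]] := radon_nikodym_sigma_finite nuf_dom.
pose fr x := fine (f x).
have frE : EFin \o fr = f by apply/funext => x /=; rewrite /fr fineK.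
have intfr : mu.-integrable setT (EFin \o fr) by rewrite frE.
have := @FTC1 R fr (BRight (-1)).
move=> /(_ _ _)[].
- by move=> y; apply: integrableS intfr.
- by apply: open_integrable_locally => //; exact: openT.
move=> N [mN N0 sN].
exists N; split => // x /= xN; apply: sN => /= H; apply: xN => /andP[x0 x1].
have [|dF _] := H; first by rewrite lte_fin; lra.
pose F (y : R) : R := (\int[mu]_(t in `]-1, y]) fr t) + G (-1).
have : derivable F (x : R) 1 by apply: (derivableD dF); exact: derivable_cst.
apply: near_eq_derivable; near=> y.
  have y0 : 0 < y by near: y; exact: lt_nbhsr.
  have y1 : y < 1 by near: y; exact: lt_nbhsl.
  pose A : set (measurableTypeR R) := `]-1, y]%classic.
  have fE' : (\int[mu]_(t in A) (fr t)%:E)%E = nuf A.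
    rewrite fE; last exact: measurable_itv.
    by apply: eq_integral => t _; rewrite /fr fineK.
  have AD : (`]-1, y]%classic : set R) `<=` `]-1, 2]%classic.
    by move=> t; rewrite /= !in_itv/= => /andP[-> ty] /=; lra.
  have nufA : nuf A = nu A.
    by change (nu (A `&` D) = nu A); rewrite setIidl.
  by rewrite /F /Rintegral fE' nufA nu_oc/=; lra.
Unshelve. all: by end_near. Qed.

End nondecreasing_ae_derivable.

Section clamp.
Context {R : realType}.

(** The projection of the real line onto [0,1]. *)
Definition clamp01 (x : R) : R := Num.max 0 (Num.min x 1).

Lemma clamp01_in x : 0 <= clamp01 x <= 1.
Proof. by rewrite /clamp01 le_max lexx ge_max ler01 ge_min lexx orbT. Qed.

Lemma clamp01_id x : 0 <= x <= 1 -> clamp01 x = x.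
Proof. by move=> /andP[x0 x1]; rewrite /clamp01 min_l// max_r. Qed.

Lemma clamp01_homo x y : x <= y -> clamp01 x <= clamp01 y.
Proof. by rewrite /clamp01 /Num.max /Num.min; do ! case: ifPn; rewrite -?leNgt; lra. Qed.

Lemma clamp01_lip x y : x <= y -> clamp01 y - clamp01 x <= y - x.
Proof. by rewrite /clamp01 /Num.max /Num.min; do ! case: ifPn; rewrite -?leNgt; lra. Qed.

End clamp.

Section absolute_continuity_derivable.
Context {R : realType}.
Implicit Types f : R -> R.
Local Notation mu := (@lebesgue_measure R).
Local Notation TV := total_variation.

(** [0,1] is cut into finitely many intervals whose length is less than the
modulus of absolute continuity for 1. *)
Lemma abs_contI_TV_lty f : abs_contI f -> (TV 0 1 f < +oo)%E.
Proof.
move=> /abs_contI_TV /(_ _ ltr01)[d d0 fd].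
pose t n : R := Num.min 1 (n%:R * (d / 2)).
have t1 n : t n <= 1 by rewrite ge_min lexx.
have t0 n : 0 <= t n by rewrite le_min ler01/= mulr_ge0// divr_ge0// ltW.
have tS n : t n <= t n.+1 /\ t n.+1 - t n < d.
  rewrite /t -[n.+1%:R]natr1 mulrDl mul1r; have : 0 <= n%:R * (d / 2).
    by rewrite mulr_ge0// divr_ge0// ltW.
  by rewrite /Num.min; do 2 case: ifPn; rewrite -?leNgt; lra.
have H n : (TV 0 (t n) f < +oo)%E.
  elim: n => [|n ih].
    by rewrite /t mul0r min_r ?ler01// total_variationxx.
  have [tn td] := tS n.
  rewrite (total_variationD f (t0 n) tn) lte_add_pinfty//.
  have := fd [:: (t n, t n.+1)]; rewrite /= !big_seq1/= t0 tn t1/=.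
  by move=> /(_ erefl erefl td) h; exact: le_lt_trans h (ltry _).
pose N := Num.bound (2 / d).
suff <- : t N = 1 by [].
rewrite /t min_l// -ler_pdivrMr ?divr_gt0// mul1r invf_div ltW//.
by apply: le_lt_trans (archi_boundP _); rewrite ?ler_norm// divr_ge0// ltW.
Qed.

(** f is the difference of the nondecreasing functions V and V - f, where V is the
variation of f on [0, x]; both inherit the absolute continuity of f. *)
Lemma abs_contI_ae_derivable f : abs_contI f ->
  {ae mu, forall x, 0 < x < 1 -> derivable (f \o clamp01) x 1}.
Proof.
move=> fac; have fTV := abs_contI_TV_lty fac.
pose V x := fine (TV 0 (clamp01 x) f).
have c0 (x : R) : 0 <= clamp01 x by have /andP[] := clamp01_in x.
have c1 (x : R) : clamp01 x <= 1 by have /andP[] := clamp01_in x.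
have TVfin x y : 0 <= x -> x <= y -> y <= 1 -> TV x y f \is a fin_num.
  move=> x0 xy y1; rewrite ge0_fin_numE ?total_variation_ge0//.
  apply: le_lt_trans fTV.
  rewrite (total_variationD f x0 (le_trans xy y1)) (total_variationD f xy y1).
  rewrite (le_trans (_ : _ <= TV x y f + TV y 1 f)%E)//.
    by rewrite leeDl// total_variation_ge0.
  by rewrite leeDr// total_variation_ge0.
have VE x y : x <= y -> V y - V x = fine (TV (clamp01 x) (clamp01 y) f).
  move=> xy; have cxy := clamp01_homo xy.
  rewrite /V (total_variationD f (c0 x) cxy) fineD ?TVfin//.
  by rewrite addrAC subrr add0r.
have ndV : {homo V : x y / x <= y}.
  move=> x y xy; rewrite -subr_ge0 VE// fine_ge0// total_variation_ge0//.
  exact: clamp01_homo.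
have fV x y : x <= y -> `|f (clamp01 y) - f (clamp01 x)| <= V y - V x.
  move=> xy; rewrite VE// -lee_fin fineK ?TVfin ?clamp01_homo//.
  by apply: total_variation_ge; exact: clamp01_homo.
have acV e : 0 < e -> exists2 d, 0 < d &
    forall s : seq (R * R), all (fun p => p.1 <= p.2) s -> pairwise nonoverlap s ->
    \sum_(p <- s) (p.2 - p.1) < d -> \sum_(p <- s) (V p.2 - V p.1) <= e.
  move=> e0; have [d d0 fd] := abs_contI_TV fac e0; exists d => // s /allP s12 sno sd.
  have := fd [seq (clamp01 p.1, clamp01 p.2) | p <- s].
  rewrite !big_map/= => H; rewrite -lee_fin -sumEFin.
  rewrite (eq_big_seq (fun p => TV (clamp01 p.1) (clamp01 p.2) f)); last first.
    move=> p ps; have p12 := s12 _ ps.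
    by rewrite VE// fineK// TVfin// clamp01_homo.
  apply: H.
  - rewrite /subitv01 all_map; apply/allP => p ps /=.
    by rewrite c0 c1 clamp01_homo// s12.
  - rewrite pairwise_map; apply: sub_pairwise sno => p q.
    by rewrite /nonoverlap => /or4P[] /clamp01_homo h /=; apply/or4P;
      [apply: Or41|apply: Or42|apply: Or43|apply: Or44].
  - apply: le_lt_trans sd; rewrite big_seq [leRHS]big_seq; apply: ler_sum => p ps.
    by apply: clamp01_lip; exact: s12.
pose W x := V x - f (clamp01 x).
have ndW : {homo W : x y / x <= y}.
  by move=> x y xy; have := fV _ _ xy; rewrite ler_norml /W => /andP[]; lra.
have acW e : 0 < e -> exists2 d, 0 < d &
    forall s : seq (R * R), all (fun p => p.1 <= p.2) s -> pairwise nonoverlap s ->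
    \sum_(p <- s) (p.2 - p.1) < d -> \sum_(p <- s) (W p.2 - W p.1) <= e.
  move=> e0; have e20 : 0 < e / 2 by rewrite divr_gt0.
  have [d d0 H] := acV _ e20; exists d => // s s12 sno sd.
  have := H s s12 sno sd.
  rewrite ler_pdivlMr// mulr_suml; apply: le_trans.
  rewrite big_seq [leRHS]big_seq; apply: ler_sum => p ps.
  have /fV : p.1 <= p.2 by move/allP: s12; exact.
  by rewrite ler_norml /W => /andP[]; lra.
have dV := nondecreasing_ae_derivable ndV acV.
have dW := nondecreasing_ae_derivable ndW acW.
have Fmu := ae_filter_ringOfSetsType mu.
move: dV dW; apply: filterS2 => x dV dW x01.
have -> : f \o clamp01 = V - W.
  by apply/funext => y; rewrite /W fctE/= opprB addrC subrK.
by apply: derivableB; [exact: dV|exact: dW].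
Qed.

Lemma abs_contI_continuous f : abs_contI f -> continuous (f \o clamp01).
Proof.
move=> fac x; apply/cvgrPdist_lt => e e0; have [d d0 H] := abs_contI_seq fac e0.
have c0 (z : R) : 0 <= clamp01 z by have /andP[] := clamp01_in z.
have c1 (z : R) : clamp01 z <= 1 by have /andP[] := clamp01_in z.
near=> y; have xyd : `|x - y| < d by near: y; exact: cvgr_dist_lt.
have K a b : a <= b -> b - a < d -> `|f (clamp01 b) - f (clamp01 a)| < e.
  move=> ab abd; have := H [:: (clamp01 a, clamp01 b)].
  rewrite /= !big_seq1/= c0 c1 clamp01_homo// => /(_ erefl erefl); apply.
  by apply: le_lt_trans abd; exact: clamp01_lip.
have [xy|/ltW yx] := leP x y.
  by rewrite distrC /= K//; move: xyd; rewrite distrC ger0_norm ?subr_ge0.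
by rewrite /= K//; move: xyd; rewrite ger0_norm ?subr_ge0.
Unshelve. all: by end_near. Qed.

End absolute_continuity_derivable.

(** * Derivatives relative to the unit interval *)

Section unit_interval_derivative.
Context {R : realType}.
Implicit Types f g : R -> R.
Local Notation mu := (@lebesgue_measure R).

Lemma quotI_cvgP g (x l : R) :
  (quotI g x y @[y --> within `[0, 1] x^'] --> l) <->
  forall e, 0 < e -> exists2 d, 0 < d & forall y, 0 <= y <= 1 -> y != x ->
    `|x - y| < d -> `|l - quotI g x y| <= e.
Proof.
split.
  move=> /cvgrPdist_le H e /H.
  move=> [d /= d0 xd]; exists d => // y y01 yx xy.
  by apply: xd => //; rewrite /= in_itv.
move=> H; apply/cvgrPdist_le => e /H[d d0 xd].
by exists d => //= y xy yx; rewrite in_itv/= => y01; exact: xd.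
Qed.

(** Every point of [0,1] is a limit of other points of [0,1]. *)
Lemma within01_proper (x : R) : 0 <= x <= 1 ->
  ProperFilter (within `[0, 1] x^').
Proof.
move=> /andP[x0 x1]; split; last exact: within_filter.
move=> [d /= d0 H]; pose t := Num.min (d / 2) (1 / 2).
have [t0 td t12] : [/\ 0 < t, t < d & t <= 1 / 2].
  split; rewrite /t; first by rewrite lt_min !divr_gt0.
    by rewrite gt_min; apply/orP; left; lra.
  by rewrite ge_min lexx orbT.
have [xh|xh] := leP x (1 / 2).
  apply: (H (x + t)) => /=; last by rewrite in_itv/=; lra.
    by rewrite opprD addNKr normrN gtr0_norm.
  by rewrite -subr_eq0 addrAC subrr add0r gt_eqF.
apply: (H (x - t)) => /=; last by rewrite in_itv/=; lra.
  by rewrite subKr gtr0_norm.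
by rewrite -subr_eq0 addrAC subrr add0r oppr_eq0 gt_eqF.
Qed.

Lemma dI_eq g (x l : R) : 0 <= x <= 1 ->
  quotI g x y @[y --> within `[0, 1] x^'] --> l ->
  derivableI g x /\ dI g x = l.
Proof.
move=> x01 gl; have PF := within01_proper x01; split; first exact: cvgP gl.
exact: cvg_lim gl.
Qed.

Lemma derivableI_lin g1 g2 (a x : R) : 0 <= x <= 1 ->
  derivableI g1 x -> derivableI g2 x ->
  derivableI (fun z => a * g1 z + g2 z) x /\
  dI (fun z => a * g1 z + g2 z) x = a * dI g1 x + dI g2 x.
Proof.
move=> x01 d1 d2; apply: dI_eq => //.
have -> : quotI (fun z => a * g1 z + g2 z) x =
    (fun y => a * quotI g1 x y + quotI g2 x y).
  by apply/funext => y; rewrite /quotI mulrA -mulrDl; congr (_ / _); ring.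
have FF : Filter (within `[0, 1] x^') by exact: within_filter.
by apply: cvgD => //; apply: cvgMl_tmp.
Qed.

Lemma quotI_ext f g (x : R) : 0 <= x <= 1 ->
  (forall z, 0 <= z <= 1 -> f z = g z) ->
  (quotI f x y @[y --> within `[0, 1] x^']) =
  (quotI g x y @[y --> within `[0, 1] x^']).
Proof.
move=> x01 fg.
have FF : Filter (within `[0, 1] x^') by exact: within_filter.
have E : {near within `[0, 1] x^', quotI f x =1 quotI g x}.
  exists 1 => //= y _ _; rewrite in_itv/= => y01.
  by rewrite /quotI !fg.
apply/funext => A; apply/propext; split.
  by apply: near_eq_cvg; apply: filterS E => y ->.
by apply: near_eq_cvg; apply: filterS E => y ->.
Qed.

Lemma dI_ext f g (x : R) : 0 <= x <= 1 ->
  (forall z, 0 <= z <= 1 -> f z = g z) -> dI f x = dI g x.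
Proof. by move=> x01 fg; rewrite /dI (quotI_ext x01 fg). Qed.

Lemma derivableI_ext f g (x : R) : 0 <= x <= 1 ->
  (forall z, 0 <= z <= 1 -> f z = g z) -> derivableI f x -> derivableI g x.
Proof. by move=> x01 fg; rewrite /derivableI (quotI_ext x01 fg). Qed.

Lemma derivable_derivableI g (x : R) : 0 < x < 1 ->
  derivable (g \o clamp01) x 1 -> derivableI g x.
Proof.
move=> /andP[x0 x1] /derivableP/is_derive1_caratheodory[q [qE cq ql]].
apply/cvg_ex; exists (q x); apply/quotI_cvgP => e e0.
move/cvgrPdist_le : cq => /(_ _ e0)[d /= d0 xd]; exists d => // y y01 yx xy.
rewrite (le_trans _ (xd y xy))//.
have := qE y; rewrite /= !clamp01_id ?(ltW x0) ?(ltW x1)// /quotI => ->.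
by rewrite mulfK// subr_eq0.
Qed.

(** [dI g] is measurable even if g is not differentiable everywhere: the set C of
the points where the difference quotients are Cauchy is a Borel set; inside
]0, 1[, [dI g] is a limit of continuous functions on C, and the default value
of [lim] off C. *)
Lemma measurable_dI g : continuous (g \o clamp01) ->
  measurable_fun (`[0, 1] : set R) (dI g).
Proof.
move=> cg; pose gt : R -> R := g \o clamp01.
pose q s x : R := (gt (x + s) - gt x) / s.
have cq s : continuous (q s).
  move=> x; apply: cvgM; last exact: cvg_cst.
  apply: cvgB; last exact: cg.
  apply: (@continuous_comp _ _ _ (fun z => z + s) gt); last exact: cg.
  by apply: cvgD; [exact: cvg_id|exact: cvg_cst].
pose E e d := \bigcap_(p in [set p : R * R | 0 < `|p.1| < d /\ 0 < `|p.2| < d])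
  [set x | `|q p.1 x - q p.2 x| <= e].
have cE e d : closed (E e d).
  apply: closed_bigI => p _.
  apply: (@preimage_closed _ _ (fun x => `|q p.1 x - q p.2 x|) [set y | y <= e]).
    by move=> x _; apply: cvg_norm; apply: cvgB; exact: cq.
  exact: closed_le.
pose C := \bigcap_k \bigcup_l E (k.+1%:R^-1) (l.+1%:R^-1).
have mC : measurable C.
  apply: bigcapT_measurable => k; apply: bigcupT_measurable => l.
  exact: closed_measurable.
have qq x y : 0 <= x <= 1 -> 0 <= y <= 1 -> quotI g x y = q (y - x) x.
  by move=> x01 y01; rewrite /q /quotI /gt /= subrKC !clamp01_id.
have C_der x : 0 < x < 1 -> C x -> derivableI g x.
  move=> /andP[x0 x1] Cx; have x01 : 0 <= x <= 1 by rewrite !ltW.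
  have PF := within01_proper x01.
  apply: cauchy_cvg; apply: cauchy_exP => e e0.
  have [k] := ltr_add_invr e0; rewrite add0r => ke.
  have [l _ El] := Cx k I.
  exists (q l.+2%:R^-1 x).
  exists l.+1%:R^-1 => //= y xy yx; rewrite in_itv/= => y01.
  rewrite /ball/= qq//.
  have := El (l.+2%:R^-1, y - x); rewrite /= => H; apply: le_lt_trans ke.
  apply: H; rewrite !normr_gt0 invr_eq0 pnatr_eq0/= subr_eq0 yx distrC xy.
  by rewrite gtr0_norm// ltf_pV2 ?posrE// ltr_nat.
have der_C x : 0 < x < 1 -> derivableI g x -> C x.
  move=> /andP[x0 x1] /quotI_cvgP dg k _.
  have x01 : 0 <= x <= 1 by rewrite !ltW.
  have [|d d0 xd] := dg (k.+1%:R^-1 / 2); first by rewrite divr_gt0.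
  have [|l] := @ltr_add_invr R 0 (Num.min d (Num.min x (1 - x))).
    by rewrite !lt_min d0 x0 subr_gt0.
  rewrite add0r !lt_min => /and3P[ld lx l1x].
  exists l => // -[s t] /= [/andP[s0 sl] /andP[t0 tl]].
  have K u : 0 < `|u| -> `|u| < l.+1%:R^-1 ->
      `|dI g x - q u x| <= k.+1%:R^-1 / 2.
    move=> u0 ul; have u01 : 0 <= x + u <= 1.
      move: ul lx l1x {ld sl tl}; set v := _^-1 => ul lx l1x.
      by move: ul; rewrite ltr_norml => /andP[u1 u2]; apply/andP; split; lra.
    have -> : q u x = quotI g x (x + u) by rewrite qq// addrC addKr.
    apply: xd => //; first by rewrite -subr_eq0 addrC addKr -normr_gt0.
    by rewrite opprD addNKr normrN (lt_trans ul).
  have := K _ s0 sl; have := K _ t0 tl.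
  move: (k.+1%:R^-1) => v.
  rewrite !ler_norml => /andP[h1 h2] /andP[h3 h4].
  by apply/andP; split; lra.
have seq_der x : 0 < x < 1 -> C x -> q n.+1%:R^-1 x @[n --> \oo] --> dI g x.
  move=> x01' Cx; have /andP[x0 x1] := x01'; have x01 : 0 <= x <= 1 by rewrite !ltW.
  have /quotI_cvgP dg := C_der x x01' Cx.
  apply/cvgrPdist_le => e /dg[d d0 xd].
  near=> n.
  have nd : n.+1%:R^-1 < Num.min d (1 - x).
    near: n; apply: near_infty_natSinv_lt (PosNum _).
    by rewrite lt_min d0 subr_gt0.
  move: nd; rewrite lt_min => /andP[nd n1x].
  have n0 : 0 < n.+1%:R^-1 :> R by [].
  have u01 : 0 <= x + n.+1%:R^-1 <= 1.
    by move: (n.+1%:R^-1) n0 n1x => v v0 v1; apply/andP; split; lra.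
  have -> : q n.+1%:R^-1 x = quotI g x (x + n.+1%:R^-1) by rewrite qq// addrC addKr.
  apply: xd => //; first by rewrite -subr_eq0 addrC addKr gt_eqF.
  by rewrite opprD addNKr normrN gtr0_norm.
apply/measurable_fun_itv_bndo_bndcP/measurable_fun_itv_obnd_cbndP.
rewrite -(setUIDK `]0%R, 1%R[%classic C).
have m01 : measurable (`]0%R, 1%R[%classic : set R) by exact: measurable_itv.
apply/measurable_funU; [exact: measurableI|exact: measurableD|split].
  apply: (@measurable_fun_cvg _ _ _ _ (fun n => q n.+1%:R^-1)).
    by move=> n; apply: measurable_funTS; exact: continuous_measurable_fun.
  by move=> x [/=]; rewrite in_itv/=; exact: seq_der.
apply: (@eq_measurable_fun _ _ _ _ _ (cst point)); last exact: measurable_cst.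
move=> x; rewrite inE => -[/=]; rewrite in_itv/= => x01 nCx.
rewrite /dI dvgP//; apply: contra_not nCx; exact: der_C.
Unshelve. all: by end_near. Qed.

End unit_interval_derivative.

(** * Sobolev spaces and the penalty J *)

Section square_integrable.
Context d (T : measurableType d) (R : realType) (mu : {measure set T -> \bar R}).
Variable D : set T.
Hypothesis mD : measurable D.
Implicit Types f g : T -> R.

(** f is measurable and square integrable on D. *)
Definition L2 f :=
  measurable_fun D f /\ (\int[mu]_(x in D) (f x ^+ 2)%:E < +oo)%E.

Lemma L2_mul_integrable f g : L2 f -> L2 g ->
  mu.-integrable D (fun x => (f x * g x)%:E).
Proof.
move=> [mf f2] [mg g2].
have int2 (h : T -> R) : measurable_fun D h ->
    (\int[mu]_(x in D) (h x ^+ 2)%:E < +oo)%E ->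
    mu.-integrable D (fun x => (h x ^+ 2)%:E).
  move=> mh h2; apply/integrableP; split.
    by apply/measurable_EFinP; exact: measurable_funX.
  by under eq_integral do rewrite gee0_abs ?lee_fin ?sqr_ge0//.
have := integrableD mD (int2 f mf f2) (int2 g mg g2).
apply: le_integrable => //.
  by apply/measurable_EFinP; exact: measurable_funM.
move=> x Dx /=; rewrite lee_fin [leRHS]ger0_norm ?addr_ge0 ?sqr_ge0//.
have := sqr_ge0 (f x + g x); have := sqr_ge0 (f x - g x).
by rewrite ler_norml => h1 h2; apply/andP; split; nra.
Qed.

Lemma L2_sqr_integrable f : L2 f -> mu.-integrable D (fun x => (f x ^+ 2)%:E).
Proof. by move=> Lf; have := L2_mul_integrable Lf Lf. Qed.

Lemma L2_lin a f g : L2 f -> L2 g -> L2 (fun x => a * f x + g x).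
Proof.
move=> Lf Lg; have [mf f2] := Lf; have [mg g2] := Lg.
have mc : measurable_fun D (fun x => a * f x + g x).
  by apply: measurable_funD => //; exact: measurable_funM.
split => //.
have H : mu.-integrable D (fun x => (a ^+ 2 * f x ^+ 2 + (2 * a) * (f x * g x) + g x ^+ 2)%:E).
  under eq_fun do rewrite EFinD EFinD EFinM (EFinM (2 * a)).
  apply: integrableD => //; last exact: L2_sqr_integrable.
  apply: integrableD => //.
    by apply: integrableZl => //; exact: L2_sqr_integrable.
  by apply: integrableZl => //; exact: L2_mul_integrable.
have := integrable_lty mD H.
by congr (_ < _)%E; apply: eq_integral => x _; congr (_%:E); ring.
Qed.

Lemma L2_ae_eq f g : L2 f -> measurable_fun D g ->
  {ae mu, forall x, D x -> f x = g x} -> L2 g.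
Proof.
move=> [mf f2] mg fg; split => //.
rewrite (@ge0_ae_eq_integral _ _ _ _ _ _ (fun x => (f x ^+ 2)%:E))//.
- by apply/measurable_EFinP; exact: measurable_funX.
- by apply/measurable_EFinP; exact: measurable_funX.
- by move=> x _; rewrite lee_fin sqr_ge0.
- by move=> x _; rewrite lee_fin sqr_ge0.
- case: fg => N [mN N0 sN]; exists N; split => // x /= xN; apply: sN => /= H.
  by apply: xN => Dx; rewrite H.
Qed.

End square_integrable.

Section sobolev_space.
Context {R : realType}.
Implicit Types f g : R -> R.
Local Notation mu := (@lebesgue_measure R).

Lemma abs_contI_ext f g : (forall x, 0 <= x <= 1 -> f x = g x) ->
  abs_contI f -> abs_contI g.
Proof.
move=> fg fac e /fac[d d0 H]; exists d => // k a b ab dis s.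
rewrite (eq_bigr (fun i => `|f (b i) - f (a i)|)); first exact: H.
by move=> i _; have [? [? ?]] := ab i; rewrite !fg//; apply/andP; split; lra.
Qed.

Lemma abs_contI_lin a f g : abs_contI f -> abs_contI g ->
  abs_contI (fun x => a * f x + g x).
Proof.
move=> fac gac e e0; pose c := `|a| + 1.
have c0 : 0 < c by rewrite /c ltr_wpDl.
have [d1 d10 H1] := fac (e / 2 / c) (divr_gt0 (divr_gt0 e0 (ltr0Sn _ 1)) c0).
have [d2 d20 H2] := gac (e / 2) (divr_gt0 e0 (ltr0Sn _ 1)).
exists (Num.min d1 d2); first by rewrite lt_min d10.
move=> k x y xy dis; rewrite lt_min => /andP[s1 s2].
have := H1 k x y xy dis s1; have := H2 k x y xy dis s2.
move=> h2; rewrite (ltr_pdivlMr _ _ c0) => h1; rewrite [e]splitr.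
apply: le_lt_trans (ltrD h1 h2).
rewrite mulr_suml -big_split/=; apply: ler_sum => i _.
rewrite (_ : _ - _ = a * (f (y i) - f (x i)) + (g (y i) - g (x i))); last by ring.
apply: (le_trans (ler_normD _ _)); rewrite lerD2r normrM mulrC.
by apply: ler_wpM2l => //; rewrite /c lerDl.
Qed.

Variable m : nat.
Hypothesis m_gt0 : (0 < m)%N.

Lemma sobolev_continuous g : sobolev m g -> continuous (g \o clamp01).
Proof. by move=> [/(_ 0 m_gt0) + _ _ _]; exact: abs_contI_continuous. Qed.

Lemma dIn_lin a g1 g2 j x : sobolev m g1 -> sobolev m g2 -> (j < m)%N ->
  0 <= x <= 1 ->
  dIn j (fun z => a * g1 z + g2 z) x = a * dIn j g1 x + dIn j g2 x.
Proof.
move=> [_ D1 _ _] [_ D2 _ _]; elim: j x => [//|j ih] x jm x01.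
rewrite /dIn !iterS (dI_ext x01 (fun z => ih z (ltnW jm))).
by have [] := derivableI_lin a x01 (D1 _ _ jm x01) (D2 _ _ jm x01).
Qed.

Lemma abs_contI_ae_derivableI f : abs_contI f ->
  {ae mu, forall x, x \in `[0, 1] -> derivableI f x}.
Proof.
move=> /abs_contI_ae_derivable; have Fmu := ae_filter_ringOfSetsType mu.
have N0 (z : R) : {ae mu, forall x, x != z}.
  exists [set z]; split; [exact: measurable_set1|exact: lebesgue_measure_set1|].
  by move=> x /= /negP; rewrite negbK => /eqP.
have := N0 1; have := N0 0; apply: filterS3 => x x0 x1 dx.
rewrite in_itv/= => /andP[x0' x1'].
by apply: derivable_derivableI; [|apply: dx]; rewrite !lt_neqAle x0' x1' eq_sym x0 x1.
Qed.

Lemma dIn_lin_ae a g1 g2 : sobolev m g1 -> sobolev m g2 ->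
  {ae mu, forall x, x \in `[0, 1] ->
    dIn m (fun z => a * g1 z + g2 z) x = a * dIn m g1 x + dIn m g2 x}.
Proof.
move=> S1 S2; have [A1 _ _ _] := S1; have [A2 _ _ _] := S2.
have Fmu := ae_filter_ringOfSetsType mu.
have m1 : (m.-1 < m)%N by rewrite prednK.
have := abs_contI_ae_derivableI (A2 _ m1); have := abs_contI_ae_derivableI (A1 _ m1).
apply: filterS2 => x d1 d2 x01; rewrite -(prednK m_gt0) /dIn !iterS.
have x01' : 0 <= x <= 1 by move: x01; rewrite in_itv.
rewrite (dI_ext x01' (fun z => dIn_lin a S1 S2 m1)).
by have [] := derivableI_lin a x01' (d1 x01) (d2 x01).
Qed.

Let mI : measurable (`[0%R, 1%R]%classic : set (measurableTypeR R)).
Proof. exact: measurable_itv. Qed.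

Lemma sobolev_L2 g : sobolev m g -> L2 mu `[0, 1] (dIn m g).
Proof. by move=> []. Qed.

Lemma sobolev_lin a g1 g2 : sobolev m g1 -> sobolev m g2 ->
  sobolev m (fun z => a * g1 z + g2 z).
Proof.
move=> S1 S2; have [A1 D1 _ _] := S1; have [A2 D2 _ _] := S2.
have A j : (j < m)%N -> abs_contI (dIn j (fun z => a * g1 z + g2 z)).
  move=> jm; apply: abs_contI_ext (abs_contI_lin a (A1 _ jm) (A2 _ jm)) => x x01.
  by rewrite dIn_lin.
have m1 : (m.-1 < m)%N by rewrite prednK.
have mm : measurable_fun (`[0, 1] : set R) (dIn m (fun z => a * g1 z + g2 z)).
  rewrite -(prednK m_gt0) /dIn iterS; apply: measurable_dI.
  exact: abs_contI_continuous (A _ m1).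
have L : L2 mu `[0, 1] (dIn m (fun z => a * g1 z + g2 z)).
  have := L2_lin mI a (sobolev_L2 S1) (sobolev_L2 S2).
  move=> /L2_ae_eq; apply => //; have Fmu := ae_filter_ringOfSetsType mu.
  by have := dIn_lin_ae a S1 S2; apply: filterS => x H x01; rewrite H.
split => //; last by case: L.
move=> j x jm x01; have jm' := ltnW jm.
have [H _] := derivableI_lin a x01 (D1 _ _ jm x01) (D2 _ _ jm x01).
by apply: derivableI_ext H => // z z01; rewrite dIn_lin.
Qed.

Lemma Hm_lin per a g1 g2 : Hm per m g1 -> Hm per m g2 ->
  Hm per m (fun z => a * g1 z + g2 z).
Proof.
case: per => /=; last exact: sobolev_lin.
move=> [S1 P1] [S2 P2]; split; first exact: sobolev_lin.
by move=> j jm; rewrite !dIn_lin ?ler01 ?lexx//= P1// P2.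
Qed.

Lemma Hm_sobolev per g : Hm per m g -> sobolev m g.
Proof. by case: per => // -[]. Qed.

Lemma J_sym g1 g2 : J m g1 g2 = J m g2 g1.
Proof. by apply: eq_Rintegral => z _; rewrite mulrC. Qed.

Lemma J_ge0 g : 0 <= J m g g.
Proof. by apply: Rintegral_ge0 => z _; rewrite -expr2 sqr_ge0. Qed.

Lemma J_lin a g1 g2 g3 : sobolev m g1 -> sobolev m g2 -> sobolev m g3 ->
  J m (fun z => a * g1 z + g2 z) g3 = a * J m g1 g3 + J m g2 g3.
Proof.
move=> S1 S2 S3; have I1 := L2_mul_integrable mI (sobolev_L2 S1) (sobolev_L2 S3).
have I2 := L2_mul_integrable mI (sobolev_L2 S2) (sobolev_L2 S3).
rewrite /J -RintegralZl// -RintegralD//; last first.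
  exact: (integrableZl mI a I1).
congr fine; apply: ae_eq_integral => //.
- apply/measurable_EFinP; apply: measurable_funM.
    by have [_ _ +] := sobolev_lin a S1 S2.
  by have [_ _ +] := S3.
- by apply: (measurable_int mu); exact: (integrableD mI (integrableZl mI a I1) I2).
- have Fmu := ae_filter_ringOfSetsType mu.
  have := dIn_lin_ae a S1 S2; apply: filterS => x H x01 /=.
  by rewrite H// mulrDl mulrA.
Qed.

End sobolev_space.

(** * Real expectations and conditional expectations *)

Section real_expectation.
Context d (Om : measurableType d) (R : realType) (P : probability Om R).
Implicit Types f g : Om -> R.

(** The real random variable f is integrable. *)
Definition Pint f := P.-integrable setT (EFin \o f).
(** The expectation of f, as a real number. *)
Definition EE f : R := \int[P]_o f o.

Lemma EEE f : EE f = fine ('E_P[f])%E.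
Proof. by rewrite unlock. Qed.

Lemma Pint_measurable f : Pint f -> measurable_fun setT f.
Proof. by move=> /(measurable_int P)/measurable_EFinP. Qed.

Lemma Pint_fine f : Pint f -> ((EE f)%:E = \int[P]_o (f o)%:E)%E.
Proof. by move=> If; rewrite /EE /Rintegral fineK//; exact: integrable_fin_num. Qed.

Lemma Pint_le f g : measurable_fun setT f -> (forall o, `|f o| <= g o) ->
  Pint g -> Pint f.
Proof.
move=> mf fg; apply: le_integrable => //; first exact/measurable_EFinP.
by move=> o _ /=; rewrite lee_fin (le_trans (fg o))// ler_norm.
Qed.

Lemma Pint_cst c : Pint (fun=> c).
Proof.
apply/integrableP; split; first exact: measurable_cst.
by rewrite integral_cst//= probability_setT mule1 ltry.
Qed.

Lemma EE_cst c : EE (fun=> c) = c.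
Proof. by rewrite /EE Rintegral_cst// [X in fine X](probability_setT P)/= mulr1. Qed.

Lemma Pint_bounded f K : measurable_fun setT f ->
  {ae P, forall o, `|f o| <= K} -> Pint f.
Proof.
move=> mf fK; apply/integrableP; split; first exact/measurable_EFinP.
apply: (@le_lt_trans _ _ (\int[P]_o (`|K|)%:E)%E); last first.
  by rewrite integral_cst//= probability_setT mule1 ltry.
apply: ae_ge0_le_integral => //.
- by apply: measurableT_comp => //; exact/measurable_EFinP.
- have FP := ae_filter_ringOfSetsType P.
  by move: fK; apply: filterS => o fK _ /=; rewrite lee_fin (le_trans fK)// ler_norm.
Qed.

Lemma PintD f g : Pint f -> Pint g -> Pint (fun o => f o + g o).
Proof. by move=> If Ig; have := integrableD measurableT If Ig. Qed.

Lemma PintZ a f : Pint f -> Pint (fun o => a * f o).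
Proof. by move=> If; have := integrableZl measurableT a If. Qed.

Lemma PintN f : Pint f -> Pint (fun o => - f o).
Proof. by move=> /(PintZ (-1)); under eq_fun do rewrite mulN1r. Qed.

Lemma PintB f g : Pint f -> Pint g -> Pint (fun o => f o - g o).
Proof. by move=> If Ig; apply: PintD => //; exact: PintN. Qed.

Lemma Pint_norm f : Pint f -> Pint (fun o => `|f o|).
Proof. by move=> If; have := integrable_abse If. Qed.

Lemma Pint_sum (I : Type) (s : seq I) (F : I -> Om -> R) :
  (forall i, Pint (F i)) -> Pint (fun o => \sum_(i <- s) F i o).
Proof.
move=> IF; elim: s => [|i s ih].
  by under eq_fun do rewrite big_nil; exact: Pint_cst.
by under eq_fun do rewrite big_cons; exact: PintD.
Qed.

Lemma EED f g : Pint f -> Pint g -> EE (fun o => f o + g o) = EE f + EE g.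
Proof. by move=> If Ig; rewrite /EE RintegralD. Qed.

Lemma EEZ a f : Pint f -> EE (fun o => a * f o) = a * EE f.
Proof. by move=> If; rewrite /EE RintegralZl. Qed.

Lemma EEN f : Pint f -> EE (fun o => - f o) = - EE f.
Proof.
by move=> If; rewrite -mulN1r -EEZ//; congr EE; apply/funext => o; rewrite mulN1r.
Qed.

Lemma EEB f g : Pint f -> Pint g -> EE (fun o => f o - g o) = EE f - EE g.
Proof. by move=> If Ig; rewrite EED ?EEN//; exact: PintN. Qed.

Lemma EE_sum (I : Type) (s : seq I) (F : I -> Om -> R) :
  (forall i, Pint (F i)) ->
  EE (fun o => \sum_(i <- s) F i o) = \sum_(i <- s) EE (F i).
Proof.
move=> IF; elim: s => [|i s ih].
  by under eq_fun do rewrite big_nil; rewrite big_nil EE_cst.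
under eq_fun do rewrite big_cons.
by rewrite big_cons EED ?ih//; exact: Pint_sum.
Qed.

Lemma EE_ext f g : f =1 g -> EE f = EE g.
Proof. by move=> /funext ->. Qed.

Lemma EE_ae_ge0 f : Pint f -> {ae P, forall o, 0 <= f o} -> 0 <= EE f.
Proof.
move=> If f0; have -> : EE f = EE (fun o => `|f o|).
  rewrite /EE /Rintegral; congr fine; apply: ae_eq_integral => //.
  - exact: measurable_int If.
  - exact: measurable_int (Pint_norm If).
  - have FP := ae_filter_ringOfSetsType P.
    by move: f0; apply: filterS => o fo _ /=; rewrite ger0_norm.
by apply: Rintegral_ge0.
Qed.

Lemma EE_ae_le f g : Pint f -> Pint g -> {ae P, forall o, f o <= g o} ->
  EE f <= EE g.
Proof.
move=> If Ig fg; rewrite -subr_ge0 -EEB//; apply: EE_ae_ge0; first exact: PintB.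
have FP := ae_filter_ringOfSetsType P.
by move: fg; apply: filterS => o; rewrite subr_ge0.
Qed.

Lemma EE_ge0 f : (forall o, 0 <= f o) -> 0 <= EE f.
Proof. by move=> f0; apply: Rintegral_ge0. Qed.

Lemma EE_le f g : Pint f -> Pint g -> (forall o, f o <= g o) -> EE f <= EE g.
Proof. by move=> If Ig fg; apply: EE_ae_le => //; apply: aeW. Qed.

Lemma EE_ae_eq f g : Pint f -> Pint g -> {ae P, forall o, f o = g o} ->
  EE f = EE g.
Proof.
move=> If Ig fg; have FP := ae_filter_ringOfSetsType P.
by apply/eqP; rewrite eq_le; apply/andP; split; apply: EE_ae_le => //;
  move: fg; apply: filterS => o ->.
Qed.

Lemma Pint_ae_le f g : measurable_fun setT f ->
  {ae P, forall o, `|f o| <= g o} -> Pint g -> Pint f.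
Proof.
move=> mf fg Ig; apply/integrableP; split; first exact/measurable_EFinP.
have /integrableP[mg] := Pint_norm Ig; apply: le_lt_trans.
apply: ae_ge0_le_integral => //.
- by apply: measurableT_comp => //; exact/measurable_EFinP.
- by apply: measurableT_comp.
- have FP := ae_filter_ringOfSetsType P.
  by move: fg; apply: filterS => o fg _ /=; rewrite lee_fin normr_id (le_trans fg)// ler_norm.
Qed.

Lemma Pint_mulb f g K : Pint f -> measurable_fun setT g ->
  {ae P, forall o, `|g o| <= K} -> Pint (fun o => g o * f o).
Proof.
move=> If mg gK.
apply: (@Pint_ae_le _ (fun o => K * `|f o|)).
- by apply: measurable_funM => //; exact: Pint_measurable.
- have FP := ae_filter_ringOfSetsType P.
  by move: gK; apply: filterS => o gK; rewrite normrM ler_wpM2r.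
- by apply: PintZ; exact: Pint_norm.
Qed.

Lemma EE_eq0 f : Pint f -> (forall o, 0 <= f o) -> EE f = 0 ->
  {ae P, forall o, f o = 0}.
Proof.
move=> If f0 Ef0.
have : (\int[P]_o `|(EFin \o f) o| = 0)%E.
  under eq_integral do rewrite gee0_abs/= ?lee_fin//.
  by rewrite -Pint_fine// Ef0.
move=> /ae_eq_integral_abs-/(_ measurableT) H.
have := H (measurable_int P If).
have FP := ae_filter_ringOfSetsType P.
by apply: filterS => o /(_ I)/= [].
Qed.

(** An integer layer cake decomposition approximates t up to 1. *)
Lemma layer_cake_le1 (t : R) M : 0 <= t <= M%:R ->
  `|t - \sum_(k < M) (k.+1%:R <= t)%R%:R| <= 1.
Proof.
elim: M t => [|M ih] t /andP[t0 tM].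
  by rewrite big_ord0 subr0 ger0_norm// (le_trans tM).
rewrite big_ord_recr/=; have [tM'|Mt] := leP t M%:R.
  have := ih t; rewrite t0 tM' => /(_ erefl).
  have [tM1|//] := leP M.+1%:R t; last by rewrite addr0.
  by have := le_trans tM1 tM'; rewrite ler_nat ltnn.
have -> : \sum_(k < M) (k.+1%:R <= t)%R%:R = M%:R :> R.
  rewrite (eq_bigr (fun=> 1)) ?sumr_const ?card_ord// => k _.
  by rewrite (le_trans _ (ltW Mt))// ler_nat.
move: tM; rewrite -natr1; move: Mt; move: (M%:R : R) => v vt tv.
by rewrite ler_norml; have [h|h] := leP (v + 1) t; rewrite /= ?mulr1n ?mulr0n; apply/andP; split; lra.
Qed.

Section cexp.
Context d' (S : measurableType d') (W : Om -> S).
Hypothesis mW : measurable_fun setT W.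

(** If E(c | W) <= 0 in the sense that c has nonpositive integrals on the events
defined by W, then E(phi(W) c) <= 0 for every bounded nonnegative phi.  Layer
cake approximations of n phi give n E(phi(W) c) <= E|c| for all n. *)
Lemma cexp_le0 (c : Om -> R) (phi : S -> R) K : Pint c ->
  (forall B, measurable B -> \int[P]_(o in W @^-1` B) c o <= 0) ->
  measurable_fun setT phi -> (forall s, 0 <= phi s <= K) ->
  EE (fun o => phi (W o) * c o) <= 0.
Proof.
move=> Ic c0 mphi phiK.
have mphiW : measurable_fun setT (phi \o W) by exact: measurableT_comp.
have IphiC : Pint (fun o => phi (W o) * c o).
  apply: (@Pint_mulb _ _ K) => //.
  by apply: aeW => o /=; have /andP[p0 pK] := phiK (W o); rewrite ger0_norm.
have key n : n%:R * EE (fun o => phi (W o) * c o) <= EE (fun o => `|c o|).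
  (* M layers suffice for n phi, which is at most n K *)
  pose M := Num.bound (n%:R * K).
  pose A k := [set s | k.+1%:R <= n%:R * phi s].
  have mA k : measurable (A k).
    rewrite -[A k]setTI; apply: (@measurable_fun_le _ _ _ setT (cst k.+1%:R)) => //.
    by apply: measurable_funM => //; exact: measurable_cst.
  pose F k o := (k.+1%:R <= n%:R * phi (W o))%R%:R * c o.
  have FE k : F k = (c \_ (W @^-1` A k)).
    apply/funext => o; rewrite /F patchE /A; case: ifPn.
      by rewrite inE /= => ->; rewrite mul1r.
    by rewrite notin_setE /= => /negP/negPf ->; rewrite mul0r.
  have mWA k : measurable (W @^-1` A k).
    by rewrite -[_ @^-1` _]setTI; exact: mW.
  have IF k : Pint (F k).
    rewrite FE /Pint (_ : EFin \o _ = (EFin \o c) \_ (W @^-1` A k)).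
      by apply/integrable_restrict => //; rewrite setTI; apply: integrableS Ic.
    by apply/funext => o /=; rewrite !patchE; case: ifP.
  have IFs : Pint (fun o => \sum_(k <- index_enum 'I_M) F k o) by exact: Pint_sum.
  rewrite -EEZ//.
  have -> : EE (fun o => n%:R * (phi (W o) * c o)) =
      EE (fun o => \sum_(k < M) F k o) +
      EE (fun o => n%:R * (phi (W o) * c o) - \sum_(k < M) F k o).
    rewrite -EED//; last by apply: PintB => //; exact: PintZ.
    by apply: EE_ext => o; rewrite addrC subrK.
  have -> : EE (fun o => `|c o|) = 0 + EE (fun o => `|c o|) by rewrite add0r.
  apply: lerD.
    rewrite EE_sum//; apply: sumr_le0 => k _.
    by rewrite /EE FE -Rintegral_mkcond; exact: c0.
  apply: EE_le; [by apply: PintB => //; exact: PintZ|exact: Pint_norm|].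
  move=> o; rewrite mulrA -mulr_suml -mulrBl (le_trans (ler_norm _))// normrM.
  rewrite ler_piMl//; apply: layer_cake_le1.
  have /andP[p0 pK] := phiK (W o).
  rewrite mulr_ge0//= (@le_trans _ _ (n%:R * K))//; first by rewrite ler_wpM2l.
  by apply/ltW/archi_boundP; rewrite mulr_ge0// (le_trans p0).
rewrite leNgt; apply/negP => E0.
set e := EE _ in E0 key; set t := EE _ in key.
have t0 : 0 <= t by apply: EE_ge0.
have := key (Num.bound (t / e)).
rewrite -ler_pdivlMr// leNgt => /negP; apply.
by apply: archi_boundP; rewrite divr_ge0// ltW.
Qed.

Lemma cexp_eq0 (c : Om -> R) (phi : S -> R) K : Pint c ->
  (forall B, measurable B -> \int[P]_(o in W @^-1` B) c o = 0) ->
  measurable_fun setT phi -> (forall s, `|phi s| <= K) ->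
  EE (fun o => phi (W o) * c o) = 0.
Proof.
move=> Ic c0 mphi phiK.
have mphiW : measurable_fun setT (phi \o W) by exact: measurableT_comp.
have K0 s : 0 <= phi s + K <= K + K.
  by have := phiK s; rewrite ler_norml => /andP[? ?]; apply/andP; split; lra.
have mphiK : measurable_fun setT (fun s => phi s + K).
  by apply: measurable_funD => //; exact: measurable_cst.
have Iphi : Pint (fun o => phi (W o) * c o).
  by apply: (@Pint_mulb _ _ K) => //; apply: aeW => o; exact: phiK.
have Ec : EE c = 0 by have := c0 setT measurableT; rewrite preimage_setT.
have E1 : EE (fun o => (phi (W o) + K) * c o) = EE (fun o => phi (W o) * c o).
  rewrite (_ : EE _ = EE (fun o => phi (W o) * c o + K * c o)).
    by rewrite EED ?EEZ ?Ec ?mulr0 ?addr0//; exact: PintZ.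
  by apply: EE_ext => o; rewrite mulrDl.
apply/eqP; rewrite eq_le; apply/andP; split.
  by rewrite -E1; apply: cexp_le0 (K0) => // B mB; rewrite c0.
rewrite -E1 -oppr_le0 -EEN; last first.
  apply: (@Pint_mulb _ _ (K + K)) => //.
    by apply: measurable_funD => //; exact: measurable_cst.
  by apply: aeW => o; have /andP[? ?] := K0 (W o); rewrite ger0_norm.
under EE_ext do rewrite -mulrN.
apply: (cexp_le0 _ _ mphiK K0); first exact: PintN.
move=> B mB; rewrite -[X in X <= _]/(Rintegral P (W @^-1` B) (fun o => - c o)).
have mWB : measurable (W @^-1` B) by rewrite -[_ @^-1` _]setTI; exact: mW.
under eq_Rintegral do rewrite -mulN1r.
by rewrite RintegralZl// ?c0// ?mulr0//; exact: integrableS Ic.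
Qed.

(** w is a version of the conditional expectation of v given W, both being real and
integrable; the defining identity is stated for bounded functions of W. *)
Definition cexpR (v : Om -> R) (w : S -> R) := [/\ Pint v, Pint (w \o W),
  measurable_fun setT w & forall (phi : S -> R) K, measurable_fun setT phi ->
    (forall s, `|phi s| <= K) ->
    EE (fun o => phi (W o) * w (W o)) = EE (fun o => phi (W o) * v o)].

(** The integrability of w(W) follows from that of v by integrating separately
where w is nonnegative and where it is negative. *)
Lemma is_cexp_cexpR (v : Om -> R) (w : S -> R) : Pint v ->
  is_cexp P W (EFin \o v) (EFin \o w) -> cexpR v w.
Proof.
move=> Iv [mv _ mw' vw].
have mw : measurable_fun setT w by exact/measurable_EFinP.
have mwW : measurable_fun setT (w \o W) by exact: measurableT_comp.
have mWB B : measurable B -> measurable (W @^-1` B).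
  by move=> mB; rewrite -[_ @^-1` _]setTI; exact: mW.
pose A := [set s | 0 <= w s].
have mA : measurable A.
  by rewrite -[A]setTI; apply: measurable_fun_le => //; exact: measurable_cst.
have fin B : measurable B -> (`|\int[P]_(o in W @^-1` B) (v o)%:E| < +oo)%E.
  move=> mB; have : P.-integrable (W @^-1` B) (EFin \o v).
    by apply: integrableS Iv => //; exact: mWB.
  by move=> /(integrable_fin_num (mWB _ mB)); rewrite fin_num_abs.
have Iw : Pint (w \o W).
  apply/integrableP; split; first exact/measurable_EFinP.
  have mE : measurable_fun setT (fun o => `|(EFin \o (w \o W)) o|%E).
    by apply: measurableT_comp => //; exact/measurable_EFinP.
  rewrite -(setUv (W @^-1` A)) ge0_integral_setU//=; last 4 first.
  - exact: mWB.
  - by apply: measurableC; exact: mWB.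
  - exact: measurable_funTS.
  - by apply/disj_setPS => o [].
  apply: lte_add_pinfty.
    rewrite (eq_integral (fun o => (w (W o))%:E)).
      rewrite vw//; apply: le_lt_trans (fin _ mA); exact: lee_abs.
    by move=> o; rewrite inE /A /= => w0; rewrite ger0_norm.
  rewrite (eq_integral (fun o => - (w (W o))%:E)%E); last first.
    move=> o; rewrite inE /A /= => /negP; rewrite -ltNge => w0.
    by rewrite ltr0_norm.
  have mAC := measurableC mA.
  have -> : (\int[P]_(o in ~` (W @^-1` A)) - (w (W o))%:E =
      - \int[P]_(o in W @^-1` (~` A)) (v o)%:E)%E.
    rewrite -vw// -[LHS]oppeK; congr (- _)%E.
    rewrite -integral_ge0N; last first.
      by move=> o; rewrite /A /= => /negP; rewrite -ltNge => /ltW w0; rewrite lee_fin oppr_ge0.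
    by apply: eq_integral => o _; rewrite oppeK.
  by apply: le_lt_trans (fin _ mAC); rewrite -abseN; exact: lee_abs.
split => // phi K mphi phiK.
have IwW : Pint (fun o => w (W o)) by exact: Iw.
have mphiW : measurable_fun setT (fun o => phi (W o)) by exact: measurableT_comp.
have aeK : {ae P, forall o, `|phi (W o)| <= K} by apply: aeW => o; exact: phiK.
have I1 := Pint_mulb IwW mphiW aeK; have I2 := Pint_mulb Iv mphiW aeK.
apply/eqP; rewrite -subr_eq0 -EEB//; apply/eqP.
rewrite -[RHS](cexp_eq0 (PintB IwW Iv) _ mphi phiK).
  by apply: EE_ext => o; rewrite mulrBr.
move=> B mB.
have IB f : Pint f -> P.-integrable (W @^-1` B) (EFin \o f).
  by move=> If; apply: integrableS If => //; exact: mWB.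
rewrite RintegralB; [|exact: mWB|exact: IB|exact: IB].
by rewrite /Rintegral; have := vw _ mB => /= ->; rewrite subrr.
Qed.

Lemma cexpRN v w : cexpR v w -> cexpR (fun o => - v o) (fun s => - w s).
Proof.
move=> [Iv Iw mw H]; split; [exact: PintN|exact: PintN|exact: measurable_funN|].
move=> phi K mphi phiK.
have mphiW : measurable_fun setT (fun o => phi (W o)) by exact: measurableT_comp.
have aeK : {ae P, forall o, `|phi (W o)| <= K} by apply: aeW => o; exact: phiK.
have I1 := Pint_mulb Iw mphiW aeK; have I2 := Pint_mulb Iv mphiW aeK.
rewrite (EE_ext (fun o => mulrN (phi (W o)) (w (W o)))) EEN//.
by rewrite (EE_ext (fun o => mulrN (phi (W o)) (v o))) EEN// (H _ _ mphi phiK).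
Qed.

(** An almost sure bound on v passes to its conditional expectation. *)
Lemma cexpR_le v w K : cexpR v w -> {ae P, forall o, v o <= K} ->
  {ae P, forall o, w (W o) <= K}.
Proof.
move=> [Iv Iw mw H] vK.
pose phi s : R := (K < w s)%R%:R.
have mphi : measurable_fun setT phi.
  have mA : measurable [set s | K < w s].
    rewrite (_ : [set s | _] = w @^-1` `]K, +oo[%classic).
      by rewrite -[_ @^-1` _]setTI; exact: mw.
    by apply/seteqP; split => s /=; rewrite in_itv/= andbT.
  rewrite (_ : phi = \1_[set s | K < w s]); first exact: measurable_indic.
  apply/funext => s; rewrite /phi indicE (_ : (s \in _) = (K < w s)%R)//.
  by apply/idP/idP; rewrite inE.
have phi1 s : `|phi s| <= 1 by rewrite /phi; case: ltP; rewrite ?normr1 ?normr0.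
have mphiW : measurable_fun setT (fun o => phi (W o)) by exact: measurableT_comp.
have aeK : {ae P, forall o, `|phi (W o)| <= 1} by apply: aeW => o; exact: phi1.
have I1 := Pint_mulb Iw mphiW aeK; have I2 := Pint_mulb Iv mphiW aeK.
have I3 : Pint (fun o => K * phi (W o)) by apply: PintZ; exact: (@Pint_bounded _ 1).
have E0 : EE (fun o => phi (W o) * w (W o) - K * phi (W o)) = 0.
  apply/eqP; rewrite eq_le; apply/andP; split.
    rewrite EEB// (H _ _ mphi phi1) -EEB// -oppr_ge0 -EEN; last exact: PintB.
    apply: EE_ae_ge0; first by apply: PintN; exact: PintB.
    have FP := ae_filter_ringOfSetsType P; move: vK; apply: filterS => o vK.
    have p0 : 0 <= phi (W o) by rewrite /phi ler0n.
    have h : 0 <= phi (W o) * (K - v o) by rewrite mulr_ge0// subr_ge0.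
    by rewrite mulrBr in h; lra.
  by apply: EE_ge0 => o; rewrite /phi; case: ltP => h; rewrite ?mulr1n ?mulr0n; lra.
have FP := ae_filter_ringOfSetsType P.
have := EE_eq0 (PintB I1 I3) _ E0; move=> /(_ _)[].
  by move=> o; rewrite /phi /=; case: ltP => h; rewrite ?mulr1n ?mulr0n; lra.
move=> N [mN N0 sN]; exists N; split => // o /= /negP; rewrite -ltNge => wK.
by apply: sN => /=; rewrite /phi wK; apply/eqP; rewrite gt_eqF// mulr1n; lra.
Qed.

Lemma cexpR_ge v w K : cexpR v w -> {ae P, forall o, K <= v o} ->
  {ae P, forall o, K <= w (W o)}.
Proof.
move=> /cexpRN cvw vK; have FP := ae_filter_ringOfSetsType P.
have vK' : {ae P, forall o, - v o <= - K}.
  by move: vK; apply: filterS => o; rewrite lerN2.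
by have := cexpR_le cvw vK'; apply: filterS => o; rewrite lerN2.
Qed.

End cexp.
End real_expectation.

(** * Independent copies *)

Section iid_sample.
Context d (Om : measurableType d) (R : realType) (P : probability Om R).
Context d' (S : measurableType d') (T : {RV P >-> S}) (Ts : nat -> {RV P >-> S}).
Hypothesis iid : iid_copies P T Ts.

Let eq_dist i A : measurable A -> distribution P (Ts i) A = distribution P T A.
Proof. by move=> mA; rewrite /distribution /pushforward; exact: (proj1 iid). Qed.

Lemma Pint_distribution (X : {RV P >-> S}) (f : S -> R) : measurable_fun setT f ->
  Pint P (f \o X) -> Pint (distribution P X) f.
Proof.
move=> mf /integrableP[_ If]; apply/integrableP; split; first exact/measurable_EFinP.
rewrite ge0_integral_distribution//.
by apply: measurableT_comp => //; exact/measurable_EFinP.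
Qed.

Lemma EE_distribution (X : {RV P >-> S}) (f : S -> R) : measurable_fun setT f ->
  Pint P (f \o X) -> EE (distribution P X) f = EE P (f \o X).
Proof.
move=> mf If; rewrite /EE /Rintegral integral_distribution//.
exact/measurable_EFinP.
Qed.

Lemma iid_Pint i (f : S -> R) : measurable_fun setT f ->
  Pint P (f \o T) -> Pint P (f \o Ts i).
Proof.
move=> mf If; have mEf : measurable_fun setT (EFin \o f) by exact/measurable_EFinP.
have mfT (X : {RV P >-> S}) : measurable_fun setT (EFin \o (f \o X)).
  by apply/measurable_EFinP; exact: measurableT_comp.
apply/integrableP; split; first exact: mfT.
have mab : measurable_fun setT (fun s => `|(f s)%:E|%E) by exact: measurableT_comp.
have /integrableP[_] := If.
rewrite -(ge0_integral_distribution T mab)//.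
rewrite -(ge0_integral_distribution (Ts i) mab)//.
rewrite (eq_measure_integral (distribution P (Ts i)))// => A mA _.
by first [exact: eq_dist|exact/esym/eq_dist].
Qed.

Lemma iid_EE i (f : S -> R) : measurable_fun setT f ->
  Pint P (f \o T) -> EE P (f \o Ts i) = EE P (f \o T).
Proof.
move=> mf If; have Ii := iid_Pint i mf If.
rewrite -!EE_distribution// /EE /Rintegral; congr fine.
by apply: eq_measure_integral => A mA _; first [exact: eq_dist|exact/esym/eq_dist].
Qed.

(** The case n = 2 of independence, at two arbitrary distinct indices. *)
Lemma iid_pair i j (A B : set S) : i != j -> measurable A -> measurable B ->
  P (Ts i @^-1` A `&` Ts j @^-1` B) = (P (T @^-1` A) * P (T @^-1` B))%E.
Proof.
move=> ij mA mB; pose n := (maxn i j).+1.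
have iN : (i < n)%N by rewrite ltnS leq_maxl.
have jN : (j < n)%N by rewrite ltnS leq_maxr.
pose i' := Ordinal iN; pose j' := Ordinal jN.
have ij' : i' != j' by [].
pose C (k : 'I_n) := if k == i' then A else if k == j' then B else setT.
have mC k : measurable (C k) by rewrite /C; case: ifP => // _; case: ifP.
have := proj2 iid n C mC.
rewrite (bigD1 i')//= (bigD1 j')/=; last by rewrite eq_sym.
rewrite big1 ?mule1; last first.
  move=> k /andP[ki kj]; rewrite /C (negPf ki) (negPf kj) preimage_setT.
  exact: probability_setT.
rewrite /C eqxx [j' == i']eq_sym (negPf ij') eqxx !(proj1 iid)// => <-.
congr (P _); apply/seteqP; split => [w [wA wB] k _ | w H].
  by case: ifPn => [/eqP ->//|_]; case: ifPn => [/eqP ->|].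
split; first by have := H i' I; rewrite eqxx.
by have := H j' I; rewrite [j' == i']eq_sym (negPf ij') eqxx.
Qed.

(** Distinct observations are uncorrelated: their joint law is the product of
their laws. *)
Lemma iid_EE_mul i j (f : S -> R) : i != j -> measurable_fun setT f ->
  Pint P (fun o => f (T o) ^+ 2) ->
  Pint P (fun o => f (Ts i o) * f (Ts j o)) /\
  EE P (fun o => f (Ts i o) * f (Ts j o)) = EE P (f \o T) ^+ 2.
Proof.
move=> ij mf If2.
have If : Pint P (f \o T).
  apply: (@Pint_le _ _ _ _ _ (fun o => 1 + f (T o) ^+ 2)).
  - exact: measurableT_comp.
  - move=> o /=; rewrite ler_norml; have := sqr_ge0 (f (T o) - 1); have := sqr_ge0 (f (T o) + 1).
    by rewrite sqrrD sqrrB => h1 h2; apply/andP; split; nra.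
  - by apply: PintD => //; exact: Pint_cst.
have mf2 : measurable_fun setT (fun s => f s ^+ 2) by exact: measurable_funX.
have If2i k : Pint P (fun o => f (Ts k o) ^+ 2) := iid_Pint k mf2 If2.
have mfk k : measurable_fun setT (fun o => f (Ts k o)) by exact: measurableT_comp.
have Iij : Pint P (fun o => f (Ts i o) * f (Ts j o)).
  apply: (@Pint_le _ _ _ _ _ (fun o => f (Ts i o) ^+ 2 + f (Ts j o) ^+ 2)).
  - exact: measurable_funM.
  - move=> o; rewrite ler_norml; have := sqr_ge0 (f (Ts i o) - f (Ts j o)).
    have := sqr_ge0 (f (Ts i o) + f (Ts j o)).
    by move=> h1 h2; apply/andP; split; nra.
  - exact: PintD.
split => //.
pose W o := (Ts i o, Ts j o).
have mW : measurable_fun setT W.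
  by apply: measurable_fun_pair; exact: measurable_funPT.
pose Wm : {mfun Om >-> (S * S)%type} := HB.pack W (isMeasurableFun.Build _ _ _ _ W mW).
pose m := distribution P T; pose F (z : S * S) : \bar R := (f z.1 * f z.2)%:E.
have mF : measurable_fun setT F.
  apply/measurable_EFinP; apply: measurable_funM.
    exact: (measurableT_comp mf measurable_fst).
  exact: (measurableT_comp mf measurable_snd).
have jE X : measurable X -> (m \x m)%E X = distribution P Wm X.
  apply: product_measure_unique => A B mA mB.
  by rewrite -(iid_pair ij mA mB).
have IF : (m \x m)%E.-integrable setT F.
  apply/integrableP; split => //.
  rewrite (eq_measure_integral (distribution P Wm)); last by move=> A mA _; exact: jE.
  rewrite ge0_integral_distribution//; last exact: measurableT_comp.
  by have /integrableP[_] := Iij.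
apply: EFin_inj; rewrite Pint_fine//.
have -> : (\int[P]_o (f (Ts i o) * f (Ts j o))%:E = \int[distribution P Wm]_z F z)%E.
  by rewrite integral_distribution.
rewrite -(eq_measure_integral _ (fun A mA _ => jE A mA)) -integral12_prod_meas1//.
have Im : Pint m f by exact: Pint_distribution.
rewrite (eq_integral (fun x => (EE m f)%:E * (f x)%:E)%E); last first.
  move=> x _; rewrite /fubini_F /F/=.
  under eq_integral do rewrite EFinM.
  by rewrite integralZl// -Pint_fine// muleC.
by rewrite integralZl// -Pint_fine// -EFinM -EE_distribution// expr2.
Qed.

(** The variance of an empirical mean. *)
Lemma iid_mean_sqr n (f : S -> R) : (0 < n)%N -> measurable_fun setT f ->
  Pint P (fun o => f (T o) ^+ 2) ->
  Pint P (fun o => (n%:R^-1 * \sum_(i < n) f (Ts i o) - EE P (f \o T)) ^+ 2) /\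
  EE P (fun o => (n%:R^-1 * \sum_(i < n) f (Ts i o) - EE P (f \o T)) ^+ 2)
    <= n%:R^-1 * EE P (fun o => f (T o) ^+ 2).
Proof.
move=> n0 mf If2; set e := EE P (f \o T).
have If : Pint P (f \o T).
  apply: (@Pint_le _ _ _ _ _ (fun o => 1 + f (T o) ^+ 2)).
  - exact: measurableT_comp.
  - move=> o /=; rewrite ler_norml; have := sqr_ge0 (f (T o) - 1); have := sqr_ge0 (f (T o) + 1).
    by rewrite sqrrD sqrrB => h1 h2; apply/andP; split; nra.
  - by apply: PintD => //; exact: Pint_cst.
pose g s := f s - e.
have mg : measurable_fun setT g by apply: measurable_funB => //; exact: measurable_cst.
have gE o : g (T o) ^+ 2 = f (T o) ^+ 2 - (2 * e) * f (T o) + e ^+ 2.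
  by rewrite /g; ring.
have Ig2 : Pint P (fun o => g (T o) ^+ 2).
  rewrite (_ : (fun o => _) = fun o => f (T o) ^+ 2 - (2 * e) * f (T o) + e ^+ 2).
    by apply: PintD; [apply: PintB => //; exact: PintZ|exact: Pint_cst].
  by apply/funext => o; rewrite gE.
have Eg2 : EE P (fun o => g (T o) ^+ 2) <= EE P (fun o => f (T o) ^+ 2).
  rewrite (EE_ext _ gE) EED; [|by apply: PintB => //; exact: PintZ|exact: Pint_cst].
  rewrite EEB//; last exact: PintZ.
  by rewrite EEZ// EE_cst -/e; have := sqr_ge0 e; rewrite expr2; lra.
have Eg : EE P (g \o T) = 0.
  by rewrite /g (EEB If (Pint_cst P e)) EE_cst subrr.
have sE o : (n%:R^-1 * \sum_(i < n) f (Ts i o) - e) ^+ 2 =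
    (n%:R^-1) ^+ 2 * \sum_(i < n) \sum_(j < n) g (Ts i o) * g (Ts j o).
  rewrite -(eq_bigr _ (fun i _ => mulr_sumr _ _ _ _)) -mulr_suml -expr2 -exprMn; congr (_ ^+ 2).
  by rewrite /g sumrB sumr_const card_ord mulrBr -[e *+ n]mulr_natl mulKf// pnatr_eq0 -lt0n.
have If2i k : Pint P (fun o => g (Ts k o) ^+ 2) :=
  iid_Pint k (measurable_funX 2 mg) Ig2.
have Ig (i j : 'I_n) : Pint P (fun o => g (Ts i o) * g (Ts j o)).
  have [<-|ij] := eqVneq (i : nat) j; first exact: If2i.
  by have [] := iid_EE_mul ij mg Ig2.
have Igs (i : 'I_n) : Pint P (fun o => \sum_(j < n) g (Ts i o) * g (Ts j o)).
  by apply: Pint_sum.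
have Igss : Pint P (fun o => \sum_(i < n) \sum_(j < n) g (Ts i o) * g (Ts j o)).
  by apply: Pint_sum.
split.
  by under eq_fun do rewrite sE; exact: PintZ.
rewrite (EE_ext _ sE) EEZ// EE_sum//.
rewrite (eq_bigr (fun=> EE P (fun o => g (T o) ^+ 2))); last first.
  move=> i _; rewrite EE_sum// (bigD1 i)//= big1 ?addr0.
    exact: iid_EE (measurable_funX 2 mg) Ig2.
  move=> j ji; have ij : (i : nat) != j by rewrite eq_sym.
  by have [_ ->] := iid_EE_mul ij mg Ig2; rewrite Eg expr2 mul0r.
rewrite sumr_const card_ord; set E2 := EE _ _.
have n0' : n%:R != 0 :> R by rewrite pnatr_eq0 -lt0n.
have -> : n%:R^-1 ^+ 2 * (E2 *+ n) = n%:R^-1 * E2.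
  by rewrite -[E2 *+ n]mulr_natl expr2 -mulrA mulKf.
by rewrite ler_wpM2l// invr_ge0.
Qed.

End iid_sample.

(** * Empirical bilinear forms *)

Section cauchy_schwarz.
Context {R : realType}.
Implicit Types a b c : R.

(** The discriminant of a nonnegative quadratic polynomial. *)
Lemma quadratic_ge0_CS a b c : 0 <= a -> 0 <= c ->
  (forall t, 0 <= a + 2 * t * b + t ^+ 2 * c) -> b ^+ 2 <= a * c.
Proof.
move=> a0; rewrite le_eqVlt => /predU1P[<- H|c0 H].
  suff -> : b = 0 by rewrite mulr0 expr0n.
  apply/eqP; rewrite -sqrf_eq0; apply/negPn/negP => b0.
  have {}b0 : 0 < b ^+ 2 by rewrite lt_def b0 sqr_ge0.
  have := H (- (a + 1) / (2 * b ^+ 2) * b).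
  rewrite mulr0 addr0 (_ : a + _ = - 1); first by rewrite lerNr oppr0 ler10.
  have b0' : b != 0 by apply: contraTneq b0 => ->; rewrite expr0n/= ltxx.
  by field.
have := H (- b / c); rewrite [X in 0 <= X](_ : _ = (a * c - b ^+ 2) / c); last first.
  by field; rewrite gt_eqF.
by rewrite pmulr_lge0 ?invr_gt0// subr_ge0.
Qed.

Lemma sum_CS (I : finType) (x y : I -> R) :
  (\sum_i x i * y i) ^+ 2 <= (\sum_i x i ^+ 2) * (\sum_i y i ^+ 2).
Proof.
apply: quadratic_ge0_CS; [by apply: sumr_ge0 => i _; rewrite sqr_ge0..|move=> t].
rewrite (_ : _ + _ = \sum_i (x i + t * y i) ^+ 2).
  by apply: sumr_ge0 => i _; rewrite sqr_ge0.
rewrite !mulr_sumr -!big_split/=; apply: eq_bigr => i _; ring.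
Qed.

(** The triangle inequality, in terms of the Gram coefficients a, b, c of two
vectors. *)
Lemma sqrt_triangle a b c : 0 <= a -> 0 <= c ->
  (forall t, 0 <= a + 2 * t * b + t ^+ 2 * c) ->
  Num.sqrt (a + 2 * b + c) <= Num.sqrt a + Num.sqrt c.
Proof.
move=> a0 c0 H; have CS := quadratic_ge0_CS a0 c0 H.
rewrite -[leRHS]ger0_norm ?addr_ge0 ?sqrtr_ge0// -sqrtr_sqr ler_sqrt ?sqr_ge0//.
rewrite sqrrD !sqr_sqrtr// lerD2r lerD2l mulr_natl lerMn2r/= -sqrtrM//.
by rewrite (le_trans (ler_norm _))// -sqrtr_sqr ler_sqrt// mulr_ge0.
Qed.

End cauchy_schwarz.

Section empirical_bilinear_form.
Context d (Om : measurableType d) (R : realType) (P : probability Om R).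
Context d' (S : measurableType d') (T : {RV P >-> S}) (Ts : nat -> {RV P >-> S}).
Hypothesis iid : iid_copies P T Ts.
Variable omega : S -> R.
Hypothesis momega : measurable_fun setT omega.
Hypothesis omega2 : Pint P (fun o => omega (T o) ^+ 2).

(** The centered empirical mean of omega f g. *)
Definition bform n (f g : S -> R) (o : Om) : R :=
  n%:R^-1 * \sum_(i < n) omega (Ts i o) * f (Ts i o) * g (Ts i o)
  - EE P (fun o' => omega (T o') * f (T o') * g (T o')).

Let bmeas (f : S -> R) := measurable_fun setT f /\ exists K : R, forall s, `|f s| <= K.

Lemma Pint_omega : Pint P (fun o => omega (T o)).
Proof.
apply: (@Pint_le _ _ _ _ _ (fun o => 1 + omega (T o) ^+ 2)).
- exact: measurableT_comp.
- move=> o /=; rewrite ler_norml; have := sqr_ge0 (omega (T o) - 1).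
  have := sqr_ge0 (omega (T o) + 1).
  by rewrite sqrrD sqrrB => h1 h2; apply/andP; split; nra.
- by apply: PintD => //; exact: Pint_cst.
Qed.

Lemma Pint_omega_mul f g : bmeas f -> bmeas g ->
  Pint P (fun o => omega (T o) * f (T o) * g (T o)).
Proof.
move=> [mf [Kf fK]] [mg [Kg gK]].
rewrite (_ : (fun o => omega (T o) * f (T o) * g (T o)) =
  (fun o => (f (T o) * g (T o)) * omega (T o))).
  apply: (@Pint_mulb _ _ _ _ _ _ (Kf * Kg)); first exact: Pint_omega.
    by apply: measurable_funM; exact: measurableT_comp.
  by apply: aeW => o; rewrite normrM ler_pM.
by apply/funext => o; ring.
Qed.

Lemma bform_linl n a f1 f2 g o : bmeas f1 -> bmeas f2 -> bmeas g ->
  bform n (fun s => a * f1 s + f2 s) g o = a * bform n f1 g o + bform n f2 g o.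
Proof.
move=> bf1 bf2 bg; have I1 := Pint_omega_mul bf1 bg; have I2 := Pint_omega_mul bf2 bg.
rewrite /bform; set E := EE P _; set S0 := \sum_(i < n) _.
have -> : E = a * EE P (fun o => omega (T o) * f1 (T o) * g (T o)) +
    EE P (fun o => omega (T o) * f2 (T o) * g (T o)).
  by rewrite -EEZ// -EED//; [apply: EE_ext => w; ring|exact: PintZ].
have -> : S0 = a * \sum_(i < n) omega (Ts i o) * f1 (Ts i o) * g (Ts i o) +
    \sum_(i < n) omega (Ts i o) * f2 (Ts i o) * g (Ts i o).
  by rewrite /S0 mulr_sumr -big_split/=; apply: eq_bigr => i _; ring.
ring.
Qed.

Lemma bform_sym n f g o : bform n f g o = bform n g f o.
Proof.
rewrite /bform; congr (_ * _ - _); first by apply: eq_bigr => i _; rewrite mulrAC.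
by apply: EE_ext => w; rewrite mulrAC.
Qed.

Variables (e : nat -> S -> R) (Ce : R).
Hypothesis me : forall k, measurable_fun setT (e k).
Hypothesis e_le : forall k s, `|e k s| <= Ce.

Let be k : bmeas (e k). Proof. by split => //; exists Ce. Qed.

Lemma bmeas_comb (a : nat -> R) N : bmeas (fun s => \sum_(k < N) a k * e k s).
Proof.
split.
  by apply: measurable_sum => k; apply: measurable_funM => //; exact: measurable_cst.
exists (\sum_(k < N) `|a k| * Ce) => s; apply: (le_trans (ler_norm_sum _ _ _)).
by apply: ler_sum => k _; rewrite normrM ler_wpM2l.
Qed.

Lemma bform_combl n (a : nat -> R) N g o : bmeas g ->
  bform n (fun s => \sum_(k < N) a k * e k s) g o = \sum_(k < N) a k * bform n (e k) g o.
Proof.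
move=> bg; elim: N => [|N ih].
  rewrite big_ord0 /bform; rewrite big1 ?mulr0; last first.
    by move=> i _; rewrite big_ord0 mulr0 mul0r.
  rewrite (EE_ext _ (_ : _ =1 fun=> 0)) ?EE_cst ?subr0// => w.
  by rewrite big_ord0 mulr0 mul0r.
rewrite (_ : (fun s => _) = fun s => a N * e N s + \sum_(k < N) a k * e k s).
  by rewrite bform_linl// ?ih ?big_ord_recr/= 1?addrC//; exact: bmeas_comb.
by apply/funext => s; rewrite big_ord_recr addrC.
Qed.

Variables (w : nat -> R) (Sw : R).
Hypothesis w_gt0 : forall k, 0 < w k.
Hypothesis w_sum : forall N, \sum_(k < N) (w k)^-1 <= Sw.

Let HS n N o := \sum_(k < N) \sum_(l < N) bform n (e k) (e l) o ^+ 2 / (w k * w l).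

Lemma bform_sqr_EE n k l : (0 < n)%N ->
  Pint P (fun o => bform n (e k) (e l) o ^+ 2) /\
  EE P (fun o => bform n (e k) (e l) o ^+ 2)
    <= n%:R^-1 * (Ce ^+ 4 * EE P (fun o => omega (T o) ^+ 2)).
Proof.
move=> n0; pose f s := omega s * e k s * e l s.
have mf : measurable_fun setT f by do 2 apply: measurable_funM => //.
have Ce0 : 0 <= Ce by exact: le_trans (e_le 0 (T point)).
have fle o : f (T o) ^+ 2 <= Ce ^+ 4 * omega (T o) ^+ 2.
  have eC j s : e j s ^+ 2 <= Ce ^+ 2.
    by rewrite -[leLHS]real_normK ?num_real// lerXn2r ?nnegrE.
  rewrite (_ : f (T o) ^+ 2 = (e k (T o) ^+ 2 * e l (T o) ^+ 2) * omega (T o) ^+ 2).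
    rewrite ler_wpM2r ?sqr_ge0// (_ : Ce ^+ 4 = Ce ^+ 2 * Ce ^+ 2); last by rewrite -exprD.
    by apply: ler_pM; rewrite ?sqr_ge0.
  by rewrite /f; ring.
have If2 : Pint P (fun o => f (T o) ^+ 2).
  apply: (@Pint_le _ _ _ _ _ (fun o => Ce ^+ 4 * omega (T o) ^+ 2)).
  - by apply: measurable_funX; exact: measurableT_comp.
  - by move=> o; rewrite ger0_norm ?sqr_ge0.
  - exact: PintZ.
have [H1 H2] := iid_mean_sqr iid n0 mf If2; split => //.
apply: (le_trans H2); rewrite ler_wpM2l ?invr_ge0// -EEZ//.
by apply: EE_le => //; exact: PintZ.
Qed.

(** Markov's inequality for the Hilbert-Schmidt norm of the centered form; the
event does not depend on the truncation N. *)
Lemma bform_HS_event n (t : R) : (0 < n)%N -> 0 < t ->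
  exists A : set Om, [/\ measurable A,
    (P A <= (n%:R^-1 * (Ce ^+ 4 * EE P (fun o => omega (T o) ^+ 2)) * Sw ^+ 2 / t)%:E)%E &
    forall o, ~ A o -> forall N, HS n N o <= t].
Proof.
move=> n0 t0; set K := n%:R^-1 * _.
have K0 : 0 <= K.
  have [_] := bform_sqr_EE 0 0 n0; apply: le_trans.
  by apply: EE_ge0 => o; exact: sqr_ge0.
have Ib k l : Pint P (fun o => bform n (e k) (e l) o ^+ 2 / (w k * w l)).
  have [Ib _] := bform_sqr_EE k l n0.
  by under eq_fun do rewrite mulrC; exact: PintZ.
have Is N k : Pint P (fun o => \sum_(l < N) bform n (e k) (e l) o ^+ 2 / (w k * w l)).
  by apply: Pint_sum => l.
have IHS N : Pint P (HS n N) by apply: Pint_sum => k.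
have HS0 N o : 0 <= HS n N o.
  apply: sumr_ge0 => k _; apply: sumr_ge0 => l _.
  by rewrite divr_ge0 ?sqr_ge0// mulr_ge0// ltW.
have EHS N : EE P (HS n N) <= K * Sw ^+ 2.
  rewrite /HS EE_sum//.
  apply: (@le_trans _ _ (K * (\sum_(k < N) (w k)^-1) ^+ 2)); last first.
    rewrite ler_wpM2l// lerXn2r ?nnegrE//; last 1 first.
      by apply: le_trans (w_sum N); apply: sumr_ge0 => k _; rewrite invr_ge0 ltW.
    by apply: sumr_ge0 => k _; rewrite invr_ge0 ltW.
  rewrite expr2 mulr_suml mulr_sumr; apply: ler_sum => k _.
  rewrite EE_sum// mulr_sumr mulr_sumr; apply: ler_sum => l _.
  have [Ibb Ebb] := bform_sqr_EE k l n0.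
  under EE_ext do rewrite mulrC.
  rewrite EEZ// mulrC invfM ler_wpM2r//.
  by rewrite mulr_ge0// invr_ge0 ltW.
pose A N := [set o | t < HS n N o].
have mA N : measurable (A N).
  rewrite (_ : A N = HS n N @^-1` `]t, +oo[%classic).
    by rewrite -[_ @^-1` _]setTI; apply: (Pint_measurable (IHS N)) => //.
  by apply/seteqP; split => o; rewrite /A /= in_itv/= andbT.
have PA N : (P (A N) <= (K * Sw ^+ 2 / t)%:E)%E.
  have I1 : Pint P (\1_(A N) : Om -> R).
    apply: (@Pint_bounded _ _ _ _ _ 1); first exact: measurable_indic.
    by apply: aeW => o; rewrite indicE; case: (_ \in _); rewrite ?normr1 ?normr0.
  have : EE P (fun o => t * \1_(A N) o) <= EE P (HS n N).
    apply: EE_le => //; first exact: PintZ.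
    move=> o; rewrite indicE; have [|_] := boolP (o \in A N).
      by rewrite inE /A/= mulr1 => /ltW.
    by rewrite mulr0.
  rewrite EEZ// => H; have {}H := le_trans H (EHS N).
  rewrite -ler_pdivlMl// mulrC in H.
  apply: le_trans (_ : ((EE P (\1_(A N) : Om -> R))%:E <= _)%E); last by rewrite lee_fin.
  by rewrite Pint_fine// integral_indic// setIT.
have ndA : {homo A : x y / (x <= y)%N >-> (x <= y)%O}.
  apply: homo_leq => [X|Y X Z|N]; [exact: lexx|exact: le_trans|].
  apply/subsetPset => o; rewrite /A/= => /lt_le_trans; apply.
  rewrite /HS big_ord_recr/= -[leLHS]addr0; apply: lerD.
    apply: ler_sum => k _; rewrite big_ord_recr/= lerDl.
    by rewrite divr_ge0 ?sqr_ge0// mulr_ge0// ltW.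
  apply: sumr_ge0 => l _.
  by rewrite divr_ge0 ?sqr_ge0// mulr_ge0// ltW.
exists (\bigcup_N A N); split.
- exact: bigcupT_measurable.
- have H := nondecreasing_cvg_mu (mu := P) mA (bigcupT_measurable _ mA) ndA.
  rewrite -(cvg_lim _ H)//; apply: lime_le; first by apply/cvg_ex; eexists; exact: H.
  by near=> N; exact: PA.
- by move=> o nA N; rewrite leNgt; apply/negP => h; apply: nA; exists N.
Unshelve. all: by end_near. Qed.

(** Off the Hilbert-Schmidt event, a centered form is bounded on finite linear
combinations, by Cauchy-Schwarz on the double sum. *)
Lemma bform_comb_le n t o (a b : nat -> R) (Ka Kb : R) N M : 0 <= t -> 0 <= Ka -> 0 <= Kb ->
  (forall N, HS n N o <= t) ->
  (forall N, \sum_(k < N) a k ^+ 2 * w k <= Ka ^+ 2) ->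
  (forall N, \sum_(k < N) b k ^+ 2 * w k <= Kb ^+ 2) -> N = M ->
  `|bform n (fun s => \sum_(k < N) a k * e k s) (fun s => \sum_(k < M) b k * e k s) o|
    <= Num.sqrt t * Ka * Kb.
Proof.
move=> t0 Ka0 Kb0 HSt aK bK <- {M}.
rewrite bform_combl; last exact: bmeas_comb.
under eq_bigr => k _ do rewrite bform_sym bform_combl//.
have E : \sum_(k < N) a k * (\sum_(l < N) b l * bform n (e l) (e k) o) =
    \sum_(z : 'I_N * 'I_N) (a z.1 * Num.sqrt (w z.1) * (b z.2 * Num.sqrt (w z.2))) *
      (bform n (e z.1) (e z.2) o / (Num.sqrt (w z.1) * Num.sqrt (w z.2))).
  rewrite -(pair_bigA _ (fun k l : 'I_N => (a k * Num.sqrt (w k) * (b l * Num.sqrt (w l))) *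
      (bform n (e k) (e l) o / (Num.sqrt (w k) * Num.sqrt (w l)))))/=.
  apply: eq_bigr => k _; rewrite mulr_sumr; apply: eq_bigr => l _.
  rewrite (bform_sym _ (e l)).
  have wk : Num.sqrt (w k) != 0 by rewrite gt_eqF// sqrtr_gt0.
  have wl : Num.sqrt (w l) != 0 by rewrite gt_eqF// sqrtr_gt0.
  by field; rewrite wk wl.
rewrite {}E.
have R0 : 0 <= Num.sqrt t * Ka * Kb by rewrite !mulr_ge0// sqrtr_ge0.
rewrite -(ger0_norm R0) -!sqrtr_sqr ler_sqrt ?sqr_ge0//.
apply: (le_trans (sum_CS _ _)).
rewrite !exprMn sqr_sqrtr// -[t * _ * _]mulrA mulrC; apply: ler_pM.
- by apply: sumr_ge0 => z _; exact: sqr_ge0.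
- by apply: sumr_ge0 => z _; exact: sqr_ge0.
- apply: le_trans (HSt N); rewrite /HS pair_bigA/=.
  by apply: ler_sum => z _; rewrite exprMn exprVn exprMn !sqr_sqrtr// ltW.
- rewrite -(pair_bigA _ (fun k l : 'I_N => (a k * Num.sqrt (w k) * (b l * Num.sqrt (w l))) ^+ 2))/=.
  apply: (@le_trans _ _ ((\sum_(k < N) a k ^+ 2 * w k) * (\sum_(k < N) b k ^+ 2 * w k))).
    rewrite mulr_suml; apply: ler_sum => k _; rewrite mulr_sumr; apply: ler_sum => l _.
    by rewrite !exprMn !sqr_sqrtr// ltW.
  by apply: ler_pM => //; apply: sumr_ge0 => k _; rewrite mulr_ge0 ?sqr_ge0// ltW.
Qed.

(** The same bound for functions f and g that are uniform limits of linear
combinations of the e_k: f and g are then exchanged for partial sums at a cost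
that depends on the sample, but that tends to 0. *)
Lemma bform_le n t o (a b : nat -> R) (Ka Kb : R) f g : 0 <= t -> 0 <= Ka -> 0 <= Kb ->
  bmeas f -> bmeas g ->
  (forall N, HS n N o <= t) ->
  (forall N, \sum_(k < N) a k ^+ 2 * w k <= Ka ^+ 2) ->
  (forall N, \sum_(k < N) b k ^+ 2 * w k <= Kb ^+ 2) ->
  (forall ep : R, 0 < ep -> \forall N \near \oo, forall s,
     `|f s - \sum_(k < N) a k * e k s| <= ep) ->
  (forall ep : R, 0 < ep -> \forall N \near \oo, forall s,
     `|g s - \sum_(k < N) b k * e k s| <= ep) ->
  `|bform n f g o| <= Num.sqrt t * Ka * Kb.
Proof.
move=> t0 Ka0 Kb0 bf bg HSt aK bK fa gb.
have [mf [Kf fK]] := bf; have [mg [Kg gK]] := bg.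
have Kf0 : 0 <= Kf by exact: le_trans (fK (T point)).
have Kg0 : 0 <= Kg by exact: le_trans (gK (T point)).
pose C := (n%:R^-1 * \sum_(i < n) `|omega (Ts i o)| + EE P (fun o => `|omega (T o)|)) *
  (Kf + Kg + 1).
have W0 : 0 <= n%:R^-1 * \sum_(i < n) `|omega (Ts i o)| + EE P (fun o => `|omega (T o)|).
  rewrite addr_ge0 ?mulr_ge0 ?invr_ge0// ?EE_ge0//.
  by apply: sumr_ge0.
have C0 : 0 <= C by rewrite mulr_ge0// !addr_ge0.
apply/ler_addgt0Pr => e1 e10.
pose ep := Num.min 1 (e1 / (C + 1)).
have C1 : 0 < C + 1 by rewrite ltr_wpDl.
have ep0 : 0 < ep by rewrite lt_min ltr01 divr_gt0.
have ep1 : ep <= 1 by rewrite ge_min lexx.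
have epC : ep * C <= e1.
  apply: (@le_trans _ _ (e1 / (C + 1) * (C + 1))); last by rewrite divfK// gt_eqF.
  by apply: ler_pM => //; [exact: ltW|rewrite ge_min lexx orbT|rewrite lerDl].
have [N [faN gbN]] : exists N, (forall s, `|f s - \sum_(k < N) a k * e k s| <= ep) /\
    (forall s, `|g s - \sum_(k < N) b k * e k s| <= ep).
  have [N _ H] := filterI (fa _ ep0) (gb _ ep0).
  by exists N; exact: (H N (leqnn N)).
set fN := (fun s => \sum_(k < N) a k * e k s) in faN.
set gN := (fun s => \sum_(k < N) b k * e k s) in gbN.
have bfN : bmeas fN by exact: bmeas_comb.
have bgN : bmeas gN by exact: bmeas_comb.
have DK s : `|f s * g s - fN s * gN s| <= ep * (Kf + Kg + 1).
  rewrite (_ : _ - _ = f s * (g s - gN s) + (f s - fN s) * gN s); last by ring.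
  apply: (le_trans (ler_normD _ _)); rewrite !normrM.
  have gN1 : `|gN s| <= Kg + 1.
    rewrite -(subrK (g s) (gN s)) addrC (le_trans (ler_normD _ _))// lerD//.
    by rewrite distrC (le_trans (gbN s)).
  rewrite -addrA mulrDr [ep * Kf]mulrC; apply: lerD; apply: ler_pM => //.
have := bform_comb_le t0 Ka0 Kb0 HSt aK bK (erefl N) => H.
rewrite -(subrK (bform n fN gN o) (bform n f g o)) addrC.
apply: (le_trans (ler_normD _ _)); apply: lerD => //.
apply: le_trans epC.
pose D s := f s * g s - fN s * gN s.
have ID : Pint P (fun v => omega (T v) * D (T v)).
  rewrite (_ : (fun v => _) = (fun v => omega (T v) * f (T v) * g (T v) -
      omega (T v) * fN (T v) * gN (T v))).
    by apply: PintB; exact: Pint_omega_mul.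
  by apply/funext => v; rewrite /D; ring.
have -> : bform n f g o - bform n fN gN o =
    n%:R^-1 * (\sum_(i < n) omega (Ts i o) * D (Ts i o)) - EE P (fun v => omega (T v) * D (T v)).
  have -> : EE P (fun v => omega (T v) * D (T v)) =
      EE P (fun v => omega (T v) * f (T v) * g (T v)) -
      EE P (fun v => omega (T v) * fN (T v) * gN (T v)).
    rewrite -EEB; [by apply: EE_ext => v; rewrite /D; ring|exact: Pint_omega_mul..].
  have -> : \sum_(i < n) omega (Ts i o) * D (Ts i o) =
      \sum_(i < n) omega (Ts i o) * f (Ts i o) * g (Ts i o) -
      \sum_(i < n) omega (Ts i o) * fN (Ts i o) * gN (Ts i o).
    by rewrite -sumrB; apply: eq_bigr => i _; rewrite /D; ring.
  by rewrite /bform; ring.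
apply: (le_trans (ler_normB _ _)); rewrite /C mulrCA mulrDl; apply: lerD.
  rewrite normrM ger0_norm ?invr_ge0// -mulrA ler_wpM2l ?invr_ge0//.
  apply: (le_trans (ler_norm_sum _ _ _)); rewrite mulr_suml; apply: ler_sum => i _.
  by rewrite normrM ler_wpM2l//; exact: DK.
apply: (le_trans (le_normr_Rintegral _ ID)) => //.
have IW := Pint_norm Pint_omega.
rewrite mulrC -EEZ//; apply: EE_le; [exact: Pint_norm|exact: PintZ|move=> v].
by rewrite normrM mulrC ler_wpM2r//; exact: DK.
Qed.

End empirical_bilinear_form.

(** * The inner product of the parameter space *)

Section clamped_covariates.
Context {R : realType} {p : nat}.
Implicit Types (u : cov R p) (f : par R p) (g : R -> R).

(** The function g is continuous on [0,1]: its extension that is constant on both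
sides of [0,1] is continuous. *)
Definition contI g := continuous (g \o clamp01).

Lemma continuous_clamp01 : continuous (@clamp01 R).
Proof.
move=> x; apply/cvgrPdist_le => e e0; near=> y.
have xy : `|x - y| <= e by near: y; exact: cvgr_dist_le.
apply: le_trans xy; have [xy|/ltW yx] := leP x y.
  rewrite distrC [leRHS]distrC !ger0_norm ?subr_ge0//; first exact: clamp01_lip.
  exact: clamp01_homo.
rewrite !ger0_norm ?subr_ge0//; first exact: clamp01_lip.
exact: clamp01_homo.
Unshelve. all: by end_near. Qed.

Lemma contI_bounded g : contI g -> exists K, forall z, 0 <= z <= 1 -> `|g z| <= K.
Proof.
move=> cg; have cgw : {within `[0, 1], continuous (g \o clamp01)}.
  exact: continuous_subspaceT.
have [a _ ga] := EVT_max ler01 cgw; have [b _ gb] := EVT_min ler01 cgw.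
exists (`|g (clamp01 a)| + `|g (clamp01 b)|) => z z01.
have zI : z \in `[0, 1] by rewrite in_itv.
have := ga z zI; have := gb z zI; rewrite /= (clamp01_id z01) => h1 h2.
have := ler_norm (g (clamp01 a)); have := ler_norm (- g (clamp01 b)); rewrite normrN.
have := normr_ge0 (g (clamp01 a)); have := normr_ge0 (g (clamp01 b)).
by rewrite ler_norml => ? ? ? ?; apply/andP; split; lra.
Qed.

Lemma contI_lin a g1 g2 : contI g1 -> contI g2 -> contI (fun z => a * g1 z + g2 z).
Proof.
move=> c1 c2 x; apply: cvgD; last exact: c2.
by apply: cvgMl_tmp; exact: c1.
Qed.

Lemma contI0 : contI (fun=> 0).
Proof. by move=> x; exact: cvg_cst. Qed.

(** The projection of the covariates onto the unit cube.  Composing with it makes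
[ev f] measurable and bounded everywhere when g is continuous on [0,1], without
changing it on the observations. *)
Definition clampU u : cov R p := (map_tuple clamp01 u.1, clamp01 u.2).

Lemma clampU_in u : Ucal (clampU u).
Proof. by split => [k|]; rewrite ?tnth_map; exact: clamp01_in. Qed.

Lemma clampU_id u : Ucal u -> clampU u = u.
Proof.
case: u => x z [/= x01 z01]; rewrite /clampU /= clamp01_id//; congr (_, _).
by apply: eq_from_tnth => k; rewrite tnth_map clamp01_id.
Qed.

Lemma evE_lin a f1 f2 u : ev (a *: f1 + f2) u = a * ev f1 u + ev f2 u.
Proof.
rewrite /ev mulrDr mulr_sumr addrACA -big_split/=; congr (_ + _).
by apply: eq_bigr => k _; rewrite !mxE; ring.
Qed.

Lemma measurable_ev_clampU f : contI f.2 ->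
  measurable_fun setT (fun u => ev f (clampU u)).
Proof.
move=> cf; apply: measurable_funD.
  apply: measurable_sum => k; apply: measurable_funM; last exact: measurable_cst.
  under eq_fun do rewrite tnth_map.
  apply: (measurableT_comp (continuous_measurable_fun continuous_clamp01)).
  by apply: (measurableT_comp (measurable_tnth k)); exact: measurable_fst.
apply: (measurableT_comp (continuous_measurable_fun cf)); exact: measurable_snd.
Qed.

Lemma ev_bounded f : contI f.2 -> exists K, forall u, Ucal u -> `|ev f u| <= K.
Proof.
move=> /contI_bounded[K gK]; exists (\sum_k `|f.1 0 k| + K) => u [u1 u2].
rewrite /ev (le_trans (ler_normD _ _))// lerD//; last exact: gK.
apply: (le_trans (ler_norm_sum _ _ _)); apply: ler_sum => k _.
by rewrite normrM ler_piMl// ger0_norm; have /andP[] := u1 k.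
Qed.

End clamped_covariates.

Section inner_product.
Context d {Om : measurableType d} {R : realType} (P : probability Om R).
Context {p : nat} (T : {RV P >-> obs R p}) (I : cov R p -> R).
Context (per : bool) (m : nat) (lam : R).
Hypothesis m_gt0 : (0 < m)%N.
Hypothesis TU : forall o, Ucal (T o).2.
Hypothesis mI : measurable_fun setT I.
Context (C2 : R).
Hypothesis C2_gt0 : 0 < C2.
Hypothesis IC2 : {ae P, forall o, C2^-1 <= I (T o).2 <= C2}.
Implicit Types (f : par R p) (g : R -> R).

Let U o : cov R p := (T o).2.
Let Z o : R := (T o).2.2.

Lemma measurable_U : measurable_fun setT U.
Proof. by apply: (measurableT_comp measurable_snd). Qed.

Lemma measurable_Z : measurable_fun setT Z.
Proof. by apply: (measurableT_comp measurable_snd measurable_U). Qed.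

Lemma measurable_evU f : contI f.2 -> measurable_fun setT (fun o => ev f (U o)).
Proof.
move=> cf; rewrite (_ : (fun o => _) = (fun u => ev f (clampU u)) \o U).
  by apply: measurableT_comp => //; [exact: measurable_ev_clampU|exact: measurable_U].
by apply/funext => o /=; rewrite clampU_id//; exact: TU.
Qed.

Lemma evU_bounded f : contI f.2 -> exists K, forall o, `|ev f (U o)| <= K.
Proof. by move=> /ev_bounded[K fK]; exists K => o; exact/fK/TU. Qed.

Lemma Pint_IU : Pint P (fun o => I (U o)).
Proof.
apply: (@Pint_bounded _ _ _ _ _ C2); first exact: (measurableT_comp mI measurable_U).
have FP := ae_filter_ringOfSetsType P; move: IC2; apply: filterS => o /andP[h1 h2].
by rewrite ger0_norm// (le_trans _ h1)// invr_ge0 ltW.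
Qed.

Lemma Pint_ev2 f1 f2 : contI f1.2 -> contI f2.2 ->
  Pint P (fun o => I (U o) * ev f1 (U o) * ev f2 (U o)).
Proof.
move=> c1 c2; have [K1 h1] := evU_bounded c1; have [K2 h2] := evU_bounded c2.
rewrite (_ : (fun o => _) = fun o => (ev f1 (U o) * ev f2 (U o)) * I (U o)).
  apply: (@Pint_mulb _ _ _ _ _ _ (K1 * K2)); first exact: Pint_IU.
    by apply: measurable_funM; exact: measurable_evU.
  by apply: aeW => o; rewrite normrM ler_pM.
by apply/funext => o; ring.
Qed.

(** The bilinear form E(I(U) f1(U) f2(U)). *)
Definition EI f1 f2 := EE P (fun o => I (U o) * ev f1 (U o) * ev f2 (U o)).

Lemma innerE f1 f2 : inner P T I lam m f1 f2 = EI f1 f2 + lam * J m f1.2 f2.2.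
Proof. by rewrite /inner /EI EEE. Qed.

Lemma EI_sym f1 f2 : EI f1 f2 = EI f2 f1.
Proof. by apply: EE_ext => o; rewrite mulrAC. Qed.

Lemma EI_lin a f1 f2 f3 : contI f1.2 -> contI f2.2 -> contI f3.2 ->
  EI (a *: f1 + f2) f3 = a * EI f1 f3 + EI f2 f3.
Proof.
move=> c1 c2 c3; rewrite /EI -EEZ; last exact: Pint_ev2.
rewrite -EED; [|by apply: PintZ; exact: Pint_ev2|exact: Pint_ev2].
by apply: EE_ext => o; rewrite evE_lin; ring.
Qed.

Lemma EI_ge0 f : contI f.2 -> 0 <= EI f f.
Proof.
move=> cf; apply: EE_ae_ge0; first exact: Pint_ev2.
have FP := ae_filter_ringOfSetsType P; move: IC2; apply: filterS => o /andP[h1 h2].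
by rewrite -mulrA -expr2 mulr_ge0 ?sqr_ge0// (le_trans _ h1)// invr_ge0 ltW.
Qed.

Lemma Hpar_lin a f1 f2 : Hpar per m f1 -> Hpar per m f2 -> Hpar per m (a *: f1 + f2).
Proof. by move=> H1 H2; have := Hm_lin m_gt0 a H1 H2. Qed.

Lemma Hm_contI g : Hm per m g -> contI g.
Proof. by move=> /Hm_sobolev; exact: sobolev_continuous. Qed.

Lemma Hpar_contI f : Hpar per m f -> contI f.2.
Proof. exact: Hm_contI. Qed.

Lemma inner_sym f1 f2 : inner P T I lam m f1 f2 = inner P T I lam m f2 f1.
Proof. by rewrite !innerE EI_sym J_sym. Qed.

Lemma inner_lin a f1 f2 f3 : Hpar per m f1 -> Hpar per m f2 -> Hpar per m f3 ->
  inner P T I lam m (a *: f1 + f2) f3 =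
  a * inner P T I lam m f1 f3 + inner P T I lam m f2 f3.
Proof.
move=> H1 H2 H3; rewrite !innerE EI_lin; [|exact: Hpar_contI..].
have := J_lin m_gt0 a (Hm_sobolev H1) (Hm_sobolev H2) (Hm_sobolev H3).
by rewrite -[J m (a *: f1 + f2).2 _]/(J m (fun z => a * f1.2 z + f2.2 z) f3.2) => ->; ring.
Qed.

Hypothesis lam_ge0 : 0 <= lam.

Lemma EI_le_inner f : EI f f <= inner P T I lam m f f.
Proof. by rewrite innerE lerDl mulr_ge0// J_ge0. Qed.

Lemma inner_ge0 f : Hpar per m f -> 0 <= inner P T I lam m f f.
Proof. by move=> Hf; apply: le_trans (EI_le_inner f); apply: EI_ge0; exact: Hpar_contI. Qed.

Lemma Hnorm_sqr f : Hpar per m f -> Hnorm P T I lam m f ^+ 2 = inner P T I lam m f f.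
Proof. by move=> Hf; rewrite sqr_sqrtr// inner_ge0. Qed.

Lemma inner_expand t f1 f2 : Hpar per m f1 -> Hpar per m f2 ->
  inner P T I lam m (t *: f2 + f1) (t *: f2 + f1) =
  inner P T I lam m f1 f1 + 2 * t * inner P T I lam m f1 f2
    + t ^+ 2 * inner P T I lam m f2 f2.
Proof.
move=> H1 H2; have H3 := Hpar_lin t H2 H1.
rewrite inner_lin// ![inner _ _ _ _ _ _ (t *: f2 + f1)]inner_sym !inner_lin//.
by rewrite (inner_sym f2 f1); ring.
Qed.

Lemma Hnorm_triangle f1 f2 : Hpar per m f1 -> Hpar per m f2 ->
  Hnorm P T I lam m (f1 + f2) <= Hnorm P T I lam m f1 + Hnorm P T I lam m f2.
Proof.
move=> H1 H2; have E := inner_expand 1 H1 H2.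
rewrite scale1r mulr1 expr1n mul1r addrC in E.
rewrite /Hnorm E; apply: sqrt_triangle; [exact: inner_ge0..|move=> t].
by rewrite -inner_expand// inner_ge0//; exact: Hpar_lin.
Qed.

Lemma HnormN f : Hpar per m f -> Hnorm P T I lam m (- f) = Hnorm P T I lam m f.
Proof.
move=> Hf; rewrite /Hnorm; congr Num.sqrt.
have Hf0 : Hpar per m (0 : par R p).
  by have := Hpar_lin (-1) Hf Hf; rewrite scaleN1r addNr.
have := inner_expand (-1) Hf0 Hf; rewrite scaleN1r addr0 sqrrN expr1n mul1r.
have E0 : inner P T I lam m 0 f = 0 /\ inner P T I lam m 0 0 = 0.
  have := inner_lin (-1) Hf Hf Hf; have := inner_lin (-1) Hf Hf Hf0.
  by rewrite !scaleN1r !addNr !mulN1r !addNr => -> ->.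
by case: E0 => -> ->; rewrite mulr0 !add0r.
Qed.

(** The function g, seen as the parameter (0, g). *)
Definition par0 g : par R p := (0, g).

Lemma ev_par0 g u : ev (par0 g) u = g u.2.
Proof. by rewrite /ev big1 ?add0r// => k _; rewrite mxE mulr0. Qed.

Context (B : R -> R).
Hypothesis cB : cexpR P Z (fun o => I (U o)) B.

Lemma VformE g1 g2 : contI g1 -> contI g2 ->
  Vform P T B g1 g2 = EI (par0 g1) (par0 g2).
Proof.
move=> c1 c2; have [K1 h1] := contI_bounded c1; have [K2 h2] := contI_bounded c2.
have [_ _ _ H] := cB.
pose phi z := g1 (clamp01 z) * g2 (clamp01 z).
have mphi : measurable_fun setT phi.
  by apply: measurable_funM; exact: continuous_measurable_fun.
have phiK z : `|phi z| <= K1 * K2.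
  by have z01 := clamp01_in z; rewrite normrM ler_pM// ?h1// h2.
have Zc o : clamp01 (Z o) = Z o by have [_ z01] := TU o; exact: clamp01_id.
rewrite /Vform -EEE /EI.
transitivity (EE P (fun o => phi (Z o) * B (Z o))).
  by apply: EE_ext => o; rewrite /phi Zc /Z; ring.
rewrite (H _ _ mphi phiK); apply: EE_ext => o.
by rewrite !ev_par0 /phi Zc /Z/U; ring.
Qed.

Lemma norm1E g : contI g -> norm1 P T B lam m g = Hnorm P T I lam m (par0 g).
Proof. by move=> cg; rewrite /norm1 /Hnorm innerE VformE. Qed.

Local Notation ip := (inner P T I lam m).
Local Notation hn := (Hnorm P T I lam m).

Lemma inner0l f : Hpar per m f -> ip 0 f = 0.
Proof.
move=> Hf; have := inner_lin (-1) Hf Hf Hf.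
by rewrite scaleN1r addNr mulN1r addNr.
Qed.

Lemma par0_lin a g1 g2 : par0 (fun z => a * g1 z + g2 z) = a *: par0 g1 + par0 g2.
Proof.
transitivity ((a *: 0 + 0, fun z => a * g1 z + g2 z) : par R p); last by [].
by rewrite scaler0 addr0.
Qed.

Lemma Hm0 g : Hm per m g -> Hm per m (fun _ : R => 0 : R).
Proof.
move=> Hg; have := Hm_lin m_gt0 (-1) Hg Hg.
by rewrite (_ : (fun z => _) = fun=> 0)//; apply/funext => z; rewrite mulN1r addNr.
Qed.

Lemma Hm_sub g1 g2 : Hm per m g1 -> Hm per m g2 -> Hm per m (fun z => g1 z - g2 z).
Proof.
move=> H1 H2; have := Hm_lin m_gt0 (-1) H2 H1.
by rewrite (_ : (fun z => _) = fun z => g1 z - g2 z)//; apply/funext => z; rewrite mulN1r addrC.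
Qed.

(** * Fourier expansion and sup norm of the nonparametric component *)

(* a lower bound cz for the density of Z *)
Context (cz : R).
Hypothesis cz_gt0 : 0 < cz.
Hypothesis Z_lower : forall a b : R, 0 <= a -> a < b -> b <= 1 ->
  ((cz * (b - a))%:E <= P (Z @^-1` `[a, b]%classic))%E.

(** A bound on [0,1] is stable under limits in mean square. *)
Lemma mean_square_limit_bounded g (gn : nat -> R -> R) (M : R) : contI g ->
  (forall n, contI (gn n)) -> (forall n z, 0 <= z <= 1 -> `|gn n z| <= M) ->
  (forall e, 0 < e -> exists n,
     EI (par0 (fun z => g z - gn n z)) (par0 (fun z => g z - gn n z)) <= e) ->
  forall z, 0 <= z <= 1 -> `|g z| <= M.
Proof.
move=> cg cgn gnM gnl z0 z01; rewrite leNgt; apply/negP => Mg.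
(* otherwise |g| exceeds M + eta on an interval [a, b] around z0, and the distance
   to gn is bounded from below there *)
pose eta := (`|g z0| - M) / 2.
have eta0 : 0 < eta by rewrite divr_gt0// subr_gt0.
have /cvgrPdist_lt/(_ _ eta0)[r /= r0 gr] := cg z0.
pose t := Num.min (r / 2) (1 / 2).
have [t0 tr t12] : [/\ 0 < t, t < r & t <= 1 / 2].
  split; rewrite /t; first by rewrite lt_min !divr_gt0.
    by rewrite gt_min; apply/orP; left; lra.
  by rewrite ge_min lexx orbT.
have [a [b [a0 ab b1 abr]]] : exists a b, [/\ 0 <= a, a < b, b <= 1 &
    forall z, a <= z <= b -> `|z0 - z| < r].
  have /andP[z00 z10] := z01.
  have [zh|zh] := leP z0 (1 / 2).
    exists z0, (z0 + t); split; [by []|by lra|by lra|move=> z /andP[h1 h2]].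
    by rewrite distrC ger0_norm; lra.
  exists (z0 - t), z0; split; [by lra|by lra|by []|move=> z /andP[h1 h2]].
  by rewrite ger0_norm; lra.
have mA : measurable (Z @^-1` `[a, b]%classic).
  by rewrite -[_ @^-1` _]setTI; apply: measurable_Z => //; exact: measurable_itv.
pose kap := C2^-1 * eta ^+ 2.
have kap0 : 0 < kap by rewrite mulr_gt0 ?invr_gt0// exprn_gt0.
have [|n En] := gnl (kap * (cz * (b - a)) / 2).
  by rewrite divr_gt0// mulr_gt0// mulr_gt0// subr_gt0.
suff H : kap * (cz * (b - a)) <= EI (par0 (fun z => g z - gn n z)) (par0 (fun z => g z - gn n z)).
  have q0 : 0 < kap * (cz * (b - a)) by rewrite mulr_gt0// mulr_gt0// subr_gt0.
  by move: H En q0; set q := kap * _; lra.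
have IA : Pint P (\1_(Z @^-1` `[a, b]%classic) : Om -> R).
  apply: (@Pint_bounded _ _ _ _ _ 1); first exact: measurable_indic.
  by apply: aeW => o; rewrite indicE; case: (_ \in _); rewrite ?normr1 ?normr0.
apply: (@le_trans _ _ (EE P (fun o => kap * \1_(Z @^-1` `[a, b]%classic) o))).
  rewrite EEZ// ler_wpM2l ?(ltW kap0)// -lee_fin Pint_fine//.
  by rewrite integral_indic// setIT; exact: Z_lower.
have cd : contI (fun z => g z - gn n z).
  have := @contI_lin _ (-1) _ _ (cgn n) cg.
  by rewrite (_ : (fun z => _) = fun z => g z - gn n z)//; apply/funext => z; rewrite mulN1r addrC.
apply: EE_ae_le; [exact: PintZ|exact: Pint_ev2|].
have FP := ae_filter_ringOfSetsType P; move: IC2; apply: filterS => o /andP[h1 h2].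
have C20 : 0 < C2^-1 by rewrite invr_gt0.
rewrite -mulrA -expr2 !ev_par0 -/(Z o) indicE.
have [|_] := boolP (o \in _); last first.
  by rewrite mulr0 mulr_ge0 ?sqr_ge0// (le_trans (ltW C20)).
rewrite inE /= in_itv/= => zab; rewrite mulr1 /kap.
apply: ler_pM => //; [exact: ltW|exact: sqr_ge0|].
have zo01 : 0 <= Z o <= 1 by have [] := TU o.
rewrite -[leRHS]real_normK ?num_real// lerXn2r ?nnegrE//; first exact: ltW.
have := gr _ (abr _ zab); rewrite /= !clamp01_id// => g1.
have := gnM n _ zo01 => g2.
have h3 : `|g z0| <= `|g z0 - g (Z o)| + `|g (Z o)|.
  by rewrite -{1}(subrK (g (Z o)) (g z0)) ler_normD.
have h4 : `|g (Z o)| <= `|g (Z o) - gn n (Z o)| + `|gn n (Z o)|.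
  by rewrite -{1}(subrK (gn n (Z o)) (g (Z o))) ler_normD.
by move: g1 g2 h3 h4; rewrite /eta; lra.
Qed.

Context (hb : nat -> R -> R) (gam : nat -> R) (Ch Sw : R).
Hypothesis hbH : forall nu, Hm per m (hb nu).
Hypothesis hb_le : forall nu z, 0 <= z <= 1 -> `|hb nu z| <= Ch.
Hypothesis hbV : forall mu nu, Vform P T B (hb mu) (hb nu) = (mu == nu)%:R.
Hypothesis hbJ : forall mu nu, J m (hb mu) (hb nu) = gam mu * (mu == nu)%:R.
Hypothesis hb_cvg : forall g, Hm per m g ->
  norm1 P T B lam m (fun z => g z - \sum_(nu < N) Vform P T B g (hb nu) * hb nu z)
    @[N --> \oo] --> (0 : R).

(** The linear combination of the first N functions h_nu with coefficients a. *)
Definition comb (a : nat -> R) N z := \sum_(nu < N) a nu * hb nu z.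
(** The squared norm of (0, h_nu) for the inner product of H. *)
Definition wt nu := 1 + lam * gam nu.
Hypothesis wt_sum : forall N, \sum_(nu < N) (wt nu)^-1 <= Sw.

Lemma wt_ge1 nu : 1 <= wt nu.
Proof.
rewrite /wt lerDl mulr_ge0//; have := J_ge0 m (hb nu).
by rewrite hbJ eqxx mulr1.
Qed.

Lemma combS a N : comb a N.+1 = (fun z => a N * hb N z + comb a N z).
Proof. by apply/funext => z; rewrite /comb big_ord_recr addrC. Qed.

Lemma Hm_comb a N : Hm per m (comb a N).
Proof.
elim: N => [|N ih]; last by rewrite combS; exact: Hm_lin.
rewrite (_ : comb a 0 = fun=> 0); first exact: Hm0 (hbH 0).
by apply/funext => z; rewrite /comb big_ord0.
Qed.

Lemma inner_hb k l : ip (par0 (hb k)) (par0 (hb l)) = (k == l)%:R * wt k.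
Proof.
rewrite innerE -VformE ?hbV ?hbJ; [by rewrite /wt; ring|exact: Hm_contI..].
Qed.

Lemma inner_comb a N f : Hpar per m f ->
  ip (par0 (comb a N)) f = \sum_(k < N) a k * ip (par0 (hb k)) f.
Proof.
move=> Hf; elim: N => [|N ih].
  rewrite big_ord0 -(inner0l Hf); congr (inner _ _ _ _ _ _ _).
  by rewrite /par0; congr (_, _); apply/funext => z; rewrite /comb big_ord0.
rewrite combS par0_lin inner_lin//; [|exact: hbH|exact: Hm_comb].
by rewrite ih big_ord_recr addrC.
Qed.

Lemma inner_comb_comb a N :
  ip (par0 (comb a N)) (par0 (comb a N)) = \sum_(k < N) a k ^+ 2 * wt k.
Proof.
rewrite inner_comb; last exact: Hm_comb.
apply: eq_bigr => k _; rewrite inner_sym inner_comb; last exact: hbH.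
rewrite (bigD1 k)//= inner_hb eqxx big1; first by rewrite mul1r addr0; ring.
by move=> l lk; rewrite inner_hb (_ : ((l : nat) == k) = false) ?mul0r ?mulr0//; exact/negbTE.
Qed.

Let coef g nu := Vform P T B g (hb nu).

Lemma comb_cvg g : Hm per m g -> forall e, 0 < e -> \forall N \near \oo,
  hn (par0 (fun z => g z - comb (coef g) N z)) <= e.
Proof.
move=> Hg e e0; have /cvgrPdist_le/(_ _ e0) := hb_cvg Hg.
apply: filterS => N; rewrite sub0r normrN ger0_norm ?sqrtr_ge0// norm1E//.
have Hd : Hm per m (fun z => g z - comb (coef g) N z).
  by apply: Hm_sub => //; exact: Hm_comb.
exact: Hm_contI Hd.
Qed.

(** Bessel's inequality, in the norm of H. *)
Lemma bessel g N : Hm per m g ->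
  \sum_(k < N) coef g k ^+ 2 * wt k <= ip (par0 g) (par0 g).
Proof.
move=> Hg; have Hg' : Hpar per m (par0 g) by [].
have s0 M : 0 <= \sum_(k < M) coef g k ^+ 2 * wt k.
  by apply: sumr_ge0 => k _; rewrite mulr_ge0 ?sqr_ge0// (le_trans _ (wt_ge1 k)).
suff : Num.sqrt (\sum_(k < N) coef g k ^+ 2 * wt k) <= hn (par0 g).
  by rewrite ler_sqrt// inner_ge0.
apply/ler_addgt0Pr => e e0; have [M0 _ HM] := comb_cvg Hg e0.
pose M := maxn N M0; have {HM}HM := HM M (leq_maxr _ _).
have NM : (N <= M)%N by exact: leq_maxl.
apply: (@le_trans _ _ (Num.sqrt (\sum_(k < M) coef g k ^+ 2 * wt k))).
  rewrite ler_sqrt// -!(big_mkord xpredT (fun k => coef g k ^+ 2 * wt k)).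
  rewrite [leRHS](@big_cat_nat _ _ _ N 0 M)//= lerDl big_nat.
  by apply: sumr_ge0 => k _; rewrite mulr_ge0 ?sqr_ge0// (le_trans _ (wt_ge1 k)).
rewrite -inner_comb_comb.
have Hd : Hpar per m (par0 (fun z => g z - comb (coef g) M z)).
  by apply: Hm_sub => //; exact: Hm_comb.
have E : par0 (comb (coef g) M) = par0 g + (- par0 (fun z => g z - comb (coef g) M z)).
  rewrite /par0; congr (_, _); first by rewrite /= subr0.
  by apply/funext => z /=; rewrite !fctE opprB addrC subrK.
rewrite -[leLHS]/(hn (par0 (comb (coef g) M))) E.
have HNd : Hpar per m (- par0 (fun z => g z - comb (coef g) M z)).
  have := Hpar_lin (-2) Hd Hd; rewrite scaleNr scaler_nat mulr2n opprD -addrA addNr addr0.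
  exact.
by apply: (le_trans (Hnorm_triangle Hg' HNd)); rewrite HnormN// lerD2l.
Qed.

(** A Sobolev type inequality for finite combinations, by Cauchy-Schwarz with the
weights [wt]. *)
Lemma comb_le (a : nat -> R) N (z K : R) : 0 <= K -> \sum_(k < N) a k ^+ 2 * wt k <= K ^+ 2 ->
  0 <= z <= 1 -> `|comb a N z| <= Ch * Num.sqrt Sw * K.
Proof.
move=> K0 aK z01; have Ch0 : 0 <= Ch by exact: le_trans (hb_le 0 z01).
have w0 k : 0 < wt k by exact: lt_le_trans (wt_ge1 k).
have Sw0 : 0 <= Sw.
  by apply: le_trans (wt_sum 0); rewrite big_ord0.
apply: (@le_trans _ _ (Ch * \sum_(k < N) `|a k|)).
  apply: (le_trans (ler_norm_sum _ _ _)); rewrite mulr_sumr; apply: ler_sum => k _.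
  by rewrite normrM mulrC ler_wpM2r// hb_le.
rewrite -mulrA ler_wpM2l//.
have -> : \sum_(k < N) `|a k| =
    \sum_(k < N) (`|a k| * Num.sqrt (wt k)) * (Num.sqrt (wt k))^-1.
  by apply: eq_bigr => k _; rewrite mulfK// gt_eqF// sqrtr_gt0.
have R0 : 0 <= Num.sqrt Sw * K by rewrite mulr_ge0// sqrtr_ge0.
apply: (le_trans (ler_norm _)); rewrite -(ger0_norm R0) -!sqrtr_sqr ler_sqrt ?sqr_ge0//.
apply: (le_trans (sum_CS _ _)); rewrite exprMn sqr_sqrtr// mulrC.
apply: ler_pM; [by apply: sumr_ge0 => k _; exact: sqr_ge0..| |].
  apply: le_trans (wt_sum N); apply: ler_sum => k _.
  by rewrite exprVn sqr_sqrtr// ltW.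
apply: le_trans aK; apply: ler_sum => k _.
by rewrite exprMn sqr_sqrtr ?(ltW (w0 k))// real_normK// num_real.
Qed.

(** The partial sums of g are uniformly bounded by [bessel] and [comb_le], and
converge to g in mean square, so that the bound passes to g. *)
Lemma sup_par0_le g z : Hm per m g -> 0 <= z <= 1 ->
  `|g z| <= Ch * Num.sqrt Sw * hn (par0 g).
Proof.
move=> Hg; have Hg' : Hpar per m (par0 g) by [].
apply: (@mean_square_limit_bounded g (comb (coef g)) _ (Hm_contI Hg)).
- by move=> n; exact/Hm_contI/Hm_comb.
- move=> n z'; apply: comb_le; first exact: sqrtr_ge0.
  by rewrite Hnorm_sqr//; exact: bessel.
- move=> e e0; have se0 : 0 < Num.sqrt e by rewrite sqrtr_gt0.
  have [N _ HN] := comb_cvg Hg se0; exists N.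
  have {HN}HN := HN N (leqnn N).
  apply: (le_trans (EI_le_inner _)).
  have Hd : Hpar per m (par0 (fun z => g z - comb (coef g) N z)).
    by apply: Hm_sub => //; exact: Hm_comb.
  rewrite -Hnorm_sqr// -(sqr_sqrtr (ltW e0)) lerXn2r ?nnegrE ?sqrtr_ge0//.
Qed.

(** * The parametric component *)

Section theta_bound.
Context (IX G : 'I_p -> R -> R).
Hypothesis cIX : forall k, cexpR P Z (fun o => I (U o) * tnth (U o).1 k) (IX k).
Hypothesis GE : forall k z, G k z = IX k z / B z.
Hypothesis Omega_pos : forall v : 'rV[R]_p, v != 0 ->
  0 < (v *m Omega P T I G *m v^T) 0 0.

Lemma measurable_inv : measurable_fun setT (@GRing.inv R).
Proof.
rewrite -(setvU [set 0 : R]); apply/measurable_funU.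
- by apply: measurableC; exact: measurable_set1.
- exact: measurable_set1.
split; last exact: measurable_fun_set1.
apply: open_continuous_measurable_fun.
  by apply: closed_openC; exact: closed_eq.
by move=> x; rewrite inE /= => /eqP x0; exact: inv_continuous.
Qed.

Let mG k : measurable_fun setT (G k).
Proof.
rewrite (_ : G k = fun z => IX k z * (B z)^-1); last exact/funext.
apply: measurable_funM; first by have [] := cIX k.
by apply: (measurableT_comp measurable_inv); have [] := cB.
Qed.

(** G, replaced by 0 where it exceeds its almost sure bound. *)
Let Gt k z : R := G k z * \1_[set z | `|G k z| <= C2 ^+ 2] z.

Let Gt_le k z : `|Gt k z| <= C2 ^+ 2.
Proof.
rewrite /Gt indicE; have [|_] := boolP (_ \in _); first by rewrite inE /= mulr1.
by rewrite mulr0 normr0 sqr_ge0.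
Qed.

Let mGt k : measurable_fun setT (Gt k).
Proof.
apply: measurable_funM => //; apply: measurable_indic.
rewrite -[X in measurable X]setTI; apply: measurable_fun_le => //.
by apply: measurableT_comp => //; exact: mG.
Qed.

Let X_in k o : 0 <= tnth (U o).1 k <= 1.
Proof. by have [] := TU o. Qed.

Let B_ge : {ae P, forall o, C2^-1 <= B (Z o)}.
Proof.
have FP := ae_filter_ringOfSetsType P; apply: (cexpR_ge measurable_Z cB).
by move: IC2; apply: filterS => o /andP[].
Qed.

Let G_Gt k : {ae P, forall o, G k (Z o) = Gt k (Z o) /\ Gt k (Z o) * B (Z o) = IX k (Z o)}.
Proof.
have FP := ae_filter_ringOfSetsType P.
have h1 : {ae P, forall o, - C2 <= IX k (Z o)}.
  apply: (cexpR_ge measurable_Z (cIX k)).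
  move: IC2; apply: filterS => o /andP[l _]; have /andP[x0 _] := X_in k o.
  apply: (@le_trans _ _ 0); first by rewrite oppr_le0 ltW.
  by rewrite mulr_ge0// (le_trans _ l)// invr_ge0 ltW.
have h2 : {ae P, forall o, IX k (Z o) <= C2}.
  apply: (cexpR_le measurable_Z (cIX k)).
  move: IC2; apply: filterS => o /andP[l u]; have /andP[_ x1] := X_in k o.
  by rewrite (le_trans _ u)// ler_piMr// (le_trans _ l)// invr_ge0 ltW.
move: h1 h2 B_ge; apply: filterS3 => o h1 h2 h3.
have C20 : 0 < C2^-1 by rewrite invr_gt0.
have B0 : 0 < B (Z o) by exact: lt_le_trans h3.
have Gle : `|G k (Z o)| <= C2 ^+ 2.
  rewrite GE normrM expr2; apply: ler_pM => //; first by rewrite ler_norml h1.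
  rewrite ger0_norm; last by rewrite invr_ge0 ltW.
  by rewrite -[leRHS]invrK lef_pV2 ?posrE.
have E : Gt k (Z o) = G k (Z o) by rewrite /Gt indicE mem_set// mulr1.
by rewrite E; split => //; rewrite GE divfK// gt_eqF.
Qed.

(** X - G(Z), with the truncated G. *)
Let Xc k o := tnth (U o).1 k - Gt k (Z o).

Let mXc k : measurable_fun setT (Xc k).
Proof.
apply: measurable_funB; last exact: (measurableT_comp (mGt k) measurable_Z).
apply: (measurableT_comp (measurable_tnth k)).
exact: (measurableT_comp measurable_fst measurable_U).
Qed.

Let Xc_le k o : `|Xc k o| <= 1 + C2 ^+ 2.
Proof.
rewrite (le_trans (ler_normB _ _))// lerD//.
by have /andP[x0 x1] := X_in k o; rewrite ger0_norm.
Qed.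

(** Bounded measurable random variables. *)
Let bm (f : Om -> R) := measurable_fun setT f /\ exists K : R, forall o, `|f o| <= K.

Let bmM (f1 f2 : Om -> R) : bm f1 -> bm f2 -> bm (fun o => f1 o * f2 o).
Proof.
move=> [m1 [K1 k1]] [m2 [K2 k2]]; split; first exact: measurable_funM.
by exists (K1 * K2) => o; rewrite normrM ler_pM.
Qed.

Let Pint_bm (f : Om -> R) : bm f -> Pint P (fun o => I (U o) * f o).
Proof.
move=> [mf [K fK]].
rewrite (_ : (fun o => _) = fun o => f o * I (U o)); last by apply/funext => o; rewrite mulrC.
by apply: (@Pint_mulb _ _ _ _ _ _ K) => //; [exact: Pint_IU|exact: aeW].
Qed.

Let bmXc k : bm (Xc k).
Proof. by split => //; exists (1 + C2 ^+ 2) => o. Qed.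

(** The random variable v (X - G(Z)). *)
Let D (v : 'rV[R]_p) o := \sum_k v 0 k * Xc k o.

Let bmD v : bm (D v).
Proof.
split.
  by apply: measurable_sum => k; apply: measurable_funM => //; exact: measurable_cst.
exists (\sum_k `|v 0 k| * (1 + C2 ^+ 2)) => o.
apply: (le_trans (ler_norm_sum _ _ _)); apply: ler_sum => k _.
by rewrite normrM ler_wpM2l.
Qed.

Let OmegaE j k : Omega P T I G j k = EE P (fun o => I (U o) * (Xc j o * Xc k o)).
Proof.
rewrite /Omega mxE -EEE.
have Iq : Pint P (fun o => I (U o) * (Xc j o * Xc k o)) by exact/Pint_bm/bmM.
have FP := ae_filter_ringOfSetsType P.
have mX i : measurable_fun setT (fun o => tnth (T o).2.1 i).
  apply: (measurableT_comp (measurable_tnth i)).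
  exact: (measurableT_comp measurable_fst measurable_U).
have mGZ i : measurable_fun setT (fun o => G i (T o).2.2).
  exact: (measurableT_comp (mG i) measurable_Z).
have E : {ae P, forall o, I (T o).2 * (tnth (T o).2.1 j - G j (T o).2.2) *
    (tnth (T o).2.1 k - G k (T o).2.2) = I (U o) * (Xc j o * Xc k o)}.
  move: (G_Gt j) (G_Gt k); apply: filterS2 => o [ej _] [ek _].
  by rewrite /Xc -ej -ek /U /Z mulrA.
apply: EE_ae_eq => //.
apply: Pint_ae_le (Pint_norm Iq).
  apply: measurable_funM; last exact: measurable_funB.
  apply: measurable_funM; last exact: measurable_funB.
  exact: (measurableT_comp mI measurable_U).
by move: E; apply: filterS => o ->.
Qed.

Let OmegaD v w : (v *m Omega P T I G *m w^T) 0 0 =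
  EE P (fun o => I (U o) * (D v o * D w o)).
Proof.
rewrite mxE (EE_ext P (_ : _ =1 fun o => \sum_k \sum_j
    (v 0 j * w 0 k) * (I (U o) * (Xc j o * Xc k o)))); last first.
  move=> o; rewrite /D mulr_sumr mulr_sumr; apply: eq_bigr => k _.
  by rewrite mulr_suml mulr_sumr; apply: eq_bigr => j _; ring.
have Iq j k : Pint P (fun o => I (U o) * (Xc j o * Xc k o)) by exact/Pint_bm/bmM.
rewrite EE_sum; last by move=> k; apply: Pint_sum => j; exact: PintZ.
apply: eq_bigr => k _; rewrite EE_sum; last by move=> j; exact: PintZ.
rewrite !mxE mulr_suml; apply: eq_bigr => j _.
by rewrite EEZ// OmegaE; ring.
Qed.

(** X - G(Z) is orthogonal to the functions of Z *)
Let Xc_orth k (phi : R -> R) (K : R) : measurable_fun setT phi -> (forall z, `|phi z| <= K) ->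
  EE P (fun o => I (U o) * (Xc k o * phi (Z o))) = 0.
Proof.
move=> mphi phiK.
have bphi : bm (fun o => phi (Z o)).
  by split; [exact: (measurableT_comp mphi measurable_Z)|exists K].
have bGt : bm (fun o => Gt k (Z o)).
  split; first exact: (measurableT_comp (mGt k) measurable_Z).
  by exists (C2 ^+ 2) => o; exact: Gt_le.
have bX : bm (fun o => tnth (U o).1 k).
  split; last by exists 1 => o; have /andP[x0 x1] := X_in k o; rewrite ger0_norm.
  apply: (measurableT_comp (measurable_tnth k)).
  exact: (measurableT_comp measurable_fst measurable_U).
have -> : EE P (fun o => I (U o) * (Xc k o * phi (Z o))) =
    EE P (fun o => phi (Z o) * (I (U o) * tnth (U o).1 k)) -
    EE P (fun o => (phi (Z o) * Gt k (Z o)) * I (U o)).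
  rewrite -EEB.
  - by apply: EE_ext => o; rewrite /Xc; ring.
  - have := Pint_bm (bmM bphi bX); congr Pint; apply/funext => o; ring.
  - have := Pint_bm (bmM bphi bGt); congr Pint; apply/funext => o; ring.
have [_ IIX _ HX] := cIX k; have [_ IB _ HB] := cB.
have FP := ae_filter_ringOfSetsType P.
rewrite -(HX _ _ mphi phiK).
have mpg : measurable_fun setT (fun z => phi z * Gt k z) by exact: measurable_funM.
have pgK z : `|phi z * Gt k z| <= K * C2 ^+ 2 by rewrite normrM ler_pM// Gt_le.
rewrite -(HB _ _ mpg pgK); apply/eqP; rewrite subr_eq0; apply/eqP.
apply: EE_ae_eq.
- apply: (@Pint_mulb _ _ _ _ (IX k \o Z) _ K) => //; first by have [] := bphi.
  by apply: aeW => o; exact: phiK.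
- apply: (@Pint_mulb _ _ _ _ (B \o Z) _ (K * C2 ^+ 2)) => //.
    by have [] := bmM bphi bGt.
  by apply: aeW => o; exact: pgK.
- by move: (G_Gt k); apply: filterS => o [_ <-]; rewrite mulrA.
Qed.

(** The values of f at U are theta (X - G(Z)) plus a function of Z, and both terms
are orthogonal. *)
Let Omega_le_EI f : contI f.2 ->
  (f.1 *m Omega P T I G *m f.1^T) 0 0 <= EI f f.
Proof.
move=> cf; rewrite OmegaD.
(* f(U) = theta (X - G(Z)) + psi(Z) *)
pose psi z := \sum_k f.1 0 k * Gt k z + f.2 (clamp01 z).
have [Kf fK] := contI_bounded cf.
have mpsi : measurable_fun setT psi.
  apply: measurable_funD; last exact: continuous_measurable_fun.
  by apply: measurable_sum => k; apply: measurable_funM => //; exact: measurable_cst.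
pose K := \sum_k `|f.1 0 k| * C2 ^+ 2 + Kf.
have psiK z : `|psi z| <= K.
  rewrite (le_trans (ler_normD _ _))// lerD//; last by apply: fK; exact: clamp01_in.
  apply: (le_trans (ler_norm_sum _ _ _)); apply: ler_sum => k _.
  by rewrite normrM ler_wpM2l// Gt_le.
have evE o : ev f (U o) = D f.1 o + psi (Z o).
  have [_ z01] := TU o.
  rewrite /ev /D /psi clamp01_id// addrA; congr (_ + _).
  by rewrite -big_split/=; apply: eq_bigr => k _; rewrite /Xc; ring.
have bpsi : bm (fun o => psi (Z o)).
  by split; [exact: (measurableT_comp mpsi measurable_Z)|exists K].
have E0 : EE P (fun o => I (U o) * (D f.1 o * psi (Z o))) = 0.
  rewrite (EE_ext P (_ : _ =1 fun o => \sum_k f.1 0 k * (I (U o) * (Xc k o * psi (Z o))))); last first.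
    by move=> o; rewrite /D mulr_suml mulr_sumr; apply: eq_bigr => k _; ring.
  rewrite EE_sum; last by move=> k; apply: PintZ; exact/Pint_bm/bmM.
  rewrite big1// => k _; rewrite EEZ; last exact/Pint_bm/bmM.
  by rewrite (Xc_orth k mpsi psiK) mulr0.
have I1 := Pint_bm (bmM (bmD f.1) (bmD f.1)).
have I2 := Pint_bm (bmM (bmD f.1) bpsi).
have I3 := Pint_bm (bmM bpsi bpsi).
have -> : EI f f = EE P (fun o => I (U o) * (D f.1 o * D f.1 o)) +
    (2 * EE P (fun o => I (U o) * (D f.1 o * psi (Z o))) +
     EE P (fun o => I (U o) * (psi (Z o) * psi (Z o)))).
  rewrite -EEZ// -EED//; last exact: PintZ.
  rewrite -EED//; last by apply: PintD => //; exact: PintZ.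
  by apply: EE_ext => o; rewrite evE; ring.
rewrite E0 mulr0 add0r lerDl; apply: EE_ae_ge0 => //.
have FP := ae_filter_ringOfSetsType P; move: IC2; apply: filterS => o /andP[h1 h2].
by rewrite -expr2 mulr_ge0 ?sqr_ge0// (le_trans _ h1)// invr_ge0 ltW.
Qed.

Let Omega_unit : Omega P T I G \in unitmx.
Proof.
rewrite -row_free_unit -kermx_eq0; apply/negPn/negP => K0.
pose v := nz_row (kermx (Omega P T I G)).
have v0 : v != 0 by rewrite nz_row_eq0.
have /sub_kermxP vO : (v <= kermx (Omega P T I G))%MS by exact: nz_row_sub.
by have := Omega_pos v0; rewrite vO mul0mx mxE ltxx.
Qed.

(** Each theta_k is the value at theta of a linear form, which is represented by
a vector w_k for the scalar product defined by Omega; apply Cauchy-Schwarz. *)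
Lemma theta_le : exists Ct, 0 <= Ct /\ forall f, contI f.2 -> forall k,
  f.1 0 k ^+ 2 <= Ct * EI f f.
Proof.
(* w k represents the linear form theta |-> theta_k for Omega *)
pose w k : 'rV[R]_p := (invmx (Omega P T I G) *m (delta_mx 0 k)^T)^T.
pose q (v1 v2 : 'rV[R]_p) : R := (v1 *m Omega P T I G *m v2^T) 0 0.
have qge0 (v : 'rV[R]_p) : 0 <= q v v.
  have [->|v0] := eqVneq v 0; last exact/ltW/Omega_pos.
  by rewrite /q mul0mx mul0mx mxE.
have IDD v1 v2 := Pint_bm (bmM (bmD v1) (bmD v2)).
have CS v1 v2 : q v1 v2 ^+ 2 <= q v1 v1 * q v2 v2.
  apply: quadratic_ge0_CS => // t.
  rewrite (_ : _ + _ = q (v1 + t *: v2) (v1 + t *: v2))//.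
  rewrite /q !OmegaD (EE_ext P (_ : (fun o => I (U o) * (D (v1 + t *: v2) o * _)) =1
    fun o => I (U o) * (D v1 o * D v1 o) + ((2 * t) * (I (U o) * (D v1 o * D v2 o)) +
      t ^+ 2 * (I (U o) * (D v2 o * D v2 o))))); last first.
    move=> o; have -> : D (v1 + t *: v2) o = D v1 o + t * D v2 o.
      rewrite /D mulr_sumr -big_split/=; apply: eq_bigr => k _.
      by rewrite !mxE; ring.
    ring.
  rewrite EED//; last by apply: PintD; exact: PintZ.
  by rewrite EED; [rewrite !EEZ// addrA|exact: PintZ..].
exists (\sum_k q (w k) (w k)); split; first exact: sumr_ge0.
move=> f cf k.
have -> : f.1 0 k = q f.1 (w k).
  rewrite /q /w trmxK mulmxA mulmxK// trmx_delta mxE (bigD1 k)//= big1 ?addr0.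
    by rewrite mxE !eqxx mulr1.
  by move=> j jk; rewrite mxE (negbTE jk) mulr0.
apply: (le_trans (CS _ _)); rewrite mulrC; apply: ler_pM => //.
  by rewrite (bigD1 k)//= lerDl; exact: sumr_ge0.
exact: Omega_le_EI.
Qed.

(** The norm of g is controlled by the norm of (theta, g), since g(Z) differs from
f(U) by at most a multiple of |theta|. *)
Lemma par0_le : exists Cg, 0 <= Cg /\ forall f, contI f.2 ->
  EI (par0 f.2) (par0 f.2) <= Cg * EI f f.
Proof.
have [Ct [Ct0 tle]] := theta_le.
exists (2 + 2 * C2 * (p%:R ^+ 2 * Ct)); split.
  by rewrite addr_ge0// mulr_ge0// mulr_ge0// ?ltW// sqr_ge0.
move=> f cf; have E0 : 0 <= EI f f by exact: EI_ge0.
have cf0 : contI (par0 f.2).2 by [].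
have If := Pint_ev2 cf cf; have I0 := Pint_ev2 cf0 cf0.
pose s := p%:R * Num.sqrt (Ct * EI f f).
have sE : s ^+ 2 = p%:R ^+ 2 * Ct * EI f f by rewrite exprMn sqr_sqrtr ?mulrA// mulr_ge0.
have xt o : (\sum_k tnth (U o).1 k * f.1 0 k) ^+ 2 <= s ^+ 2.
  rewrite -[leLHS]real_normK ?num_real// lerXn2r ?nnegrE//.
    by rewrite mulr_ge0// sqrtr_ge0.
  apply: (le_trans (ler_norm_sum _ _ _)).
  rewrite /s -[p in p%:R]card_ord mulr_natl -sumr_const; apply: ler_sum => k _.
  have /andP[x0 x1] := X_in k o; rewrite normrM ger0_norm//.
  apply: (@le_trans _ _ `|f.1 0 k|); first by rewrite ler_piMl.
  by rewrite -sqrtr_sqr ler_sqrt ?mulr_ge0//; exact: tle.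
rewrite (_ : (2 + _) * _ = 2 * EI f f + 2 * s ^+ 2 * C2); last by rewrite sE; ring.
have -> : 2 * EI f f + 2 * s ^+ 2 * C2 =
    EE P (fun o => 2 * (I (U o) * ev f (U o) * ev f (U o)) + 2 * s ^+ 2 * C2).
  by rewrite (EED (PintZ 2 If) (Pint_cst P _)) EEZ// EE_cst.
apply: EE_ae_le => //; first by apply: PintD; [exact: PintZ|exact: Pint_cst].
have FP := ae_filter_ringOfSetsType P; move: IC2; apply: filterS => o /andP[h1 h2].
have I_ge0 : 0 <= I (T o).2 by rewrite (le_trans _ h1)// invr_ge0 ltW.
rewrite ev_par0 {1 2}/ev -/(U o) in h2 I_ge0 *.
have := xt o; set x := \sum_k _; set g := f.2 _ => xs.
apply: (@le_trans _ _ (2 * (I (U o) * (x + g) * (x + g)) + 2 * (x ^+ 2 * I (U o)))).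
  (* g^2 <= 2 (x + g)^2 + 2 x^2, that is (g + 2 x)^2 >= 0 *)
  have := mulr_ge0 I_ge0 (sqr_ge0 (g + 2 * x)); rewrite -/(U o).
  by move: (I (U o)) => i; nra.
by rewrite lerD2l -mulrA ler_wpM2l// ler_pM// sqr_ge0.
Qed.

End theta_bound.

(** * Coordinates of a parameter *)

Section expansion.
Context (Ct Cg : R).
Hypothesis Ct0 : 0 <= Ct.
Hypothesis Cg0 : 0 <= Cg.
Hypothesis thetaC : forall f, contI f.2 -> forall k, f.1 0 k ^+ 2 <= Ct * EI f f.
Hypothesis par0C : forall f, contI f.2 -> EI (par0 f.2) (par0 f.2) <= Cg * EI f f.

(** The coordinates of x, followed by the functions h_nu of z. *)
Definition ebas (a : nat) (t : obs R p) : R :=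
  if insub a is Some k then tnth (clampU t.2).1 k else hb (a - p) (clampU t.2).2.
(** The weights of the basis [ebas]: 1 for the coordinates of x. *)
Definition wbas (a : nat) : R := if (a < p)%N then 1 else wt (a - p).
(** The coefficients of a parameter f = (theta, g) in the basis [ebas]. *)
Definition cbas f (a : nat) : R :=
  if insub a is Some k then f.1 0 k else coef f.2 (a - p).

Let insub_l (k : 'I_p) : insub (k : nat) = Some k :> option 'I_p.
Proof. exact: valK. Qed.

Let insub_r (k : nat) : insub (p + k)%N = None :> option 'I_p.
Proof. by rewrite insubF// ltnNge leq_addr. Qed.

Lemma wbas_gt0 a : 0 < wbas a.
Proof. by rewrite /wbas; case: ifP => // _; exact: lt_le_trans (wt_ge1 _). Qed.

Let sum_le_split (F : nat -> R) N : (forall a, 0 <= F a) ->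
  \sum_(a < N) F a <= \sum_(k < p) F k + \sum_(k < N) F (p + k)%N.
Proof.
move=> F0; have -> : \sum_(k < p) F k + \sum_(k < N) F (p + k)%N = \sum_(a < p + N) F a.
  by rewrite big_split_ord.
suff H q : \sum_(a < N) F a <= \sum_(a < q + N) F a by exact: H.
elim: q => [|q ih]; first by rewrite add0n.
by rewrite addSn big_ord_recr/=; apply: le_trans ih _; rewrite lerDl.
Qed.

Lemma wbas_sum N : \sum_(a < N) (wbas a)^-1 <= p%:R + Sw.
Proof.
apply: le_trans (@sum_le_split (fun a => (wbas a)^-1) N _) _.
  by move=> a; rewrite invr_ge0 ltW// wbas_gt0.
apply: lerD.
  rewrite (eq_bigr (fun=> 1)) ?sumr_const ?card_ord//= => k _.
  by rewrite /wbas ltn_ord invr1.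
apply: le_trans (wt_sum N); apply: ler_sum => k _.
by rewrite /wbas ltnNge leq_addr/= addKn.
Qed.

Lemma ebas_le a t : `|ebas a t| <= 1 + Ch.
Proof.
have [u1 u2] := @clampU_in _ _ t.2.
have Ch0 : 0 <= Ch by apply: le_trans (hb_le 0 u2).
rewrite /ebas; case: insubP => [k _ _|_].
  by have /andP[x0 x1] := u1 k; rewrite ger0_norm// (le_trans x1)// lerDl.
by rewrite (le_trans (hb_le _ u2))// lerDr.
Qed.

Lemma measurable_ebas a : measurable_fun setT (ebas a).
Proof.
rewrite /ebas; case: insubP => [k _ _|_].
  under eq_fun do rewrite tnth_map.
  apply: (measurableT_comp (continuous_measurable_fun (@continuous_clamp01 R))).
  apply: (measurableT_comp (measurable_tnth k)).
  exact: (measurableT_comp measurable_fst measurable_snd).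
apply: (measurableT_comp (continuous_measurable_fun (Hm_contI (hbH _)))).
exact: (measurableT_comp measurable_snd measurable_snd).
Qed.

Lemma ip_par0_le f : Hpar per m f -> ip (par0 f.2) (par0 f.2) <= (Cg + 1) * ip f f.
Proof.
move=> Hf; rewrite !innerE mulrDl mul1r.
have cf := Hpar_contI Hf; have E0 := EI_ge0 cf.
have J0 : 0 <= lam * J m f.2 f.2 by rewrite mulr_ge0// J_ge0.
have := par0C cf; rewrite mulrDr /=.
have := mulr_ge0 Cg0 J0; lra.
Qed.

(** The weighted squared coefficients are summable, with sum at most a constant
times the squared norm of f. *)
Lemma cbas_sum f N : Hpar per m f ->
  \sum_(a < N) cbas f a ^+ 2 * wbas a <= (Num.sqrt (p%:R * Ct + Cg + 1) * hn f) ^+ 2.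
Proof.
move=> Hf; have cf := Hpar_contI Hf.
rewrite exprMn Hnorm_sqr// sqr_sqrtr; last by rewrite !addr_ge0// mulr_ge0.
apply: le_trans (@sum_le_split (fun a => cbas f a ^+ 2 * wbas a) N _) _.
  by move=> a; rewrite mulr_ge0 ?sqr_ge0// ltW// wbas_gt0.
rewrite -addrA mulrDl; apply: lerD.
  rewrite -mulrA -[p in p%:R]card_ord mulr_natl -sumr_const; apply: ler_sum => k _.
  rewrite /cbas insub_l /wbas ltn_ord mulr1; apply: le_trans (thetaC cf k) _.
  by rewrite ler_wpM2l// EI_le_inner.
apply: le_trans (ip_par0_le Hf); apply: le_trans (bessel N Hf).
apply: ler_sum => k _; rewrite /cbas insub_r /wbas ltnNge leq_addr/= addKn.
by [].
Qed.

(** The expansion of f in the basis converges uniformly on the unit cube. *)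
Lemma cbas_approx f : Hpar per m f -> forall e, 0 < e -> \forall N \near \oo, forall t,
  `|ev f (clampU t.2) - \sum_(a < N) cbas f a * ebas a t| <= e.
Proof.
move=> Hf e e0; have Hg : Hm per m f.2 by [].
have Ch0 : 0 <= Ch by apply: (le_trans _ (hb_le 0 (_ : 0 <= 0 <= 1))) => //; rewrite lexx ler01.
pose K := Ch * Num.sqrt Sw + 1.
have K0 : 0 < K by rewrite ltr_wpDl// mulr_ge0// sqrtr_ge0.
have := comb_cvg Hg (divr_gt0 e0 K0) => -[N0 _ HN].
exists (p + N0)%N => // N' /= pN t.
have pN' : (p <= N')%N by exact: leq_trans (leq_addr _ _) pN.
move: pN; rewrite -(subnKC pN') leq_add2l; set N := (N' - p)%N => /HN /= hN.
have [u1 u2] := @clampU_in _ _ t.2.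
rewrite big_split_ord/=.
have -> : \sum_(k < p) cbas f k * ebas k t = \sum_(k < p) tnth (clampU t.2).1 k * f.1 0 k.
  by apply: eq_bigr => k _; rewrite /cbas /ebas insub_l mulrC.
have -> : \sum_(k < N) cbas f (p + k)%N * ebas (p + k)%N t = comb (coef f.2) N (clampU t.2).2.
  by apply: eq_bigr => k _; rewrite /cbas /ebas insub_r addKn.
rewrite /ev opprD addrACA subrr add0r.
have Hd : Hm per m (fun z => f.2 z - comb (coef f.2) N z) by apply: Hm_sub => //; exact: Hm_comb.
apply: (le_trans (sup_par0_le Hd u2)).
apply: (@le_trans _ _ (K * (e / K))); last by rewrite mulrC divfK// gt_eqF.
apply: ler_pM => //; last by rewrite lerDl.
  by rewrite mulr_ge0// sqrtr_ge0.
exact: sqrtr_ge0.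
Qed.

(** The sup norm of f is bounded by its norm in H. *)
Lemma ev_le f u : Hpar per m f -> Ucal u ->
  `|ev f u| <= (p%:R * Num.sqrt Ct + Ch * Num.sqrt Sw * Num.sqrt (Cg + 1)) * hn f.
Proof.
move=> Hf [u1 u2]; have cf := Hpar_contI Hf; have Hg : Hm per m f.2 by [].
have Ch0 : 0 <= Ch by apply: le_trans (hb_le 0 u2).
rewrite mulrDl; apply: (le_trans (ler_normD _ _)); apply: lerD.
  apply: (le_trans (ler_norm_sum _ _ _)).
  rewrite -mulrA -[p in p%:R]card_ord mulr_natl -sumr_const; apply: ler_sum => k _.
  have /andP[x0 x1] := u1 k; rewrite normrM ger0_norm//.
  apply: (@le_trans _ _ `|f.1 0 k|); first by rewrite ler_piMl.
  rewrite -sqrtr_sqr -sqrtrM// ler_sqrt; last by rewrite mulr_ge0// inner_ge0.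
  by apply: le_trans (thetaC cf k) _; rewrite ler_wpM2l// EI_le_inner.
apply: (le_trans (sup_par0_le Hg u2)).
rewrite -[leRHS]mulrA; apply: ler_wpM2l; first by rewrite mulr_ge0// sqrtr_ge0.
rewrite -sqrtrM ?addr_ge0//.
have q0 : 0 <= (Cg + 1) * ip f f by apply: mulr_ge0; [exact: addr_ge0|exact: inner_ge0 Hf].
rewrite /Hnorm ler_sqrt//; exact: ip_par0_le.
Qed.

(** The centered empirical process with weight omega is small as a bilinear form
on H, uniformly, off an event of small probability. *)
Lemma bform_H_event (Ts : nat -> {RV P >-> obs R p}) (omega : obs R p -> R) n t :
  iid_copies P T Ts -> measurable_fun setT omega ->
  Pint P (fun o => omega (T o) ^+ 2) -> (0 < n)%N -> 0 < t ->
  exists A : set Om, [/\ measurable A,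
    (P A <= (n%:R^-1 * ((1 + Ch) ^+ 4 * EE P (fun o => omega (T o) ^+ 2)) *
       (p%:R + Sw) ^+ 2 / t)%:E)%E &
    forall o, ~ A o -> forall f1 f2, Hpar per m f1 -> Hpar per m f2 ->
      `|bform T Ts omega n (fun s => ev f1 (clampU s.2)) (fun s => ev f2 (clampU s.2)) o|
      <= Num.sqrt t * (p%:R * Ct + Cg + 1) * (hn f1 * hn f2)].
Proof.
move=> iid mo o2 n0 t0.
have [A [mA PA HA]] := bform_HS_event iid mo o2 measurable_ebas ebas_le wbas_gt0 wbas_sum n0 t0.
exists A; split => // o nA f1 f2 H1 H2.
have bm f : Hpar per m f -> measurable_fun setT (fun s : obs R p => ev f (clampU s.2)) /\
    exists K : R, forall s : obs R p, `|ev f (clampU s.2)| <= K.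
  move=> Hf; have cf := Hpar_contI Hf; split.
    by apply: (measurableT_comp (measurable_ev_clampU cf)).
  by have [K fK] := ev_bounded cf; exists K => s; apply: fK; exact: clampU_in.
have q0 : 0 <= p%:R * Ct + Cg + 1 by rewrite !addr_ge0// mulr_ge0.
have := bform_le mo o2 measurable_ebas ebas_le wbas_gt0 (ltW t0) _ _ (bm _ H1) (bm _ H2)
  (HA o nA) (fun N => cbas_sum N H1) (fun N => cbas_sum N H2) (cbas_approx H1) (cbas_approx H2).
move=> H; apply: le_trans (H _ _) _; [by rewrite mulr_ge0 ?sqrtr_ge0..|].
rewrite -{3}(sqr_sqrtr q0) expr2.
set q := Num.sqrt (p%:R * _ + _ + _); set s := Num.sqrt t.
by rewrite (_ : s * (q * hn f1) * (q * hn f2) = s * (q * q) * (hn f1 * hn f2)); [exact: lexx|ring].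
Qed.

End expansion.
End inner_product.

(** * First order condition and Taylor expansion *)

Section derivatives.
Context {R : realType}.
Implicit Types (f : R -> R).

Lemma is_derive_derive1 f x : derivable f x 1 -> is_derive x 1 f (derive1 f x).
Proof. by move=> fx; apply: DeriveDef; rewrite ?derive1E. Qed.

(** The mean value theorem, for points a and b in any order. *)
Lemma mean_value f a b : (forall x, derivable f x 1) ->
  exists c, [/\ Num.min a b <= c, c <= Num.max a b & f b - f a = derive1 f c * (b - a)].
Proof.
move=> df; have cf : continuous f.
  by move=> x; apply: differentiable_continuous; exact/derivable1_diffP.
have [ab|/ltW ba] := leP a b.
  have [c cab fE] := MVT_segment ab (fun x _ => is_derive_derive1 (df x)) (continuous_subspaceT cf).
  by move: cab; rewrite in_itv/= => /andP[ac cb]; exists c.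
have [c cab fE] := MVT_segment ba (fun x _ => is_derive_derive1 (df x)) (continuous_subspaceT cf).
move: cab; rewrite in_itv/= => /andP[ac cb]; exists c; split => //.
by rewrite -opprB fE -mulrN opprB.
Qed.

(** Taylor expansion of order one with a quadratic remainder. *)
Lemma taylor_quadratic f (lo hi L a b : R) : (forall x, derivable f x 1) ->
  (forall x, derivable (derive1 f) x 1) -> (forall x, lo < x < hi -> `|derive1 (derive1 f) x| <= L) ->
  lo < a < hi -> lo < b < hi -> `|f b - f a - derive1 f a * (b - a)| <= L * (b - a) ^+ 2.
Proof.
move=> df d2f f2L /andP[la ah] /andP[lb bh].
have [c [c1 c2 ->]] := mean_value a b df; have [e [e1 e2 fe]] := mean_value a c d2f.
rewrite -mulrBl fe.
have ca : `|c - a| <= `|b - a|.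
  move: c1 c2; rewrite /Num.min /Num.max; have [ab|ba] := ltP a b => c1 c2.
    by rewrite !ger0_norm ?subr_ge0// ?(ltW ab)// lerD2r.
  by rewrite !ler0_norm ?subr_le0// !opprB lerD2l lerN2.
have fL : `|derive1 (derive1 f) e| <= L.
  apply: f2L; have l1 : lo < Num.min a c.
    by rewrite lt_min la/=; apply: lt_le_trans c1; rewrite lt_min la.
  have l2 : Num.max a c < hi.
    by rewrite gt_max ah/=; apply: le_lt_trans c2 _; rewrite gt_max ah.
  by rewrite (lt_le_trans l1 e1) (le_lt_trans e2 l2).
rewrite normrM normrM -mulrA; apply: ler_pM => //.
by rewrite -[leRHS]ger0_norm ?sqr_ge0// normrX expr2 ler_wpM2r.
Qed.

Lemma is_derive_affine f (a b t : R) : derivable f (t * b + a) 1 ->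
  is_derive t 1 (fun s => f (s * b + a)) (derive1 f (t * b + a) * b).
Proof.
move=> df.
have dg : is_derive t 1 (fun s : R => s * b + a) b.
  rewrite (_ : (fun s => _) = b *: (@id R) + cst a); last first.
    by apply/funext => s; rewrite !fctE /GRing.scale/= mulrC.
  by apply: is_derive_eq; rewrite addr0 /GRing.scale/= mulr1.
exact: (@is_derive1_comp _ f (fun s : R => s * b + a) t _ _ (is_derive_derive1 df) dg).
Qed.

Lemma is_derive_quadratic (a b c t : R) :
  is_derive t 1 (cst a + (b *: (@id R) + c *: ((@id R) ^+ 2))) (b + c * (2 * t)).
Proof.
have H1 := @is_derive_id _ R^o t 1.
have H2 := is_deriveX 2 H1.
have H3 := is_deriveD (is_deriveZ b H1) (is_deriveZ c H2).
have H4 := is_deriveD (@is_derive_cst _ R^o R^o a t 1) H3.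
by apply: (is_derive_eq H4); rewrite /GRing.scale/= expr1 add0r !mulr1.
Qed.

End derivatives.

Section first_order_condition.
Context {R : realType} {p : nat}.
Context (per : bool) (m : nat) (lam : R) (ell : R -> R -> R) (Ycal : set R).
Hypothesis m_gt0 : (0 < m)%N.
Hypothesis ell_der : forall y a, Ycal y -> derivable (ell y) a 1.

(** The derivative at 0 of t |-> pen_crit (f + t g) vanishes. *)
Lemma first_order_condition n (ts : nat -> obs R p) (f g : par R p) :
  (forall i, Ycal (ts i).1) -> is_maximizer (Hpar per m) (pen_crit ell lam m n ts) f ->
  Hpar per m g ->
  n%:R^-1 * (\sum_(i < n) derive1 (ell (ts i).1) (ev f (ts i).2) * ev g (ts i).2) = lam * J m f.2 g.2.
Proof.
move=> Yts [Hf fmax] Hg.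
pose phi (t : R) := n%:R^-1 * \sum_(i < n) ell (ts i).1 (t * ev g (ts i).2 + ev f (ts i).2)
  - lam / 2 * (J m f.2 f.2 + 2 * t * J m f.2 g.2 + t ^+ 2 * J m g.2 g.2).
have Hfg t : Hpar per m (t *: g + f) by have := Hm_lin m_gt0 t Hg Hf.
have phiE t : phi t = pen_crit ell lam m n ts (t *: g + f).
  rewrite /phi /pen_crit; congr (_ * _ - _ * _).
    by apply: eq_bigr => i _; rewrite evE_lin.
  have [Sf Sg] := (Hm_sobolev Hf, Hm_sobolev Hg).
  have Sfg := Hm_sobolev (Hfg t).
  have E g' : sobolev m g' -> J m (t *: g + f).2 g' = t * J m g.2 g' + J m f.2 g'.
    by move=> Sg'; exact: J_lin.
  rewrite -[LHS]/(_ + _ + _) -[RHS]/(J m (t *: g + f).2 (t *: g + f).2) E//.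
  by rewrite !(J_sym m _ (t *: g + f).2) !E// (J_sym m g.2 f.2); ring.
pose dphi (t : R) : R := n%:R^-1 *
    \sum_(i < n) derive1 (ell (ts i).1) (t * ev g (ts i).2 + ev f (ts i).2) * ev g (ts i).2
  - lam / 2 * (2 * J m f.2 g.2 + 2 * t * J m g.2 g.2).
have phiD (t : R) : is_derive t 1 phi (dphi t).
  pose F (i : 'I_n) s := ell (ts i).1 (s * ev g (ts i).2 + ev f (ts i).2).
  pose dF (i : 'I_n) := derive1 (ell (ts i).1) (t * ev g (ts i).2 + ev f (ts i).2) * ev g (ts i).2.
  have HF i : is_derive t 1 (F i) (dF i) by apply: is_derive_affine; exact: ell_der.
  have HS := is_derive_sum HF.
  rewrite (_ : phi = n%:R^-1 *: (\sum_(i < n) F i) - (lam / 2) *: (cst (J m f.2 f.2) +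
      ((2 * J m f.2 g.2) *: (@id R) + J m g.2 g.2 *: ((@id R) ^+ 2)))); last first.
    apply/funext => s; rewrite /phi !fctE.
    rewrite fct_sumE. rewrite /GRing.scale/=; congr (_ - _). ring.
  have := is_deriveB (is_deriveZ n%:R^-1 HS)
    (is_deriveZ (lam / 2) (is_derive_quadratic (J m f.2 f.2) (2 * J m f.2 g.2) (J m g.2 g.2) t)).
  move=> H; apply: (is_derive_eq H); rewrite /dphi /GRing.scale/=; congr (_ - _ * _).
  by ring.
have max0 : is_derive (0 : R) 1 phi 0.
  apply: (@derive1_at_max _ phi (-1) 1 0).
  - lra.
  - by move=> t _; have [] := phiD t.
  - by rewrite in_itv/=; apply/andP; split; lra.
  - move=> t _; rewrite (phiE t) (phiE 0) scale0r add0r.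
    by apply: fmax; exact: Hfg.
have : dphi 0 = 0.
  by have [_ <-] := phiD 0; have [_ ->] := max0.
rewrite /dphi; under eq_bigr do rewrite mul0r add0r; lra.
Qed.
End first_order_condition.

Section remainder.
Context d {Om : measurableType d} {R : realType} (P : probability Om R).
Context {p : nat} (T : {RV P >-> obs R p}) (Ts : nat -> {RV P >-> obs R p}).
Context (I : cov R p -> R) (per : bool) (m : nat) (lam : R).
Hypothesis m_gt0 : (0 < m)%N.
Hypothesis TU : forall o, Ucal (T o).2.
Hypothesis mI : measurable_fun setT I.
Context (C2 : R).
Hypothesis C2_gt0 : 0 < C2.
Hypothesis IC2 : {ae P, forall o, C2^-1 <= I (T o).2 <= C2}.
Hypothesis lam_ge0 : 0 <= lam.
Context (Ycal : set R) (ell : R -> R -> R) (f0 : par R p).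
Hypothesis f0_H : Hpar per m f0.
Context (Rep : cov R p -> par R p) (Pl : par R p -> par R p).
Hypothesis Rep_def : forall u, Ucal u -> is_representer P T I per lam m u (Rep u).
Hypothesis Pl_def : is_Plambda P T I per lam m Pl.
Local Notation ip := (inner P T I lam m).
Local Notation hn := (Hnorm P T I lam m).

Let H0 : Hpar per m (0 : par R p).
Proof. by have := Hpar_lin m_gt0 (-1) f0_H f0_H; rewrite scaleN1r addNr. Qed.

Let iplin a f1 f2 f3 : Hpar per m f1 -> Hpar per m f2 -> Hpar per m f3 ->
  ip (a *: f1 + f2) f3 = a * ip f1 f3 + ip f2 f3.
Proof. exact: (inner_lin lam m_gt0 TU mI C2_gt0 IC2). Qed.

Lemma inner_sum n (c : nat -> R) (r : nat -> par R p) g : (forall i, Hpar per m (r i)) ->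
  Hpar per m g -> Hpar per m (\sum_(i < n) c i *: r i) /\
  ip (\sum_(i < n) c i *: r i) g = \sum_(i < n) c i * ip (r i) g.
Proof.
move=> Hr Hg; elim: n => [|n [ih1 ih2]].
  by rewrite !big_ord0; split => //; exact: (inner0l lam m_gt0 TU mI C2_gt0 IC2 Hg).
rewrite !big_ord_recr/= [_ + c n *: _]addrC; split; first exact: Hpar_lin.
by rewrite iplin// ih2 addrC.
Qed.

(** The inner products with S_n(f_0), by the definitions of R_u and P_lambda. *)
Lemma S_nl_inner n (ts : nat -> obs R p) g : (forall i, Ucal (ts i).2) -> Hpar per m g ->
  Hpar per m (S_nl ell f0 ts Rep Pl n) /\
  ip (S_nl ell f0 ts Rep Pl n) g =
  n%:R^-1 * \sum_(i < n) score ell f0 (ts i) * ev g (ts i).2 - lam * J m f0.2 g.2.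
Proof.
move=> Uts Hg; have [HP ipP] := Pl_def f0_H.
have [HS ipS] := @inner_sum n (fun i => score ell f0 (ts i)) (fun i => Rep (ts i).2) g
  (fun i => (Rep_def (Uts i)).1) Hg.
have HnS := Hpar_lin m_gt0 n%:R^-1 HS H0; rewrite addr0 in HnS.
rewrite /S_nl addrC -scaleN1r; split; first exact: Hpar_lin.
rewrite iplin// ipP// mulN1r addrC -[n%:R^-1 *: _]addr0 iplin//.
rewrite (inner0l lam m_gt0 TU mI C2_gt0 IC2 Hg) addr0 ipS; congr (_ * _ - _).
by apply: eq_bigr => i _; have [_ ->] := Rep_def (Uts i).
Qed.

Lemma Hnorm_mul_le f1 K : Hpar per m f1 -> ip f1 f1 <= K * hn f1 -> 0 <= K -> hn f1 <= K.
Proof.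
move=> Hf; rewrite -(Hnorm_sqr m_gt0 TU mI C2_gt0 IC2 lam_ge0 Hf) expr2 => h K0.
have [/eqP ->//|r0] := boolP (hn f1 == 0).
by rewrite ler_pM2r// lt_def r0 sqrtr_ge0 in h.
Qed.

Hypothesis ell_der : forall y a, Ycal y -> derivable (ell y) a 1.
Hypothesis ell_der2 : forall y a, Ycal y -> derivable (derive1 (ell y)) a 1.
Hypothesis ell_der3 : forall y a, Ycal y -> derivable (derive1 (derive1 (ell y))) a 1.
Context (lo hi csup gap : R) (om1 om2 : obs R p -> R).
Hypothesis f0_gap : forall u, Ucal u -> lo + gap < ev f0 u < hi - gap.
Hypothesis csup0 : 0 <= csup.
Hypothesis ev_sup : forall f u, Hpar per m f -> Ucal u -> `|ev f u| <= csup * hn f.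
Hypothesis om1E : forall t, Ycal t.1 -> Ucal t.2 ->
  om1 t = derive1 (derive1 (ell t.1)) (ev f0 t.2).
Hypothesis om1I : forall f1 f2, Hpar per m f1 -> Hpar per m f2 ->
  EE P (fun o => om1 (T o) * ev f1 (clampU (T o).2) * ev f2 (clampU (T o).2)) =
  - EI T I f1 f2.
Context (K2 : R).
Hypothesis om2K : forall f, Hpar per m f ->
  EE P (fun o => om2 (T o) * ev f (clampU (T o).2) * ev f (clampU (T o).2)) <=
  K2 * hn f ^+ 2.
Hypothesis K2_ge0 : 0 <= K2.
Local Notation bf w n f1 f2 o :=
  (bform T Ts w n (fun s => ev f1 (clampU s.2)) (fun s => ev f2 (clampU s.2)) o).

(** The Bahadur remainder on the event where the empirical bilinear forms are
controlled. *)
Lemma remainder_le n o (fh : par R p) (W1 W2 : R) :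
  (forall i, Ycal (Ts i o).1 /\ Ucal (Ts i o).2) ->
  (forall i a, lo < a < hi -> `|derive1 (derive1 (derive1 (ell (Ts i o).1))) a| <= om2 (Ts i o)) ->
  is_maximizer (Hpar per m) (pen_crit ell lam m n (fun i => Ts i o)) fh ->
  (forall f1 f2, Hpar per m f1 -> Hpar per m f2 -> `|bf om1 n f1 f2 o| <= W1 * (hn f1 * hn f2)) ->
  (forall f1 f2, Hpar per m f1 -> Hpar per m f2 -> `|bf om2 n f1 f2 o| <= W2 * (hn f1 * hn f2)) ->
  0 <= W1 -> 0 <= W2 -> csup * hn (fh - f0) <= gap ->
  hn (fh - f0 - S_nl ell f0 (fun i => Ts i o) Rep Pl n)
    <= W1 * hn (fh - f0) + csup * ((W2 + K2) * hn (fh - f0) ^+ 2).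
Proof.
move=> YU L3 fmax B1 B2 W10 W20 small.
have Hfh : Hpar per m fh by have [] := fmax.
set de : par R p := fh - f0; set S := S_nl _ _ _ _ _ _; set r : par R p := de - S.
have Hde : Hpar per m de.
  by rewrite /de addrC -scaleN1r; exact: Hpar_lin.
have Uts i : Ucal (Ts i o).2 by have [] := YU i.
have Yts i : Ycal (Ts i o).1 by have [] := YU i.
have HS : Hpar per m S by have [] := S_nl_inner n Uts f0_H.
have Hr : Hpar per m r by rewrite /r addrC -scaleN1r; exact: Hpar_lin.
have h0 f : 0 <= hn f by exact: sqrtr_ge0.
have K0 : 0 <= W1 * hn de + csup * ((W2 + K2) * hn de ^+ 2).
  by rewrite addr_ge0 ?mulr_ge0 ?addr_ge0// sqr_ge0.
apply: (Hnorm_mul_le Hr) => //.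
have evde i : ev de (Ts i o).2 = ev fh (Ts i o).2 - ev f0 (Ts i o).2.
  by rewrite /de addrC -scaleN1r evE_lin mulN1r addrC.
(* the remainder of the first order expansion of the score around f_0 *)
pose rho i := derive1 (ell (Ts i o).1) (ev fh (Ts i o).2) - derive1 (ell (Ts i o).1) (ev f0 (Ts i o).2)
  - derive1 (derive1 (ell (Ts i o).1)) (ev f0 (Ts i o).2) * ev de (Ts i o).2.
have rho_le i : `|rho i| <= om2 (Ts i o) * ev de (Ts i o).2 ^+ 2.
  rewrite /rho evde; apply: (@taylor_quadratic _ _ lo hi) => //.
  - by move=> x; exact: ell_der2.
  - by move=> x; exact: ell_der3.
  - by move=> x; exact: L3.
  - have := f0_gap (Uts i); have := le_trans (ev_sup Hde (Uts i)) small.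
    have := normr_ge0 (ev de (Ts i o).2).
    by move: (`|_|) => v v0 vg /andP[? ?]; apply/andP; split; lra.
  - have := f0_gap (Uts i); have := le_trans (ev_sup Hde (Uts i)) small.
    by rewrite evde ler_norml => /andP[? ?] /andP[? ?]; apply/andP; split; lra.
have ipE : ip r r = bf om1 n de r o + n%:R^-1 * \sum_(i < n) rho i * ev r (Ts i o).2.
  have -> : ip r r = ip de r - ip S r.
    by rewrite {1}/r addrC -scaleN1r iplin// mulN1r addrC.
  have [_ ->] := S_nl_inner n Uts Hr.
  rewrite innerE /bform om1I//.
  have foc := first_order_condition m_gt0 ell_der Yts fmax Hr.
  have Jde : J m de.2 r.2 = J m fh.2 r.2 - J m f0.2 r.2.
    have S1 := Hm_sobolev f0_H; have S2 := Hm_sobolev Hfh; have S3 := Hm_sobolev Hr.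
    have := J_lin m_gt0 (-1) S1 S2 S3; rewrite mulN1r addrC => <-; congr J.
    by apply/funext => z; rewrite mulN1r addrC.
  rewrite Jde mulrBr -foc.
  have -> : \sum_(i < n) om1 (Ts i o) * ev de (clampU (Ts i o).2) * ev r (clampU (Ts i o).2) =
     \sum_(i < n) derive1 (ell (Ts i o).1) (ev fh (Ts i o).2) * ev r (Ts i o).2
     - \sum_(i < n) score ell f0 (Ts i o) * ev r (Ts i o).2
     - \sum_(i < n) rho i * ev r (Ts i o).2.
    rewrite -!sumrB; apply: eq_bigr => i _.
    by rewrite clampU_id// om1E// /rho /score; ring.
  ring.
rewrite ipE mulrDl; apply: lerD.
  by rewrite -mulrA; apply: le_trans (B1 de r Hde Hr); exact: ler_norm.
have n0 : 0 <= n%:R^-1 :> R by rewrite invr_ge0.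
apply: (@le_trans _ _ ((csup * hn r) * (n%:R^-1 * \sum_(i < n) om2 (Ts i o) * ev de (Ts i o).2 ^+ 2))).
  rewrite mulrCA ler_wpM2l// mulr_sumr; apply: ler_sum => i _.
  apply: le_trans (ler_norm _) _; rewrite normrM mulrC; apply: ler_pM => //.
  exact: ev_sup.
rewrite -[leLHS]mulrA -[leRHS]mulrA ler_wpM2l// [leRHS]mulrC ler_wpM2l//.
have -> : n%:R^-1 * \sum_(i < n) om2 (Ts i o) * ev de (Ts i o).2 ^+ 2 =
    bf om2 n de de o + EE P (fun o => om2 (T o) * ev de (clampU (T o).2) * ev de (clampU (T o).2)).
  rewrite /bform subrK; congr (_ * _); apply: eq_bigr => i _.
  by rewrite clampU_id//; ring.
rewrite mulrDl; apply: lerD; last exact: om2K.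
by rewrite expr2; apply: le_trans (B2 de de Hde Hde); exact: ler_norm.
Qed.

End remainder.

(** * Measurability of the derivatives of the criterion *)

Section caratheodory.
Context {R : realType} (Ycal : set R).
Hypothesis mY : measurable Ycal.

(** The derivative at a is a limit of difference quotients. *)
Lemma measurable_derive1 (psi : R -> R -> R) (a : R) :
  (forall a, measurable_fun Ycal (psi ^~ a)) ->
  (forall y, Ycal y -> derivable (psi y) a 1) ->
  measurable_fun Ycal (fun y => derive1 (psi y) a).
Proof.
move=> mpsi dpsi.
apply: (@measurable_fun_cvg _ _ _ _ (fun n y => n.+1%:R * (psi y (n.+1%:R^-1 + a) - psi y a))).
  move=> n; apply: measurable_funM; first exact: measurable_cst.
  by apply: measurable_funB; exact: mpsi.
move=> y Yy; have := dpsi y Yy; rewrite /derivable => /cvg_ex[l hl].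
have -> : derive1 (psi y) a = l.
  rewrite derive1E /derive; exact: cvg_lim hl.
have /cvgr_dnbhsP/(_ (fun n => n.+1%:R^-1)) := hl.
rewrite /= => H; have {}H := H (conj (fun n => _) (@cvg_harmonic R)).
apply: cvg_trans (H _); last by move=> n; rewrite invr_eq0 pnatr_eq0.
by apply: near_eq_cvg; near=> n; rewrite /GRing.scale/= invrK mulr1.
Unshelve. all: by end_near. Qed.

(** A function of (y, b) that is measurable in y and continuous in b is jointly
measurable: b is approximated by the points of a grid of step 1/(n+1). *)
Lemma measurable_caratheodory d (V : measurableType d) (psi : R -> R -> R) (b : V -> R) (lo : R) :
  (forall a, measurable_fun Ycal (psi ^~ a)) ->
  (forall y, Ycal y -> continuous (psi y)) ->
  measurable_fun setT b -> (forall v, lo <= b v) ->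
  measurable_fun (Ycal `*` [set: V]) (fun t : R * V => psi t.1 (b t.2)).
Proof.
move=> mpsi cpsi mb lob; have mYV : measurable (Ycal `*` [set: V]) by exact: measurableX.
(* lo + c n v / (n+1) is the point of the grid just below b v *)
pose c n v : R := (Num.truncn ((b v - lo) * n.+1%:R))%:R.
apply: (@measurable_fun_cvg _ _ _ _ (fun n t => psi t.1 (lo + c n t.2 / n.+1%:R))).
  move=> n; pose E k := (Ycal `*` [set: V]) `&` [set t : R * V | c n t.2 = k%:R].
  have mE k : measurable (E k).
    apply: measurableI => //; rewrite (_ : [set t | _] =
      (fun t : R * V => (b t.2 - lo) * n.+1%:R) @^-1` `[k%:R, k.+1%:R[%classic).
      rewrite -[X in measurable X]setTI.
      have mf : measurable_fun setT (fun t : R * V => (b t.2 - lo) * n.+1%:R).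
        apply: measurable_funM; last exact: measurable_cst.
        apply: measurable_funB; last exact: measurable_cst.
        exact: (measurableT_comp mb measurable_snd).
      exact: mf.
    have b0 v : 0 <= (b v - lo) * n.+1%:R by rewrite mulr_ge0// subr_ge0.
    apply/seteqP; split => t; rewrite /c/= in_itv/=.
      by move=> /eqP; rewrite eqr_nat => /eqP <-; exact: truncn_itv.
    by move=> h; congr (_ *+ _); exact: truncn_def.
  rewrite (_ : Ycal `*` _ = \bigcup_k E k); last first.
    apply/seteqP; split => [t Yt|t [k _ []]//].
    by exists (Num.truncn ((b t.2 - lo) * n.+1%:R)).
  apply/measurable_fun_bigcup => // k.
  apply: (eq_measurable_fun (fun t : R * V => psi t.1 (lo + k%:R / n.+1%:R))).
    by move=> t; rewrite inE => -[_ /= ->].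
  apply: (@measurable_comp _ _ _ _ _ _ Ycal (psi ^~ (lo + k%:R / n.+1%:R)) _ (fst : R * V -> R)) => //.
    by move=> _ [t [[/= Yt _] _]] <-.
  exact: measurable_funTS.
move=> t [/= Yt _]; apply: (cvg_comp (fun n => lo + c n t.2 / n.+1%:R) (psi t.1)) (cpsi _ Yt _).
have d0 : 0 <= b t.2 - lo by rewrite subr_ge0.
apply/cvgrPdist_le => e e0.
have /cvgrPdist_le/(_ _ e0)[N _ HN] := @cvg_harmonic R.
exists N => // n /HN; rewrite /= sub0r normrN => hn.
apply: le_trans hn; rewrite [leRHS]ger0_norm//.
have n0 : 0 < n.+1%:R :> R by rewrite ltr0n.
have /andP[t1 t2] := truncn_itv (mulr_ge0 d0 (ltW n0)).
rewrite -(ler_pM2r n0) mulVf ?gt_eqF//.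
rewrite -[X in _ * X <= _](gtr0_norm n0) -normrM mulrBl mulrDl divfK ?gt_eqF//.
have := t2; rewrite -natr1; move: t1; rewrite -/(c n t.2).
rewrite mulrBl => t1 t3.
by rewrite ler_norml; apply/andP; split; lra.
Qed.

End caratheodory.

Section supremum_of_derivative.
Context {R : realType}.

(** The rational points of the interval ]lo, hi[, where the middle point stands for
the rationals outside of it. *)
Definition rational_pts (lo hi : R) (n : nat) : R :=
  if unpickle n is Some r then
    (if lo < ratr (r : rat) < hi then ratr r else (lo + hi) / 2) else (lo + hi) / 2.

Lemma rational_pts_in lo hi n : lo < hi -> lo < rational_pts lo hi n < hi.
Proof.
move=> lh; have mid : lo < (lo + hi) / 2 < hi by apply/andP; split; lra.
by rewrite /rational_pts; case: unpickle => // r; case: ifP.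
Qed.

(** By continuity, a supremum over an open interval is a supremum over its
rational points. *)
Lemma ereal_sup_rational (f : R -> R) (lo hi : R) : lo < hi -> continuous f ->
  ereal_sup [set (`|f a|)%:E | a in `]lo, hi[] =
  esups (fun n => (`|f (rational_pts lo hi n)|)%:E) 0%N.
Proof.
move=> lh cf; apply/eqP; rewrite eq_le; apply/andP; split; last first.
  apply: ge_ereal_sup => _ [n _ <-]; apply: ereal_sup_ubound.
  by exists (rational_pts lo hi n) => //=; rewrite in_itv/=; exact: rational_pts_in.
apply: ge_ereal_sup => _ [a /= + <-]; rewrite in_itv/= => /andP[la ah].
apply/lee_addgt0Pr => e e0.
have [d /= d0 ade] : \forall b \near a, `|f a - f b| < e by exact: cvgr_dist_lt (cf a) _ e0.
have [r] : exists q : rat, ratr q \in `]a, Num.min hi (a + d)[%R.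
  by apply: rat_in_itvoo; rewrite lt_min ah/= ltrDl.
rewrite in_itv/= lt_min => /andP[ar /andP[rh rd]].
have rn : rational_pts lo hi (pickle r) = ratr r.
  by rewrite /rational_pts pickleK rh (lt_trans la ar).
apply: (@le_trans _ _ ((`|f (ratr r)|)%:E + e%:E)%E).
  rewrite -EFinD lee_fin -lerBlDl (le_trans (lerB_dist _ _))//.
  by apply/ltW/ade; rewrite /= distrC ger0_norm ?subr_ge0 ?(ltW ar)// ltrBlDl.
apply: leeD => //; apply: ereal_sup_ubound.
by exists (pickle r); rewrite ?rn.
Qed.

End supremum_of_derivative.

(** * Moments and conditional expectations of the derivatives *)

Section exponential_moments.
Context d {Om : measurableType d} {R : realType} (P : probability Om R).

Lemma sqr_le_expR (x : R) : 0 <= x -> x ^+ 2 <= 2 * expR x.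
Proof.
move=> x0; have := expR_ge1Dxn 1 x0; rewrite (_ : 2`! = 2)%N// => h.
have : x ^+ 2 / 2%:R <= expR x by apply: le_trans h; rewrite lerDr.
by rewrite ler_pdivrMr// mulrC.
Qed.

(** The function f need not be nonnegative nor integrable. *)
Lemma integral_le_cst (D : set Om) (f : Om -> \bar R) (c : R) : measurable D -> 0 <= c ->
  measurable_fun D f -> {ae P, forall o, D o -> (f o <= c%:E)%E} ->
  (\int[P]_(o in D) f o <= c%:E * P D)%E.
Proof.
move=> mD c0 mf fc; rewrite integralE.
apply: (@le_trans _ _ (\int[P]_(o in D) (f^\+ o))%E).
  by rewrite geeDl// oppe_le0 integral_ge0.
rewrite -integral_cst//.
apply: ae_ge0_le_integral => //.
- exact: measurable_funepos.
- have FP := ae_filter_ringOfSetsType P; move: fc; apply: filterS => o fc Do.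
  by rewrite funeposE ge_max fc//= lee_fin.
Qed.

Lemma cexp_ae_le_integral d' (S : measurableType d') (W : Om -> S) (V : Om -> \bar R) (c : R) :
  measurable_fun setT W -> (forall o, 0 <= V o)%E -> 0 <= c -> cexp_ae_le P W V c ->
  measurable_fun setT V /\ (\int[P]_o V o <= c%:E)%E.
Proof.
move=> mW V0 c0 [w [mV _ mw HB] wc]; split => //.
have := HB setT measurableT; rewrite preimage_setT => <-.
have -> : c%:E = (c%:E * P setT)%E by rewrite probability_setT mule1.
apply: integral_le_cst => //; first exact: measurableT_comp.
by have FP := ae_filter_ringOfSetsType P; move: wc; apply: filterS => o wc _.
Qed.

Context d' (S : measurableType d') (W : Om -> S) (V : Om -> \bar R) (C0 C1 : R).
Hypothesis mW : measurable_fun setT W.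
Hypothesis V0 : forall o, (0 <= V o)%E.
Hypothesis C0_gt0 : 0 < C0.
Hypothesis C1_gt0 : 0 < C1.
Hypothesis VC1 : cexp_ae_le P W (fun o => expeR ((C0^-1)%:E * V o)%E) C1.

Let expV := cexp_ae_le_integral mW (fun o => expeR_ge0 _) (ltW C1_gt0) VC1.

(** A variable with a bounded conditional exponential moment is finite almost
surely. *)
Lemma exp_moment_fin : {ae P, forall o, (V o < +oo)%E}.
Proof.
have [mE EC1] := expV.
have : P.-integrable setT (fun o => expeR ((C0^-1)%:E * V o)%E).
  apply/integrableP; split => //.
  under eq_integral do rewrite gee0_abs ?expeR_ge0//.
  exact: le_lt_trans EC1 (ltry _).
move=> /(integrable_ae measurableT).
have FP := ae_filter_ringOfSetsType P; apply: filterS => o /(_ Logic.I).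
have := V0 o; case: (V o) => [r|_|//]; first by rewrite ltry.
by rewrite gt0_muley ?lte_fin ?invr_gt0.
Qed.

(** A variable with a bounded conditional exponential moment is square
integrable. *)
Lemma exp_moment_sqr (f : Om -> R) : measurable_fun setT f ->
  (forall o, (`|f o|)%:E <= V o)%E -> Pint P (fun o => f o ^+ 2).
Proof.
move=> mf fV; have [mE EC1] := expV.
apply/integrableP; split; first by apply/measurable_EFinP; exact: measurable_funX.
pose K := 2 * C0 ^+ 2.
have K0 : 0 <= K by rewrite mulr_ge0// sqr_ge0.
apply: (@le_lt_trans _ _ (\int[P]_o (K%:E * expeR ((C0^-1)%:E * V o)))%E); last first.
  rewrite ge0_integralZl//; last by move=> o _; exact: expeR_ge0.
  apply: (@le_lt_trans _ _ (K%:E * C1%:E)%E); last by rewrite -EFinM ltry.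
  by rewrite lee_wpmul2l// lee_fin.
apply: ge0_le_integral => //.
- by apply: measurableT_comp => //; apply/measurable_EFinP; exact: measurable_funX.
- exact: measurable_funeM.
move=> o _ /=; rewrite ger0_norm ?sqr_ge0//.
apply: (@le_trans _ _ (K%:E * expeR ((C0^-1)%:E * (`|f o|)%:E))%E); last first.
  rewrite lee_wpmul2l ?lee_fin// lee_expeR lee_wpmul2l// lee_fin invr_ge0; exact: ltW.
rewrite [leRHS](_ : _ = (K * expR (C0^-1 * `|f o|))%:E)// lee_fin.
have x0 : 0 <= C0^-1 * `|f o| by rewrite mulr_ge0// invr_ge0 ltW.
have := sqr_le_expR x0; rewrite exprMn exprVn real_normK ?num_real// => h.
have C20 : 0 < C0 ^+ 2 by rewrite exprn_gt0.
rewrite -(@ler_pM2l _ (C0 ^+ 2)) // in h.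
move: h; rewrite mulrA divff ?gt_eqF// mul1r => h; apply: le_trans h _.
by rewrite /K; rewrite mulrA [C0 ^+ 2 * 2]mulrC.
Qed.

End exponential_moments.

Section likelihood_weights.
Context d {Om : measurableType d} {R : realType} (P : probability Om R) {p : nat}.
Context (T : {RV P >-> obs R p}) (Ts : nat -> {RV P >-> obs R p}).
Context (Ycal : set R) (ell : R -> R -> R) (f0 : par R p) (lo hi : R) (I : cov R p -> R).
Hypothesis mY : measurable Ycal.
Hypothesis mell : forall a, measurable_fun Ycal (fun y => ell y a).
Hypothesis T_range : forall o, Ycal (T o).1 /\ Ucal (T o).2.
Hypothesis cf0 : contI f0.2.
Hypothesis ell_der : forall y a k, Ycal y -> (k < 3)%N -> derivable (derive1n k (ell y)) a 1.
Hypothesis ell_cont : forall y, Ycal y -> continuous (derive1n 3 (ell y)).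
Hypothesis f0_in : forall u, Ucal u -> lo < ev f0 u < hi.

Let D : set (obs R p) := Ycal `*` setT.

Let mD : measurable D. Proof. exact: measurableX. Qed.

Let mU : measurable_fun setT (fun o => (T o).2).
Proof. exact: (measurable_U T). Qed.

Let lohi : lo < hi.
Proof. by have /andP[] := f0_in (@clampU_in _ _ point); exact: lt_trans. Qed.

Lemma measurable_derive1n k a : (k <= 3)%N -> measurable_fun Ycal (fun y => derive1n k (ell y) a).
Proof.
elim: k a => [|k ih] a k3; first exact: mell.
apply: (measurable_derive1 (psi := fun y => derive1n k (ell y))) => //.
  by move=> b; apply: ih; exact: ltnW.
by move=> y Yy; exact: ell_der.
Qed.

(** The second derivative of the criterion at f_0, as a function of the
observation.  Its value is 0 where y is not in Ycal. *)
Definition om_second : obs R p -> R :=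
  (fun t => derive1n 2 (ell t.1) (ev f0 (clampU t.2))) \_ D.

Lemma om_secondE t : Ycal t.1 -> Ucal t.2 -> om_second t = derive1n 2 (ell t.1) (ev f0 t.2).
Proof. by move=> Yt Ut; rewrite /om_second patchE mem_set ?clampU_id. Qed.

Lemma measurable_om_second : measurable_fun setT om_second.
Proof.
apply/(measurable_restrictT _ mD).
have H := @measurable_caratheodory _ _ mY _ (cov R p) (fun y => derive1n 2 (ell y))
  (fun u => ev f0 (clampU u)) lo.
apply: H.
- by move=> a; exact: measurable_derive1n.
- move=> y Yy a; apply: differentiable_continuous; apply/derivable1_diffP.
  exact: ell_der.
- exact: measurable_ev_clampU.
- by move=> u; have /andP[/ltW] := f0_in (clampU_in u).
Qed.

(** The supremum L(y) of the absolute third derivative of the criterion on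
]lo, hi[, as a function of the observation.  Its value is 0 where the supremum
is infinite, which happens with probability 0, and where y is not in Ycal. *)
Definition om_third : obs R p -> R := (fun t => fine (supabs_deriv ell lo hi 3 t.1)) \_ D.

Lemma om_thirdE t : Ycal t.1 -> om_third t = fine (supabs_deriv ell lo hi 3 t.1).
Proof. by move=> Yt; rewrite /om_third patchE mem_set. Qed.

Lemma supabs_deriv_ge0 k y : (0 <= supabs_deriv ell lo hi k y)%E.
Proof.
have h : lo < (lo + hi) / 2 < hi by rewrite !(midf_lt lohi).
apply: (@le_trans _ _ (`|derive1n k (ell y) ((lo + hi) / 2)|)%:E); first by rewrite lee_fin.
by apply: ereal_sup_ubound; exists ((lo + hi) / 2) => //=; rewrite in_itv.
Qed.

Lemma measurable_supabs3 : measurable_fun Ycal (supabs_deriv ell lo hi 3).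
Proof.
apply: (eq_measurable_fun (fun y => esups (fun n => (`|derive1n 3 (ell y) (rational_pts lo hi n)|)%:E) 0%N)).
  move=> y; rewrite inE => Yy; apply/esym; exact: (ereal_sup_rational lohi (ell_cont Yy)).
apply: measurable_fun_esups => n; apply/measurable_EFinP.
by apply: measurableT_comp => //; exact: measurable_derive1n.
Qed.

Let measurable_supabs3_fst : measurable_fun D (fun t => supabs_deriv ell lo hi 3 t.1).
Proof.
apply: (measurable_comp _ _ measurable_supabs3) => //.
  by move=> _ [t [/= Yt _]] <-.
exact: measurable_funTS.
Qed.

Lemma measurable_om_third : measurable_fun setT om_third.
Proof.
apply/(measurable_restrictT _ mD).
by apply: (measurableT_comp _ measurable_supabs3_fst).
Qed.

Context (C0 C1 : R).
Hypothesis C0_gt0 : 0 < C0.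
Hypothesis C1_gt0 : 0 < C1.
Hypothesis mom2 : cexp_ae_le P (fun o => (T o).2)
  (fun o => expeR ((C0^-1)%:E * supabs_deriv ell lo hi 2 (T o).1)%E) C1.
Hypothesis mom3 : cexp_ae_le P (fun o => (T o).2)
  (fun o => expeR ((C0^-1)%:E * supabs_deriv ell lo hi 3 (T o).1)%E) C1.

Lemma om_second_sqr : Pint P (fun o => om_second (T o) ^+ 2).
Proof.
have H := exp_moment_sqr mU C0_gt0 C1_gt0 mom2
  (measurableT_comp measurable_om_second (measurable_funP T)).
apply: H.
move=> o; have [Yo Uo] := T_range o; rewrite /= om_secondE//.
apply: ereal_sup_ubound; exists (ev f0 (T o).2) => //=.
by rewrite in_itv/= f0_in.
Qed.

Lemma om_third_sqr : Pint P (fun o => om_third (T o) ^+ 2).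
Proof.
have H := exp_moment_sqr mU C0_gt0 C1_gt0 mom3
  (measurableT_comp measurable_om_third (measurable_funP T)).
apply: H.
move=> o; have [Yo Uo] := T_range o; rewrite /= om_thirdE//.
have := supabs_deriv_ge0 3 (T o).1; case: (supabs_deriv _ _ _ _ _) => [r|_|//].
  by rewrite lee_fin => r0; rewrite ger0_norm.
by rewrite leey.
Qed.

Lemma supabs3_fin : {ae P, forall o, (supabs_deriv ell lo hi 3 (T o).1 < +oo)%E}.
Proof.
apply: (exp_moment_fin mU _ C0_gt0 C1_gt0 mom3) => o; exact: supabs_deriv_ge0.
Qed.

Hypothesis iid : iid_copies P T Ts.
Hypothesis Ts_range : forall i o, Ycal (Ts i o).1 /\ Ucal (Ts i o).2.

(** The finiteness of L(Y) is transferred to the sample through the equality of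
the laws. *)
Lemma sample_supabs3_fin :
  {ae P, forall o, forall i, (supabs_deriv ell lo hi 3 (Ts i o).1 < +oo)%E}.
Proof.
(* the observations with L = +oo *)
pose N : set (obs R p) := D `&` [set t | supabs_deriv ell lo hi 3 t.1 = +oo%E].
have mN : measurable N.
  by have := measurable_supabs3_fst mD (emeasurable_set1 +oo%E); congr measurable.
have TN0 : P (T @^-1` N) = 0.
  have mTN : measurable (T @^-1` N).
    by rewrite -[X in measurable X]setTI; exact: measurable_funP.
  apply/negligibleP => //; apply: negligibleS supabs3_fin => o [_ /= ->].
  by rewrite ltxx.
have : P.-negligible (\bigcup_i (Ts i @^-1` N)).
  apply: negligible_bigcup => i.
  have mTN : measurable (Ts i @^-1` N).
    by rewrite -[X in measurable X]setTI; exact: measurable_funP.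
  have PN : P (Ts i @^-1` N) = 0 by have [iidN _] := iid; rewrite (iidN i N mN).
  by exists (Ts i @^-1` N); split.
apply: negligibleS => o /= /existsNP[i /negP]; rewrite -leNgt leye_eq => /eqP h.
by exists i => //; split => //; split => //; exact: (Ts_range i o).1.
Qed.

Lemma om_third_bound o : (forall i, (supabs_deriv ell lo hi 3 (Ts i o).1 < +oo)%E) ->
  forall i a, lo < a < hi -> `|derive1n 3 (ell (Ts i o).1) a| <= om_third (Ts i o).
Proof.
move=> fin i a la; have [Yi _] := Ts_range i o; rewrite om_thirdE//.
rewrite -lee_fin fineK; last by rewrite ge0_fin_numE// supabs_deriv_ge0.
by apply: ereal_sup_ubound; exists a => //=; rewrite in_itv.
Qed.

Hypothesis TI : is_I P T ell f0 I.

Let bev (f1 f2 : par R p) : contI f1.2 -> contI f2.2 ->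
  measurable_fun setT (fun u : cov R p => ev f1 (clampU u) * ev f2 (clampU u))
  /\ exists K : R, forall u : cov R p, `|ev f1 (clampU u) * ev f2 (clampU u)| <= K.
Proof.
move=> c1 c2; split; first by apply: measurable_funM; exact: measurable_ev_clampU.
have [K1 k1] := ev_bounded c1; have [K2 k2] := ev_bounded c2.
exists (K1 * K2) => u; rewrite normrM ler_pM//; [apply: k1|apply: k2]; exact: clampU_in.
Qed.

(** By the definition of I as a conditional expectation. *)
Lemma EE_om_second f1 f2 : contI f1.2 -> contI f2.2 ->
  EE P (fun o => om_second (T o) * ev f1 (clampU (T o).2) * ev f2 (clampU (T o).2)) =
  - EI T I f1 f2.
Proof.
move=> c1 c2; have [mb [K bK]] := bev c1 c2.
have IO : Pint P (fun o => om_second (T o)) by exact: (Pint_omega measurable_om_second om_second_sqr).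
have cI : cexpR P (fun o => (T o).2) (fun o => om_second (T o)) (fun u => - I u).
  apply: is_cexp_cexpR => //; move: TI; rewrite /is_I; congr is_cexp.
  by apply/funext => o; have [Yo Uo] := T_range o; rewrite /= om_secondE.
have [_ II _ H] := cI; have := H _ _ mb bK.
rewrite (EE_ext P (_ : (fun o => _ * om_second (T o)) =1 fun o =>
  om_second (T o) * ev f1 (clampU (T o).2) * ev f2 (clampU (T o).2))); last by move=> o; ring.
move=> <-; rewrite -EEN.
  by apply: EE_ext => o; rewrite clampU_id; [ring|exact: (T_range o).2].
rewrite (_ : (fun o => _) = fun o => (- (ev f1 (clampU (T o).2) * ev f2 (clampU (T o).2))) * (- I (T o).2)).
  apply: (@Pint_mulb _ _ _ _ _ _ K) => //.
    by apply: measurable_funN; exact: (measurableT_comp mb mU).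
  by apply: aeW => o; rewrite normrN.
by apply/funext => o; rewrite clampU_id; [ring|exact: (T_range o).2].
Qed.

Context (L3 : cov R p -> \bar R).
Hypothesis L3_def : is_cexp P (fun o => (T o).2)
  (fun o => supabs_deriv ell lo hi 3 (T o).1) L3.
Local Notation Cell := (ereal_sup [set L3 u | u in Ucal]).

Let L3_le u : Ucal u -> (L3 u <= Cell)%E.
Proof. by move=> Uu; apply: ereal_sup_ubound; exists u. Qed.

(** L3 is only a version of the conditional expectation of a nonnegative variable;
its supremum is nonnegative because U takes its values in the unit cube. *)
Lemma Cell_ge0 : (0 <= Cell)%E.
Proof.
have [mV _ mL HL] := L3_def.
have := HL setT measurableT; rewrite preimage_setT => E.
have V0 : (0 <= \int[P]_o L3 (T o).2)%E.
  by rewrite E; apply: integral_ge0 => o _; exact: supabs_deriv_ge0.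
rewrite leNgt; apply/negP => C0'.
have [c [c0 cC]] : exists c : R, c < 0 /\ (Cell <= c%:E)%E.
  case: (Cell) C0' => [r|//|_]; first by rewrite lte_fin; exists r.
  by exists (-1); split; [rewrite oppr_lt0 ltr01|exact: leNye].
have : (\int[P]_o (cst (- c)%:E) o <= \int[P]_o (- L3 (T o).2))%E.
  apply: ge0_le_integral => //.
  - by move=> o _; rewrite lee_fin oppr_ge0 ltW.
  - by apply: measurableT_comp => //; exact: measurableT_comp.
  - by move=> o _; rewrite EFinN leeN2 (le_trans _ cC)// L3_le//; exact: (T_range o).2.
rewrite integral_cst//= probability_setT mule1.
have N0 o : [set: Om] o -> (0 <= - L3 (T o).2)%E.
  move=> _; rewrite oppe_ge0 (le_trans (L3_le (T_range o).2))// (le_trans cC)//.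
  by rewrite lee_fin ltW.
have : (\int[P]_o (- - L3 (T o).2) = - \int[P]_o (- L3 (T o).2))%E.
  by rewrite integral_ge0N.
under eq_integral do rewrite oppeK.
move=> EN h; have : (\int[P]_o L3 (T o).2 <= c%:E)%E.
  by rewrite EN leeNl -EFinN.
move=> /(le_trans V0); rewrite lee_fin => c0'.
by move: c0; rewrite ltNge c0'.
Qed.

(** By the definition of C_ell as a bound of the conditional expectation of L. *)
Lemma EE_om_third c f : Cell = c%:E -> contI f.2 ->
  EE P (fun o => om_third (T o) * ev f (clampU (T o).2) * ev f (clampU (T o).2)) <=
  c * EE P (fun o => ev f (T o).2 * ev f (T o).2).
Proof.
move=> Cc cf; have [mb [K bK]] := bev cf cf.
have [mV _ mL HL] := L3_def.
have IO : Pint P (fun o => om_third (T o)) by exact: (Pint_omega measurable_om_third om_third_sqr).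
have Ic : Pint P (fun o => om_third (T o) - c) by apply: PintB => //; exact: Pint_cst.
have FP := ae_filter_ringOfSetsType P.
have omV : {ae P, forall o, supabs_deriv ell lo hi 3 (T o).1 = (om_third (T o))%:E}.
  move: supabs3_fin; apply: filterS => o oo; rewrite om_thirdE; last exact: (T_range o).1.
  by rewrite fineK// ge0_fin_numE// supabs_deriv_ge0.
have H : EE P (fun o => (fun u => ev f (clampU u) * ev f (clampU u)) (T o).2 * (om_third (T o) - c)) <= 0.
  have H0 := @cexp_le0 _ _ _ P _ _ (fun o => (T o).2) mU (fun o => om_third (T o) - c)
    (fun u => ev f (clampU u) * ev f (clampU u)) K Ic.
  apply: H0 => //; last first.
    move=> u; rewrite -{1}expr2 sqr_ge0/=.
    by apply: le_trans (bK u); exact: ler_norm.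
  move=> B mB; have mWB : measurable ((fun o => (T o).2) @^-1` B).
    by rewrite -[X in measurable X]setTI; exact: mU.
  have PB0 : (0 <= P ((fun o => (T o).2) @^-1` B))%E by [].
  have Iom : P.-integrable ((fun o => (T o).2) @^-1` B) (EFin \o (fun o => om_third (T o))).
    exact: integrableS IO.
  rewrite RintegralB//; last exact: integrableS (Pint_cst P c).
  rewrite subr_le0 Rintegral_cst//.
  have : (\int[P]_(o in (fun o => (T o).2) @^-1` B) (om_third (T o))%:E <=
      c%:E * P ((fun o => (T o).2) @^-1` B))%E.
    rewrite (_ : (\int[P]_(o in _) (om_third (T o))%:E =
        \int[P]_(o in (fun o => (T o).2) @^-1` B) supabs_deriv ell lo hi 3 (T o).1)%E); last first.
      apply: ae_eq_integral => //.
      - exact: measurable_int Iom.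
      - exact: measurable_funTS.
      - by move: omV; apply: filterS => o ->.
    rewrite -HL//; apply: integral_le_cst => //.
    - by rewrite -lee_fin -Cc Cell_ge0.
    - by apply: measurable_funTS; exact: measurableT_comp.
    - by apply: aeW => o _; rewrite -Cc; apply: L3_le; exact: (T_range o).2.
  move=> h; rewrite -lee_fin /Rintegral fineK; last exact: integral_fune_fin_num.
  by rewrite EFinM fineK// fin_num_measure.
have bU : {ae P, forall o, `|ev f (T o).2 * ev f (T o).2| <= K}.
  by apply: aeW => o; have := bK (T o).2; rewrite clampU_id//; exact: (T_range o).2.
have mbU : measurable_fun setT (fun o => ev f (T o).2 * ev f (T o).2).
  have := measurableT_comp mb mU; congr measurable_fun; apply/funext => o /=.
  by rewrite clampU_id//; exact: (T_range o).2.
have Ib : Pint P (fun o => ev f (T o).2 * ev f (T o).2) by exact: (Pint_bounded mbU bU).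
have H1 := Pint_mulb Ic (measurableT_comp mb mU) (aeW _ (fun o => bK (T o).2)).
have E1 := EED H1 (PintZ c Ib).
rewrite -EEZ// -[leRHS]add0r.
rewrite (EE_ext P (_ : _ =1 fun o => (ev f (clampU (T o).2) * ev f (clampU (T o).2)) * (om_third (T o) - c)
  + c * (ev f (T o).2 * ev f (T o).2))).
  by rewrite E1 lerD2r.
by move=> o; rewrite clampU_id; [ring|exact: (T_range o).2].
Qed.

End likelihood_weights.

(** * Range of f_0, density of Z, weights and rates *)

Section range_gap.
Context {R : realType} {p : nat}.
Implicit Types (u : cov R p) (f : par R p).

(** The maximum is reached where x is a vertex of the cube and z a maximum of g. *)
Lemma ev_max f : contI f.2 -> exists2 u, Ucal u & forall v, Ucal v -> ev f v <= ev f u.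
Proof.
move=> cf; have cgw : {within `[0, 1], continuous (f.2 \o clamp01)}.
  exact: continuous_subspaceT.
have [z z01 zmax] := EVT_max ler01 cgw; rewrite in_itv/= in z01.
exists ([tuple (0 < f.1 0 k)%R%:R | k < p], z) => [|v [v1 v2]].
  by split => // k; rewrite tnth_mktuple; case: (_ < _); rewrite ?lexx ler01.
apply: lerD; last first.
  have := zmax v.2; rewrite in_itv/= => /(_ v2).
  by rewrite /= !clamp01_id.
apply: ler_sum => k _; rewrite tnth_mktuple.
have /andP[x0 x1] := v1 k; have [t0|t0] := ltP 0 (f.1 0 k).
  by rewrite mul1r ler_piMl// ltW.
by rewrite mul0r mulr_ge0_le0.
Qed.

(** The values of f on the cube stay at a positive distance from lo and hi. *)
Lemma ev_gap f lo hi : contI f.2 -> (forall u, Ucal u -> lo < ev f u < hi) ->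
  exists2 g, 0 < g & forall u, Ucal u -> lo + g < ev f u < hi - g.
Proof.
move=> cf fin; have [u Uu umax] := ev_max cf.
have cN : contI (- f).2.
  have := @contI_lin _ (-1) _ _ cf (@contI0 R); congr contI.
  by apply/funext => z; rewrite addr0 mulN1r.
have [v Uv vmin] := ev_max cN.
have evN w : ev (- f) w = - ev f w.
  have := evE_lin (-1) f 0 w; rewrite scaleN1r addr0 mulN1r => ->.
  have := evE_lin (-1) f f w; rewrite scaleN1r addNr => ->.
  by rewrite mulN1r addNr addr0.
have /andP[_ u2] := fin u Uu; have /andP[v1 _] := fin v Uv.
exists (Num.min ((hi - ev f u) / 2) ((ev f v - lo) / 2)).
  by rewrite lt_min; apply/andP; split; rewrite divr_gt0// subr_gt0.
move=> w Uw; have := umax w Uw; have := vmin w Uw; rewrite !evN lerN2 => h1 h2.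
set g := Num.min _ _; have g1 : g <= (hi - ev f u) / 2 by rewrite ge_min lexx.
have g2 : g <= (ev f v - lo) / 2 by rewrite ge_min lexx orbT.
by apply/andP; split; lra.
Qed.

End range_gap.

Section density.
Context d {Om : measurableType d} {R : realType} (P : probability Om R) {p : nat}.
Context (T : Om -> obs R p).

Lemma Z_has_density_lower : Z_has_density P T -> exists2 c : R, 0 < c &
  forall a b : R, 0 <= a -> a < b -> b <= 1 ->
    ((c * (b - a))%:E <= P ((fun o => (T o).2.2) @^-1` `[a, b]%classic))%E.
Proof.
move=> [dens [c [C [mdens c0 dc PZ]]]]; exists c => // a b a0 ab b1.
rewrite PZ//.
have -> : `[a, b]%classic `&` `[0%R, 1%R]%classic = `[a, b]%classic :> set (measurableTypeR R).
  apply/setIidl => x; rewrite /= !in_itv/= => /andP[ax xb].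
  by rewrite (le_trans a0 ax) (le_trans xb b1).
apply: (@le_trans _ _ (\int[lebesgue_measure]_(z in `[a, b]) c%:E)%E).
  rewrite integral_cst//= lebesgue_measure_itv/= lte_fin ab.
  by rewrite EFinM EFinB.
apply: ge0_le_integral => //.
- by move=> z _; rewrite lee_fin ltW.
- by apply/measurable_EFinP; exact: measurable_funTS.
move=> z; rewrite /= in_itv/= => /andP[az zb]; rewrite lee_fin.
have /dc/andP[] // : 0 <= z <= 1 by rewrite (le_trans a0 az) (le_trans zb b1).
Qed.

End density.

Section weights.
Context {R : realType}.

(** Telescoping comparison with the integral of (1 + h x)^-2. *)
Lemma sum_inv_sqr (h : R) N : 0 < h ->
  \sum_(nu < N.+1) ((1 + h * nu%:R) ^+ 2)^-1 <= 1 + h^-1 * (1 - (1 + h * N%:R)^-1).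
Proof.
move=> h0; elim: N => [|N ih].
  by rewrite big_ord_recr big_ord0/= mulr0 addr0 expr1n invr1 subrr mulr0 add0r addr0.
rewrite big_ord_recr/=; apply: (le_trans (lerD ih (lexx _))).
set a := 1 + h * N%:R; set b := 1 + h * N.+1%:R.
have ba : b = a + h by rewrite /a /b -natr1; ring.
have a0 : 0 < a by rewrite ltr_pwDl// mulr_ge0// ltW.
have b0 : 0 < b by rewrite ba addr_gt0.
have : (b ^+ 2)^-1 <= h^-1 * (a^-1 - b^-1).
  rewrite (_ : a^-1 - b^-1 = h * (a * b)^-1); last first.
    by rewrite [h in RHS](_ : h = b - a); [field; rewrite !gt_eqF|rewrite ba; ring].
  rewrite mulKf ?gt_eqF// lef_pV2 ?posrE ?mulr_gt0 ?exprn_gt0//.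
  by rewrite expr2 ler_pM2r// ba lerDl ltW.
rewrite !mulrBr mulr1; move: (h^-1 * a^-1) (h^-1 * b^-1) (h^-1) => u v w; lra.
Qed.

Lemma sqr_le_power (y : R) m : (0 < m)%N -> 0 <= y -> (1 + y) ^+ 2 <= 4 * (1 + y ^+ (2 * m)).
Proof.
move=> m0 y0; apply: (@le_trans _ _ (2 * (1 + y ^+ 2))).
  have := sqr_ge0 (1 - y); rewrite sqrrB sqrrD; lra.
have [y1|y1] := leP y 1.
  have : y ^+ 2 <= 1 by rewrite exprn_ile1.
  have : 0 <= y ^+ (2 * m) by exact: exprn_ge0.
  lra.
have : y ^+ 2 <= y ^+ (2 * m) by rewrite ler_eXn2l// leq_pmulr.
have : 0 <= y ^+ (2 * m) by exact: exprn_ge0.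
lra.
Qed.

(** For large nu, gamma_nu is at least a constant times nu^(2m), so that the
weights 1 + h^(2m) gamma_nu are at least a constant times (1 + h nu)^2. *)
Lemma weight_sum (gam : nat -> R) (m : nat) (c : R) : (0 < m)%N -> (forall nu, 0 <= gam nu) ->
  0 < c -> (gam nu / nu%:R ^+ (2 * m))%R @[nu --> \oo] --> c ->
  exists2 Cw : R, 0 < Cw & forall h : R, 0 < h <= 1 -> forall N,
    \sum_(nu < N) (1 + h ^+ (2 * m) * gam nu)^-1 <= Cw / h.
Proof.
move=> m0 g0 c0 /cvgrPdist_le/(_ (c / 2) (divr_gt0 c0 (ltr0n R 2)))[N0 _ HN].
pose c' := Num.min 1 (c / 2).
have c'0 : 0 < c' by rewrite lt_min ltr01 divr_gt0.
have c'1 : c' <= 1 by rewrite ge_min lexx.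
(* from N1 on, gamma_nu >= c' nu^(2m) *)
pose N1 := maxn N0 1.
exists (N1%:R + 8 / c'); first by rewrite ltr_wpDl// divr_gt0.
move=> h /andP[h0 h1] N.
have lam0 : 0 <= h ^+ (2 * m) by rewrite exprn_ge0// ltW.
have w1 nu : 1 <= 1 + h ^+ (2 * m) * gam nu by rewrite lerDl mulr_ge0.
have wle nu : (N1 <= nu)%N ->
    (1 + h ^+ (2 * m) * gam nu)^-1 <= 4 / c' * ((1 + h * nu%:R) ^+ 2)^-1.
  rewrite geq_max => /andP[N0nu nu1]; have nu0 : 0 < nu%:R :> R by rewrite ltr0n.
  have q0 : 0 < nu%:R ^+ (2 * m) :> R by rewrite exprn_gt0.
  have := HN nu N0nu; rewrite /= ler_norml => /andP[_].
  rewrite lerBlDl -lerBlDr => hg.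
  have {}hg : c' * nu%:R ^+ (2 * m) <= gam nu.
    rewrite -ler_pdivlMr//; apply: le_trans hg; rewrite ge_min; apply/orP; right; lra.
  have s0 : 0 < (1 + h * nu%:R) ^+ 2 by rewrite exprn_gt0// ltr_pwDl// mulr_ge0// ltW.
  rewrite -[4 / c']invrK -invfM lef_pV2 ?posrE; last 2 first.
    by rewrite (lt_le_trans _ (w1 _)).
    by rewrite mulr_gt0// invr_gt0 divr_gt0.
  rewrite invf_div mulrAC ler_pdivrMr//.
  apply: (@le_trans _ _ (c' * (4 * (1 + (h * nu%:R) ^+ (2 * m))))).
    by rewrite ler_wpM2l ?(ltW c'0)//; apply: sqr_le_power => //; rewrite mulr_ge0// ltW.
  rewrite exprMn mulrCA [leRHS]mulrC ler_wpM2l// mulrDr mulr1 lerD//.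
  by rewrite mulrCA ler_wpM2l.
have t0 nu : 0 <= ((1 + h * nu%:R) ^+ 2)^-1 by rewrite invr_ge0 sqr_ge0.
apply: (@le_trans _ _ (\sum_(nu < N) ((nu < N1)%N%:R + 4 / c' * ((1 + h * nu%:R) ^+ 2)^-1))).
  apply: ler_sum => nu _; have [nuN|/wle//] := ltnP nu N1; last by rewrite add0r.
  by rewrite (@le_trans _ _ 1) ?invf_le1 ?(lt_le_trans _ (w1 _))// lerDl mulr_ge0// divr_ge0// ltW.
rewrite big_split/= -mulr_sumr [leRHS]mulrDl; apply: lerD.
  have E M : \sum_(nu < M) (nu < N1)%N%:R = (minn M N1)%:R :> R.
    elim: M => [|M ih]; first by rewrite big_ord0 min0n.
    by rewrite big_ord_recr/= ih -natrD; congr _%:R; case: ltnP => ?; lia.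
  apply: (@le_trans _ _ N1%:R); last by rewrite ler_pdivlMr// ler_piMr.
  by rewrite E ler_nat geq_minr.
have h11 : 1 <= h^-1 by rewrite invf_ge1.
have S2 : \sum_(nu < N) ((1 + h * nu%:R) ^+ 2)^-1 <= 2 * h^-1.
  case: N => [|N]; first by rewrite big_ord0 mulr_ge0// invr_ge0 ltW.
  apply: (le_trans (sum_inv_sqr N h0)); rewrite [2]mulr2n mulrDl mul1r lerD//.
  by rewrite ler_piMr ?invr_ge0 ?(ltW h0)// gerBl invr_ge0 addr_ge0// mulr_ge0// ltW.
apply: (@le_trans _ _ (4 / c' * (2 * h^-1))).
  by rewrite ler_wpM2l// divr_ge0// ltW.
by rewrite (_ : 4 / c' * (2 * h^-1) = 8 / c' / h)//; field; rewrite gt_eqF//= gt_eqF.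
Qed.

End weights.

Section rates.
Context {R : realType}.

Lemma bandwidthK m (lam : R) : (0 < m)%N -> 0 <= lam -> bandwidth m lam ^+ (2 * m) = lam.
Proof.
move=> m0 l0; rewrite /bandwidth -powR_mulrn ?powR_ge0// -powRrM mulVf ?powRr1//.
by rewrite pnatr_eq0 -lt0n muln_gt0 m0.
Qed.

Lemma sqr_half (x : R) : 0 < x -> (x `^ (- 2^-1)) ^+ 2 = x^-1.
Proof.
move=> x0; rewrite -powR_mulrn ?powR_ge0// -powRrM mulNr mulVf ?pnatr_eq0//.
by rewrite powR_inv1// ltW.
Qed.

Lemma rate_sqr_le m n (h : R) : 0 < h -> (0 < n)%N ->
  rate m n h ^+ 2 <= 2 * ((n%:R * h)^-1 + h ^+ (2 * m)).
Proof.
move=> h0 n0; rewrite /rate; have nh0 : 0 < n%:R * h by rewrite mulr_gt0// ltr0n.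
rewrite -(sqr_half nh0) [(2 * m)%N]mulnC exprM.
move: (_ `^ _) (h ^+ m) => a b; have := sqr_ge0 (a - b); rewrite sqrrB sqrrD; lra.
Qed.

Lemma inv_le_powR m (h : R) : (0 < m)%N -> 0 < h <= 1 ->
  h^-1 <= h `^ (- ((6 * m)%:R - 1) / (4 * m)%:R).
Proof.
move=> m0 /andP[h0 h1]; rewrite -powR_inv1; last exact: ltW.
apply: ger_powR; first by rewrite h0.
have m40 : 0 < (4 * m)%:R :> R by rewrite ltr0n muln_gt0.
rewrite ler_pdivrMr// mulN1r lerN2 lerBrDr natr1 ler_nat; lia.
Qed.

(** The product of h^(-1/2) and the rate is (n h^2)^(-1/2) + h^(m - 1/2). *)
Lemma rate_small m (e : R) n (h : R) : (0 < m)%N -> (0 < n)%N -> 0 < e -> 0 < h <= 1 ->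
  4 / e ^+ 2 <= n%:R * h ^+ 2 -> h <= (e / 2) ^+ 2 ->
  h `^ (- 2^-1) * rate m n h <= e.
Proof.
move=> m0 n0 e0 /andP[h0 h1] nh hs; have n0' : 0 < n%:R :> R by rewrite ltr0n.
rewrite /rate mulrDr (splitr e); apply: lerD.
  rewrite -powRM ?(ltW h0)//; last by rewrite mulr_ge0// ltW.
  rewrite -(@ler_pXn2r _ 2) ?nnegrE ?powR_ge0 ?divr_ge0 ?(ltW e0)//.
  rewrite sqr_half; last by rewrite !mulr_gt0.
  rewrite mulrCA -expr2 expr_div_n.
  rewrite -[leRHS]invrK lef_pV2 ?posrE; last 2 first.
    by rewrite mulr_gt0// exprn_gt0.
    by rewrite invr_gt0 divr_gt0// exprn_gt0.
  by rewrite invf_div -natrX.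
rewrite -(prednK m0) exprS mulrA.
have sh : h `^ (- 2^-1) * h = Num.sqrt h.
  rewrite -powR12_sqrt ?(ltW h0)// -{2}(powRr1 (ltW h0)) -powRD; last by rewrite (gt_eqF h0) implybT.
  by congr (_ `^ _); lra.
rewrite sh; apply: (@le_trans _ _ (Num.sqrt h)).
  by rewrite ler_piMr ?sqrtr_ge0// exprn_ile1// ltW.
rewrite -(@ler_pXn2r _ 2) ?nnegrE ?sqrtr_ge0 ?divr_ge0 ?(ltW e0)//.
by rewrite sqr_sqrtr// ltW.
Qed.

End rates.

(** * Rates in probability *)

Section outer_probability.
Context d {Om : measurableType d} {R : realType} (P : probability Om R).
Local Open Scope ereal_scope.

(** Subadditivity of the outer probability. *)
Lemma mu_ext_union_le (X A B1 B2 N : set Om) (a b1 b2 : \bar R) :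
  X `<=` A `|` B1 `|` B2 `|` N -> measurable B1 -> measurable B2 -> P.-negligible N ->
  mu_ext P A <= a -> P B1 <= b1 -> P B2 <= b2 -> mu_ext P X <= a + b1 + b2.
Proof.
move=> XA mB1 mB2 [N' [mN' N'0 NN']] Aa B1b B2b.
have -> : a + b1 + b2 = a + b1 + b2 + P N' by rewrite N'0 adde0.
have le A' B' (a' b' : \bar R) : mu_ext P A' <= a' -> mu_ext P B' <= b' ->
    mu_ext P (A' `|` B') <= a' + b'.
  by move=> h1 h2; apply: (le_trans (outer_measureU2 (mu_ext P) A' B')); exact: leeD.
apply: (@le_trans _ _ (mu_ext P (A `|` B1 `|` B2 `|` N'))).
  apply: le_mu_ext; apply: subset_trans XA _; exact: setUS.
have E D : measurable D -> mu_ext P D = P D by exact: measurable_mu_extE.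
have h1 : mu_ext P B1 <= b1 by rewrite E.
have h2 : mu_ext P B2 <= b2 by rewrite E.
have h3 : mu_ext P N' <= P N' by rewrite E.
refine (le _ _ _ _ (le _ _ _ _ (le _ _ _ _ Aa h1) h2) h3).
Qed.

End outer_probability.

Section empirical_rate.
Context d {Om : measurableType d} {R : realType} (P : probability Om R).
Context {p : nat} (T : {RV P >-> obs R p}) (Ts : nat -> {RV P >-> obs R p}).
Context (I : cov R p -> R) (per : bool) (m : nat).
Hypothesis m_gt0 : (0 < m)%N.
Hypothesis TU : forall o, Ucal (T o).2.
Hypothesis mI : measurable_fun setT I.
Context (C2 : R).
Hypothesis C2_gt0 : 0 < C2.
Hypothesis IC2 : {ae P, forall o, C2^-1 <= I (T o).2 <= C2}.
Context (B : R -> R).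
Hypothesis cB : cexpR P (fun o => (T o).2.2) (fun o => I (T o).2) B.
Context (cz : R).
Hypothesis cz_gt0 : 0 < cz.
Hypothesis Z_lower : forall a b : R, 0 <= a -> a < b -> b <= 1 ->
  ((cz * (b - a))%:E <= P ((fun o => (T o).2.2) @^-1` `[a, b]%classic))%E.
Context (hb : nat -> R -> R) (gam : nat -> R) (Ch Cw : R).
Hypothesis hbH : forall nu, Hm per m (hb nu).
Hypothesis hb_le : forall nu z, 0 <= z <= 1 -> `|hb nu z| <= Ch.
Hypothesis hbV : forall mu nu, Vform P T B (hb mu) (hb nu) = (mu == nu)%:R.
Hypothesis hbJ : forall mu nu, J m (hb mu) (hb nu) = gam mu * (mu == nu)%:R.
Hypothesis Cw_gt0 : 0 < Cw.
Hypothesis wt_sum : forall h : R, 0 < h <= 1 -> forall N,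
    \sum_(nu < N) (1 + h ^+ (2 * m) * gam nu)^-1 <= Cw / h.
Context (Ct Cg : R).
Hypothesis Ct0 : 0 <= Ct.
Hypothesis Cg0 : 0 <= Cg.
Hypothesis thetaC : forall f : par R p, contI f.2 -> forall k, f.1 0 k ^+ 2 <= Ct * EI T I f f.
Hypothesis par0C : forall f : par R p, contI f.2 -> EI T I (par0 f.2) (par0 f.2) <= Cg * EI T I f f.
Hypothesis iid : iid_copies P T Ts.

(** The expansions in the functions h_nu converge in the norm for lambda = lam. *)
Definition basis_cvg lam := forall g, Hm per m g ->
  norm1 P T B lam m (fun z => g z - \sum_(nu < N) Vform P T B g (hb nu) * hb nu z)
    @[N --> \oo] --> (0 : R).

Let Ch0 : 0 <= Ch.
Proof. by apply: (le_trans _ (hb_le 0 (_ : 0 <= 0 <= 1))) => //; rewrite lexx ler01. Qed.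

(** The constant in the comparison of the sup norm with h^(-1/2) times the norm
of H. *)
Definition sup_const := p%:R * Num.sqrt Ct + Ch * Num.sqrt Cw * Num.sqrt (Cg + 1).

Lemma sup_const_ge0 : 0 <= sup_const.
Proof. by rewrite /sup_const addr_ge0 ?mulr_ge0 ?sqrtr_ge0. Qed.

(** [ev_le] when lambda = h^(2m), with the weights summing to at most Cw / h. *)
Lemma ev_le_rate lam h f u : 0 < h <= 1 -> lam = h ^+ (2 * m) -> basis_cvg lam ->
  Hpar per m f -> Ucal u -> `|ev f u| <= sup_const * h `^ (- 2^-1) * Hnorm P T I lam m f.
Proof.
move=> h01 lamE hcvg Hf Uu; have /andP[h0 h1] := h01.
have lam_ge0 : 0 <= lam by rewrite lamE exprn_ge0// ltW.
have ws N : \sum_(nu < N) (wt lam gam nu)^-1 <= Cw / h by rewrite /wt lamE; exact: wt_sum.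
apply: le_trans (ev_le m_gt0 TU mI C2_gt0 IC2 lam_ge0 cB cz_gt0 Z_lower hbH hb_le hbV hbJ hcvg ws
  Ct0 Cg0 thetaC par0C Hf Uu) _.
rewrite ler_wpM2r ?sqrtr_ge0// /sup_const [leRHS]mulrDl.
have hh : h `^ (- 2^-1) = Num.sqrt h^-1.
  by rewrite -(sqr_half h0) sqrtr_sqr ger0_norm// powR_ge0.
apply: lerD.
  rewrite ler_peMr ?mulr_ge0 ?sqrtr_ge0// hh -sqrtr1 ler_sqrt ?invr_ge0 ?(ltW h0)//.
  by rewrite invf_ge1.
by rewrite sqrtrM ?(ltW Cw_gt0)// hh le_eqVlt; apply/orP; left; apply/eqP; ring.
Qed.

Lemma EE_sqr_ev_le lam f : 0 <= lam -> Hpar per m f ->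
  EE P (fun o => ev f (T o).2 * ev f (T o).2) <= C2 * Hnorm P T I lam m f ^+ 2.
Proof.
move=> lam0 Hf; have cf := Hpar_contI m_gt0 Hf.
rewrite (Hnorm_sqr m_gt0 TU mI C2_gt0 IC2 lam0 Hf).
apply: (@le_trans _ _ (C2 * EI T I f f)); last first.
  by rewrite ler_wpM2l ?(ltW C2_gt0)//; exact: EI_le_inner.
have I2 := Pint_ev2 TU mI C2_gt0 IC2 cf cf.
have mev := measurable_evU TU cf.
have [K fK] := evU_bounded TU cf.
rewrite /EI -EEZ//; apply: EE_ae_le; last 1 first.
- have FP := ae_filter_ringOfSetsType P; move: IC2; apply: filterS => o /andP[h1 _].
  have CI : 1 <= C2 * I (T o).2.
    by rewrite -(divff (lt0r_neq0 C2_gt0)) ler_wpM2l// ltW.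
  by rewrite -mulrA mulrA -expr2 ler_peMl// sqr_ge0.
- apply: (@Pint_bounded _ _ _ _ _ (K * K)); first exact: measurable_funM.
  by apply: aeW => o; rewrite normrM ler_pM.
- exact: PintZ.
Qed.

(** [bform_H_event] when lambda = h^(2m): with probability at least 1 - e, the
norm of the centered form is at most K n^(-1/2) h^-1, with K independent of n,
h and lambda. *)
Lemma bform_rate (omega : obs R p -> R) : measurable_fun setT omega ->
  Pint P (fun o => omega (T o) ^+ 2) -> forall e : R, 0 < e ->
  exists2 K : R, 0 <= K & forall lam h n, 0 < h <= 1 -> lam = h ^+ (2 * m) -> basis_cvg lam ->
    (0 < n)%N -> exists A : set Om, [/\ measurable A, (P A <= e%:E)%E &
      forall o, ~ A o -> forall f1 f2, Hpar per m f1 -> Hpar per m f2 ->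
      `|bform T Ts omega n (fun s => ev f1 (clampU s.2)) (fun s => ev f2 (clampU s.2)) o|
      <= K * (n%:R `^ (- 2^-1) * h^-1) * (Hnorm P T I lam m f1 * Hnorm P T I lam m f2)].
Proof.
move=> mo o2 e e0.
pose K1 := (1 + Ch) ^+ 4 * EE P (fun o => omega (T o) ^+ 2).
have K10 : 0 <= K1.
  by rewrite mulr_ge0 ?exprn_ge0 ?addr_ge0// EE_ge0// => o; exact: sqr_ge0.
(* q is chosen so that the Markov bound is at most e; K1 + 1 makes q positive *)
pose q := (K1 + 1) * (p%:R + Cw) ^+ 2 / e.
have pC0 : 0 < p%:R + Cw by rewrite ltr_wpDl.
have q0 : 0 < q by rewrite divr_gt0// mulr_gt0 ?exprn_gt0// ltr_wpDl.
exists (Num.sqrt q * (p%:R * Ct + Cg + 1)).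
  by rewrite mulr_ge0 ?sqrtr_ge0// !addr_ge0// mulr_ge0.
move=> lam h n h01 lamE hcvg n0; have /andP[h0 h1] := h01.
have n0' : 0 < n%:R :> R by rewrite ltr0n.
have lam_ge0 : 0 <= lam by rewrite lamE exprn_ge0// ltW.
have ws N : \sum_(nu < N) (wt lam gam nu)^-1 <= Cw / h by rewrite /wt lamE; exact: wt_sum.
pose t := n%:R^-1 * (h^-1) ^+ 2 * q.
have t0 : 0 < t by rewrite mulr_gt0// mulr_gt0 ?exprn_gt0 ?invr_gt0.
have [A [mA PA HA]] := bform_H_event m_gt0 TU mI C2_gt0 IC2 lam_ge0 cB cz_gt0 Z_lower hbH hb_le
  hbV hbJ hcvg ws Ct0 Cg0 thetaC par0C iid mo o2 n0 t0.
exists A; split => //.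
  apply: (le_trans PA); rewrite lee_fin ler_pdivrMr// -/K1.
  have -> : e * t = n%:R^-1 * (K1 + 1) * ((p%:R + Cw) / h) ^+ 2.
    by rewrite /t /q; field; rewrite !gt_eqF.
  apply: ler_pM.
  - by rewrite mulr_ge0// invr_ge0 ltW.
  - by rewrite sqr_ge0.
  - by rewrite ler_wpM2l ?invr_ge0 ?(ltW n0')// lerDl.
  - have Cwh : 0 <= Cw / h by rewrite divr_ge0 ?(ltW h0) ?(ltW Cw_gt0).
    have pCh : 0 <= (p%:R + Cw) / h by rewrite divr_ge0 ?(ltW h0) ?(ltW pC0).
    rewrite lerXn2r ?nnegrE ?addr_ge0//.
    by rewrite mulrDl lerD2r ler_pdivlMr// ler_piMr.
move=> o nA f1 f2 H1 H2; apply: le_trans (HA o nA f1 f2 H1 H2) _.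
rewrite ler_wpM2r ?mulr_ge0 ?sqrtr_ge0//.
have -> : Num.sqrt t = n%:R `^ (- 2^-1) * h^-1 * Num.sqrt q.
  rewrite /t -(sqr_half n0') -exprMn sqrtrM ?sqr_ge0// sqrtr_sqr ger0_norm//.
  by rewrite mulr_ge0 ?powR_ge0// invr_ge0 ltW.
by rewrite le_eqVlt; apply/orP; left; apply/eqP; ring.
Qed.

End empirical_rate.

(** The bound on the remainder in terms of the rates: b is the norm of the
estimation error, rt its rate, s = n^(-1/2) h^-1, hh = h^(-1/2),
q = (n h)^-1 + h^(2m), c = C_ell, L = log n, LL = (log log n)^(1/2), and
z = n^(-1/2) h^(-(6m-1)/(4m)). *)
Lemma remainder_algebra {R : realType} (hr b rt s hh q c C2 A2 K1 K2 M4 L LL z : R) :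
  0 <= b -> 0 <= rt -> 0 <= s -> 0 <= hh -> 0 <= q -> 0 <= c -> 0 <= C2 -> 0 <= A2 -> 0 <= K1 ->
  0 <= K2 -> 0 <= M4 -> 1 <= L -> 1 <= LL -> 
  hr <= K1 * s * b + A2 * hh * ((K2 * s + c * C2) * b ^+ 2) ->
  b <= M4 * rt -> hh * rt <= 1 -> rt ^+ 2 <= 2 * q -> s <= z ->
  hr <= (K1 * M4 + A2 * K2 * M4 ^+ 2 + 2 * A2 * C2 * M4 ^+ 2) *
    ((z * rt * LL + c * (hh * q / L)) * L).
Proof.
move=> b0 rt0 s0 hh0 q0 c0 C20 A20 K10 K20 M40 L1 LL1 H bM hrt rt2 sz.
have z0 : 0 <= z by exact: le_trans sz.
have L0 : L != 0 by rewrite gt_eqF// (lt_le_trans ltr01).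
have -> : (z * rt * LL + c * (hh * q / L)) * L = z * rt * (LL * L) + c * hh * q by field.
have LL0 : 1 <= LL * L by rewrite mulr_ege1.
have M0 : 0 <= M4 * rt by rewrite mulr_ge0.
have b2 : b ^+ 2 <= M4 ^+ 2 * rt ^+ 2 by rewrite -exprMn lerXn2r ?nnegrE.
have zr0 : 0 <= z * rt by rewrite mulr_ge0.
have zr : s * rt <= z * rt * (LL * L).
  apply: (@le_trans _ _ (z * rt)); first by rewrite ler_wpM2r.
  by rewrite ler_peMr.
apply: (le_trans H).
have T1 : K1 * s * b <= (K1 * M4) * (z * rt * (LL * L)).
  apply: (@le_trans _ _ (K1 * s * (M4 * rt))); first by rewrite ler_wpM2l// mulr_ge0.
  by rewrite (_ : _ * _ = K1 * M4 * (s * rt)) ?ler_wpM2l ?mulr_ge0//; ring.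
have T2 : A2 * hh * (K2 * s * b ^+ 2) <= A2 * K2 * M4 ^+ 2 * (z * rt * (LL * L)).
  apply: (@le_trans _ _ (A2 * hh * (K2 * s * (M4 ^+ 2 * rt ^+ 2)))).
    by rewrite ler_wpM2l ?mulr_ge0// ler_wpM2l ?mulr_ge0.
  rewrite (_ : _ * _ = (A2 * K2 * M4 ^+ 2) * ((hh * rt) * (s * rt))); last by ring.
  rewrite ler_wpM2l ?mulr_ge0 ?sqr_ge0//; apply: le_trans zr.
  by rewrite ler_piMl// mulr_ge0.
have T3 : A2 * hh * (c * C2 * b ^+ 2) <= 2 * A2 * C2 * M4 ^+ 2 * (c * hh * q).
  apply: (@le_trans _ _ (A2 * hh * (c * C2 * (M4 ^+ 2 * (2 * q))))).
    rewrite ler_wpM2l ?mulr_ge0// ler_wpM2l ?mulr_ge0//.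
    by apply: (le_trans b2); rewrite ler_wpM2l// sqr_ge0.
  by rewrite le_eqVlt; apply/orP; left; apply/eqP; ring.
have X0 : 0 <= z * rt * (LL * L) by rewrite mulr_ge0// (le_trans ler01).
have Y0 : 0 <= c * hh * q by rewrite !mulr_ge0.
have k1 : 0 <= K1 * M4 by rewrite mulr_ge0.
have k2 : 0 <= A2 * K2 * M4 ^+ 2 by rewrite !mulr_ge0 ?sqr_ge0.
have k3 : 0 <= 2 * A2 * C2 * M4 ^+ 2 by rewrite !mulr_ge0 ?sqr_ge0.
rewrite mulrDl mulrDr.
move: T1 T2 T3 X0 Y0 k1 k2 k3.
move: (K1 * s * b) (A2 * hh * (K2 * s * b ^+ 2)) (A2 * hh * (c * C2 * b ^+ 2)) => t1 t2 t3.
move: (z * rt * (LL * L)) (c * hh * q) (K1 * M4) (A2 * K2 * M4 ^+ 2) (2 * A2 * C2 * M4 ^+ 2).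
move=> X Y u v w T1 T2 T3 X0 Y0 k1 k2 k3.
have := mulr_ge0 k3 X0; have := mulr_ge0 k1 Y0; have := mulr_ge0 k2 Y0.
rewrite !mulrDl !mulrDr; lra.
Qed.

Unset Implicit Arguments.
Set Strict Implicit.
Set Printing Implicit Defensive.

Theorem theorem2p6 (R : realType) (d : measure_display) (Om : measurableType d)
  (P : probability Om R) (p m : nat) (per : bool)
  (Ycal : set R) (F : R -> R) (ell : R -> R -> R)
  (T : {RV P >-> obs R p})
  (Ts : nat -> {RV P >-> obs R p})
  (f0 : par R p) (lo hi : R)
  (lam : nat -> R) (fhat : nat -> Om -> par R p)
  (I : cov R p -> R) (B : R -> R) (G : 'I_p -> R -> R)
  (Rep : nat -> cov R p -> par R p)
  (Pl : nat -> par R p -> par R p)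
  (L3 : cov R p -> \bar R)
  (h := fun n => bandwidth m (lam n))
  (Cell := ereal_sup [set L3 u | u in Ucal])
  (m_gt0 : (0 < m)%N)
  (mY : measurable Ycal)
  (mell : forall a, measurable_fun Ycal (fun y => ell y a))
  (T_range : forall o, Ycal (T o).1 /\ Ucal (T o).2)
  (Ts_range : forall i o, Ycal (Ts i o).1 /\ Ucal (Ts i o).2)
  (Ts_iid : iid_copies P T Ts)
  (Z_dens : Z_has_density P T)
  (f0_H : Hpar per m f0)
  (model : mean_model P T F f0)
  (crit : loglik_criterion P T Ycal F ell f0
          \/ quasilik_criterion P T Ycal F ell)
  (lam_gt0 : forall n, 0 < lam n)
  (lam_cvg0 : lam n @[n --> \oo] --> (0 : R))
  (fhatP : forall n, (0 < n)%N -> {ae P, forall o,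
     is_maximizer (Hpar per m)
       (pen_crit ell (lam n) m n (fun i => Ts i o)) (fhat n o)})
  (I_def : is_I P T ell f0 I) (B_def : is_B P T I B) (G_def : is_G P T I B G)
  (Rep_def : forall n u, Ucal u ->
     is_representer P T I per (lam n) m u (Rep n u))
  (Pl_def : forall n, is_Plambda P T I per (lam n) m (Pl n))
  (L3_def : is_cexp P (fun o => (T o).2)
     (fun o => supabs_deriv ell lo hi 3 (T o).1) L3)
  (A1 : assumption_A1 P T I Ycal ell f0 lo hi)
  (A2 : assumption_A2 P T B per m lam)
  (A3 : assumption_A3 P T I G)
  (A4 : OP P (fun n o => Hnorm P T I (lam n) m (fhat n o - f0))
          (fun n => (rate m n (h n))%:E))
  (h_cvg0 : h n @[n --> \oo] --> (0 : R))
  (nh2_cvgy : n%:R * h n ^+ 2 @[n --> \oo] --> +oo) :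
  OP P (fun n o => Hnorm P T I (lam n) m (fhat n o - f0
        - S_nl ell f0 (fun i => Ts i o) (Rep n) (Pl n) n))
    (fun n => (a_rate Cell m n (h n) * (ln n%:R)%:E)%E).

Proof.
have TU o : Ucal (T o).2 by have [] := T_range o.
case: A1 => ell_der ell_cont _ f0_in [C0 [C1 [C0_gt0 C1_gt0 mom2 mom3]]] [C2 C2_gt0 IC2] _ _ _.
have FP := ae_filter_ringOfSetsType P.
have mU := measurable_U T; have mZ := measurable_Z T.
have mI : measurable_fun setT I.
  have [_ _ /measurable_EFinP mNI _] := I_def.
  rewrite (_ : I = (fun u => - (- I u))); last by apply/funext => u; rewrite opprK.
  exact: measurable_funN.
have IIU : Pint P (fun o => I (T o).2) by exact: (Pint_IU mI C2_gt0 IC2).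
have cB : cexpR P (fun o => (T o).2.2) (fun o => I (T o).2) B.
  by apply: is_cexp_cexpR => //; exact: B_def.
case: A2 => hb [gam [hbH [[Ch hb_le] [_ [[cg cg_gt0 gam_cvg] [hbV [hbJ hb_cvg]]]]]]].
have gam_ge0 nu : 0 <= gam nu by have := J_ge0 m (hb nu); rewrite hbJ eqxx mulr1.
have [Cw Cw_gt0 wt_sum] := weight_sum m_gt0 gam_ge0 cg_gt0 gam_cvg.
have [cz cz_gt0 Z_lower] := Z_has_density_lower Z_dens.
have Hc (f : par R p) : Hpar per m f -> contI f.2 by exact: (Hpar_contI m_gt0).
have cf0 : contI f0.2 by exact: (Hc f0 f0_H).
have [gap gap_gt0 f0_gap] := ev_gap cf0 f0_in.
have HIk k : exists IXk : R -> R,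
    cexpR P (fun o => (T o).2.2) (fun o => I (T o).2 * tnth (T o).2.1 k) IXk /\
    forall z, G k z = IXk z / B z.
  have [IXk h1 h2] := G_def k; exists IXk; split => //.
  apply: is_cexp_cexpR => //.
  rewrite (_ : (fun o => _) = fun o => tnth (T o).2.1 k * I (T o).2); last first.
    by apply/funext => o; rewrite mulrC.
  apply: (@Pint_mulb _ _ _ _ _ _ 1) => //.
    apply: (measurableT_comp (measurable_tnth k)).
    exact: (measurableT_comp measurable_fst mU).
  by apply: aeW => o; have [/(_ k)/andP[x0 x1] _] := TU o; rewrite ger0_norm.
have [IX HIX] := choice HIk.
have [_ Om_pos] := A3.
have [Ct [Ct0 thetaC]] := theta_le TU mI C2_gt0 IC2 cB (fun k => (HIX k).1) (fun k => (HIX k).2) Om_pos.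
have [Cg [Cg0 par0C]] := par0_le TU mI C2_gt0 IC2 cB (fun k => (HIX k).1) (fun k => (HIX k).2) Om_pos.
pose om1 := om_second Ycal ell f0.
pose om2 : obs R p -> R := om_third Ycal ell lo hi.
have mom1 : measurable_fun setT om1 by exact: (measurable_om_second mY mell cf0 ell_der f0_in).
have mo2 : measurable_fun setT om2 by exact: (measurable_om_third mY mell ell_der ell_cont f0_in).
have om1s : Pint P (fun o => om1 (T o) ^+ 2).
  exact: (om_second_sqr mY mell T_range cf0 ell_der f0_in C0_gt0 C1_gt0 mom2).
have om2s : Pint P (fun o => om2 (T o) ^+ 2).
  exact: (om_third_sqr mY mell T_range ell_der ell_cont f0_in C0_gt0 C1_gt0 mom3).
have Cell0 : (0 <= Cell)%E by exact: (Cell_ge0 T_range f0_in L3_def).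
have h_gt0 n : 0 < h n by exact: powR_gt0.
have lamE n : lam n = h n ^+ (2 * m) by rewrite /h bandwidthK// ltW.
have lam_ge0 n : 0 <= lam n by exact: ltW.
have h_le1 : \forall n \near \oo, h n <= 1.
  have /cvgrPdist_le/(_ _ ltr01) := h_cvg0; apply: filterS => n.
  by rewrite sub0r normrN ger0_norm// ltW.
have ln1 : \forall n \near \oo, 1 <= ln (n%:R : R) /\ 1 <= ln (ln (n%:R : R)).
  exists (Num.truncn (expR (expR 1 : R))).+1 => // n /= hn.
  have e1 : expR (expR 1) <= n%:R :> R.
    apply/ltW/(lt_le_trans (truncnS_gt _)); first by rewrite ler_nat.
  have ee : expR 1 <= ln (n%:R : R) 
    by rewrite -[leLHS]expRK ler_ln// posrE ?expR_gt0// (lt_le_trans (expR_gt0 _) e1).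
  split; first by apply: le_trans ee; apply: le_trans (expR_ge1Dx 1); rewrite lerDl.
  by rewrite -[leLHS]expRK ler_ln ?posrE ?expR_gt0// (lt_le_trans (expR_gt0 _) ee).
move=> e e0.
have e3 : 0 < e / 3 by rewrite divr_gt0.
(* one third for the rate of fhat and one third for each empirical form *)
have eE : e%:E = ((e / 3)%:E + (e / 3)%:E + (e / 3)%:E)%E.
  by rewrite -!EFinD; congr EFin; field.
have [M4 M40 HA4] := A4 _ e3.
have [K1 K10 HK1] := bform_rate m_gt0 TU mI C2_gt0 IC2 cB cz_gt0 Z_lower hbH hb_le hbV hbJ
  Cw_gt0 wt_sum Ct0 Cg0 thetaC par0C Ts_iid mom1 om1s e3.
have [K2 K20 HK2] := bform_rate m_gt0 TU mI C2_gt0 IC2 cB cz_gt0 Z_lower hbH hb_le hbV hbJ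
  Cw_gt0 wt_sum Ct0 Cg0 thetaC par0C Ts_iid mo2 om2s e3.
set A2' := sup_const (p := p) Ch Cw Ct Cg.
have A20 : 0 <= A2' by exact: (sup_const_ge0 Cw hb_le Ct Cg).
pose M := K1 * M4 + A2' * K2 * M4 ^+ 2 + 2 * A2' * C2 * M4 ^+ 2 + 1.
have M0 : 0 < M.
  by rewrite ltr_wpDl// !addr_ge0 ?mulr_ge0 ?sqr_ge0 ?(ltW M40) ?(ltW C2_gt0).
(* sup |delta| <= A2' M4 ep <= gap once h^(-1/2) times the rate is at most ep *)
pose ep := Num.min 1 (gap / (A2' * M4 + 1)).
have AM0 : 0 <= A2' * M4 by rewrite mulr_ge0// ltW.
have AM : 0 < A2' * M4 + 1 by rewrite ltr_wpDl.
have ep0 : 0 < ep by rewrite lt_min ltr01 divr_gt0.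
have nh2 : \forall n \near \oo, 4 / ep ^+ 2 <= n%:R * h n ^+ 2.
  by move/cvgryPge : nh2_cvgy; exact.
have hep : \forall n \near \oo, h n <= (ep / 2) ^+ 2.
  have q0 : 0 < (ep / 2) ^+ 2 by rewrite exprn_gt0// divr_gt0.
  have /cvgrPdist_le/(_ _ q0) := h_cvg0; apply: filterS => n.
  by rewrite sub0r normrN ger0_norm// ltW.
exists M => //; near=> n.
have h1 : h n <= 1 by near: n.
have [L1 LL1] : 1 <= ln (n%:R : R) /\ 1 <= ln (ln (n%:R : R)) by near: n.
have hA4 : (mu_ext P [set o | M4%:E * (rate m n (h n))%:E <
    (Hnorm P T I (lam n) m (fhat n o - f0))%:E] <= (e / 3)%:E)%E by near: n.
have n0 : (0 < n)%N by near: n; exists 1%N.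
have n0' : 0 < n%:R :> R by rewrite ltr0n.
have hn2 : 4 / ep ^+ 2 <= n%:R * h n ^+ 2 by near: n.
have hhep : h n <= (ep / 2) ^+ 2 by near: n.
have h01 : 0 < h n <= 1 by rewrite h_gt0.
have [B1 [mB1 PB1 HB1]] := HK1 _ _ _ h01 (lamE n) (hb_cvg n) n0.
have [B2 [mB2 PB2 HB2]] := HK2 _ _ _ h01 (lamE n) (hb_cvg n) n0.
pose good o := is_maximizer (Hpar per m) (pen_crit ell (lam n) m n (fun i => Ts i o)) (fhat n o) /\
  forall i, (supabs_deriv ell lo hi 3 (Ts i o).1 < +oo)%E.
have Ngood : P.-negligible (~` [set o | good o]).
  have : {ae P, forall o, good o}.
    move: (fhatP n n0) (sample_supabs3_fin mY mell ell_der ell_cont f0_in C0_gt0 C1_gt0 mom3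
      Ts_iid Ts_range).
    by apply: filterS2 => o ? ?; split.
  exact.
rewrite eE.
apply: (mu_ext_union_le _ mB1 mB2 Ngood hA4 PB1 PB2).
move=> o /= bad; apply: contrapT => /not_orP[/not_orP[/not_orP[nA nB1] nB2] /contrapT[fmax fin]].
move: bad.
set b := Hnorm P T I (lam n) m (fhat n o - f0).
have b0 : 0 <= b by exact: sqrtr_ge0.
have bM : b <= M4 * rate m n (h n).
  by rewrite leNgt; apply/negP => hlt; apply: nA; rewrite /= -EFinM lte_fin.
have rt0 : 0 <= rate m n (h n) by rewrite /rate addr_ge0 ?powR_ge0// exprn_ge0// ltW.
have hh0 : 0 <= h n `^ (- 2^-1) by exact: powR_ge0.
have hrt : h n `^ (- 2^-1) * rate m n (h n) <= ep by exact: rate_small.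
pose q := (n%:R * h n)^-1 + h n ^+ (2 * m).
have q0 : 0 <= q by rewrite addr_ge0 ?invr_ge0 ?mulr_ge0 ?exprn_ge0// ltW.
have z0 : 0 <= n%:R `^ (- 2^-1) :> R by exact: powR_ge0.
have LL0 : 1 <= ln (ln (n%:R : R)) `^ 2^-1.
  by rewrite -[leLHS](powRr0 (ln (ln n%:R))); apply: ler_powR => //; rewrite invr_ge0.
(* if C_ell is infinite the rate is infinite and the event is empty *)
have [CE|[c CE c0]] : Cell = +oo%E \/ exists2 c : R, Cell = c%:E & 0 <= c.
  by case: (Cell) Cell0 => [c c0|_|//]; [right; exists c|left].
  have L0 : (0 < (ln (n%:R : R))%:E)%E by rewrite lte_fin (lt_le_trans ltr01).
  have y0 : (0 < (h n `^ (- 2^-1) * q / ln (n%:R : R))%:E)%E.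
    rewrite lte_fin; apply: divr_gt0; last by rewrite (lt_le_trans ltr01).
    apply: mulr_gt0; first exact: powR_gt0.
    by rewrite ltr_pwDl ?invr_gt0 ?mulr_gt0// exprn_ge0// ltW.
  by rewrite /a_rate CE gt0_mulye// addey// gt0_mulye// gt0_muley// lte_fin.
have key : Hnorm P T I (lam n) m (fhat n o - f0 - S_nl ell f0 (fun i => Ts i o) (Rep n) (Pl n) n)
    <= K1 * (n%:R `^ (- 2^-1) * (h n)^-1) * b + (A2' * h n `^ (- 2^-1)) *
      ((K2 * (n%:R `^ (- 2^-1) * (h n)^-1) + c * C2) * b ^+ 2).
  have S0 : 0 <= n%:R `^ (- 2^-1) * (h n)^-1 by rewrite mulr_ge0// invr_ge0 ltW.
  have csup0 : 0 <= A2' * h n `^ (- 2^-1) by rewrite mulr_ge0.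
  have evs f u : Hpar per m f -> Ucal u ->
      `|ev f u| <= A2' * h n `^ (- 2^-1) * Hnorm P T I (lam n) m f.
    move=> Hf Uu; exact: (ev_le_rate m_gt0 TU mI C2_gt0 IC2 cB cz_gt0 Z_lower hbH hb_le hbV hbJ
      Cw_gt0 wt_sum Ct0 Cg0 thetaC par0C h01 (lamE n) (hb_cvg n) Hf Uu).
  have om1I f1 f2 : Hpar per m f1 -> Hpar per m f2 ->
      EE P (fun o => om1 (T o) * ev f1 (clampU (T o).2) * ev f2 (clampU (T o).2)) = - EI T I f1 f2.
    move=> /Hc cf1 /Hc cf2.
    exact: (EE_om_second mY mell T_range cf0 ell_der f0_in C0_gt0 C1_gt0 mom2 I_def cf1 cf2).
  have om2K f : Hpar per m f ->
      EE P (fun o => om2 (T o) * ev f (clampU (T o).2) * ev f (clampU (T o).2)) <=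
      c * C2 * Hnorm P T I (lam n) m f ^+ 2.
    move=> Hf; have cf := Hc f Hf.
    apply: (le_trans (EE_om_third mY mell T_range ell_der ell_cont f0_in C0_gt0 C1_gt0 mom3 L3_def CE cf)).
    by rewrite -mulrA ler_wpM2l//; exact: (EE_sqr_ev_le m_gt0 TU mI C2_gt0 IC2 (lam_ge0 n) Hf).
  have cC20 : 0 <= c * C2 by rewrite mulr_ge0// ltW.
  apply: (remainder_le m_gt0 TU mI C2_gt0 IC2 (lam_ge0 n) f0_H (Rep_def n) (Pl_def n)
    (fun y a Yy => ell_der y a 0 Yy isT) (fun y a Yy => ell_der y a 1 Yy isT)
    (fun y a Yy => ell_der y a 2 Yy isT) f0_gap csup0 evs (@om_secondE _ _ Ycal ell f0) om1I om2K cC20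
    (fun i => Ts_range i o) (om_third_bound f0_in Ts_range fin) fmax (HB1 o nB1) (HB2 o nB2)).
  - by rewrite mulr_ge0.
  - by rewrite mulr_ge0.
  - apply: (@le_trans _ _ ((A2' * M4 + 1) * ep)); last first.
      rewrite -(@divfK _ (A2' * M4 + 1) _ gap) ?gt_eqF// mulrC ler_wpM2r ?(ltW AM)//.
      by rewrite ge_min lexx orbT.
    apply: (@le_trans _ _ (A2' * M4 * (h n `^ (- 2^-1) * rate m n (h n)))).
      rewrite (_ : A2' * M4 * _ = A2' * h n `^ (- 2^-1) * (M4 * rate m n (h n))); last by ring.
      by rewrite ler_wpM2l// mulr_ge0.
    by apply: ler_pM => //; rewrite ?mulr_ge0// lerDl.
have K : Hnorm P T I (lam n) m (fhat n o - f0 - S_nl ell f0 (fun i => Ts i o) (Rep n) (Pl n) n) <=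
    (M - 1) * ((n%:R `^ (- 2^-1) * h n `^ (- ((6 * m)%:R - 1) / (4 * m)%:R) * rate m n (h n) *
      ln (ln n%:R) `^ 2^-1 + c * (h n `^ (- 2^-1) * q / ln n%:R)) * ln n%:R).
  rewrite /M addrK; apply: (remainder_algebra (b := b) (rt := rate m n (h n))
     (s := n%:R `^ (- 2^-1) * (h n)^-1)) => //.
  - by rewrite mulr_ge0// invr_ge0 ltW.
  - exact: ltW.
  - exact: ltW.
  - by apply: (le_trans hrt); rewrite ge_min lexx.
  - exact: rate_sqr_le.
  - by rewrite ler_wpM2l//; exact: inv_le_powR.
rewrite /a_rate CE -!EFinM lte_fin; apply/negP; rewrite -leNgt.
apply: (le_trans K); rewrite mulrBl mul1r.
set X := (_ + _) * ln n%:R; set X' := (_ + _) * ln n%:R.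
have -> : X' = X by rewrite /X /X'; congr ((_ + _) * _); ring.
rewrite gerBl mulr_ge0 ?(le_trans ler01 L1)// addr_ge0//.
  by rewrite !mulr_ge0 ?powR_ge0.
by rewrite mulr_ge0// divr_ge0 ?(le_trans ler01 L1)// mulr_ge0.
Unshelve. all: by end_near. Qed.
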